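(* Let $\gamma>0$, $m\in\mathbb N$, $m\ge1$, and let $\{c_\xi\}_{\xi\in\mathcal Z^2}$ be a random field on a complete probability space $(\Omega,\mathcal F,\mathbb P)$ which satisfies $\sup_\xi|c_\xi(\omega)|<\frac1{4\gamma}$ for $\mathbb P$-a.e. $\omega$, is $m$-stationary, and is $\alpha$-mixing with $\sum_{n\ge1}\alpha(n)<+\infty$. Then for $\mathbb P$-almost every $\omega\in\Omega$ the following holds. Let $\varepsilon_j\downarrow0$ and let $A_j^0(\omega)\in\mathcal A_{\varepsilon_j}$ be coordinate rectangles converging in the Hausdorff metric to a coordinate rectangle $A(\omega)$. For each $j$ let $A_{\varepsilon_j}(t)(\omega)$ be a discrete flat flow with initial set $A_j^0(\omega)$. Then there is a subsequence (not relabeled) such that $A_{\varepsilon_j}(t)(\omega)$ converges locally in time to $A(t)(\omega)$, where $A(t)(\omega)$ is a coordinate rectangle with sides $S_1(t)(\omega),\dots,S_4(t)(\omega)$ such that $A(0)(\omega)=A(\omega)$, and each side $S_i(t)(\omega)$ moves inward with velocity $v_i(t)(\omega)$ satisfying, with $L_i(t)(\omega):=\mathcal H^1(S_i(t)(\omega))$, $$v_i(t)(\omega)\begin{cases}=\frac1\gamma v_i^{\mathrm{eff}}(L_i(t)(\omega))&\text{if }L_i(t)(\omega)\notin\mathcal S_i,\\[2mm]\in\frac1\gamma\left[(v_i^{\mathrm{eff}})^{(-)}(L_i(t)(\omega)),\ (v_i^{\mathrm{eff}})^{(+)}(L_i(t)(\omega))\right]&\text{otherwise.}\end{cases}$$ The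 inclusions are valid until the extinction time, i.e. the first time at which some $L_i(t)(\omega)=0$.
   Context: **Random field.** $\mathcal Z^2:=\{\frac{i+j}2:\ i,j\in\mathbb Z^2,\ |i-j|=1\}$ is the dual lattice. A measure preserving group action $\{\tau_z\}_{z\in\mathbb Z^2}$ on $\Omega$ is a family of measurable maps $\tau_z:\Omega\to\Omega$ with $\tau_{z_1+z_2}=\tau_{z_2}\circ\tau_{z_1}$ and $\mathbb P(\tau_zB)=\mathbb P(B)$ for all $B\in\mathcal F$, $z\in\mathbb Z^2$. The field $\{c_\xi\}$ of real random variables is $m$-stationary if, for such an action, $c_\xi(\tau_{mz}\omega)=c_{\xi+mz}(\omega)$ for all $z\in\mathbb Z^2$, $\xi\in\mathcal Z^2$. It is $\alpha$-mixing (with rate $\alpha$) if there is a sequence $\alpha(n)\to0$ such that for all $I_1,I_2\subset\mathcal Z^2$ with $\mathrm{dist}(I_1,I_2)\ge n$ one has $\sup\{|\mathbb P(A\cap B)-\mathbb P(A)\mathbb P(B)|:A\in\mathcal F_{I_1},B\in\mathcal F_{I_2}\}\le\alpha(n)$, where $\mathcal F_I=\sigma(c_\xi:\xi\in I)$. **Minimizing movement scheme.** For $\varepsilon>0$ let $Q_\varepsilon(x)=x+[-\frac\varepsilon2,\frac\varepsilon2)^2$ and let $\mathcal A_\varepsilon$ be the class of sets of the form $\bigcup_{i\in\mathcal I}Q_\varepsilon(i)$ with $\mathcal I\subset\varepsilon\mathbb Z^2$. For $A\in\mathcal A_\varepsilon$ put $P_\varepsilon^\omega(A)=\sum_{\xi\in\mathcal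 Z^2:\ \varepsilon\xi\in\partial A}\varepsilon(1+\varepsilon c_\xi(\omega))$. For $x\in Q_\varepsilon(i)$, $i\in\varepsilon\mathbb Z^2$, let $d^\varepsilon_\infty(x,\partial A)=\inf\{\|i-j\|_\infty:j\in\varepsilon\mathbb Z^2\setminus A\}$ if $i\in A$, and $=\inf\{\|i-j\|_\infty:j\in\varepsilon\mathbb Z^2\cap A\}$ if $i\notin A$. Set $\tau=\gamma\varepsilon$ and $$E_\varepsilon^\omega(A,F)=P_\varepsilon^\omega(A)+\frac1{\gamma\varepsilon}\int_{A\Delta F}d_\infty^\varepsilon(x,\partial F)\,dx,\qquad A,F\in\mathcal A_\varepsilon.$$ Given an initial set $A_\varepsilon^0(\omega)\in\mathcal A_\varepsilon$, choose recursively $A_\varepsilon^{k+1}(\omega)$ to be any minimizer over $\mathcal A_\varepsilon$ of $A\mapsto E_\varepsilon^\omega(A,A_\varepsilon^k(\omega))$ (the choice may be non-unique). A discrete flat flow is the interpolation $A_\varepsilon(t)(\omega):=A_\varepsilon^{\lfloor t/(\gamma\varepsilon)\rfloor}(\omega)$, $t\ge0$. **Effective velocity.** For $k=0,\dots,m-1$ put $$\mu_k=\mathbb E\Big[\frac1m\sum_{j=0}^{m-1}c_{(k+\frac12,\,j)}\Big],\qquad \lambda_k=\mathbb E\Big[\frac1m\sum_{j=0}^{m-1}c_{(j,\,k+\frac12)}\Big],$$ and extend both $m$-periodically to $k\in\mathbb Z$. To each side $S_i$ of a coordinate rectangle associate an $m$-periodic sequence $(a^i_k)_{k\in\mathbb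 Z}$: $a^i_k=\mu_k$ if $S_i$ is the left vertical side, $a^i_k=\mu_{-k}$ for the right vertical side, $a^i_k=\lambda_k$ for the lower horizontal side, $a^i_k=\lambda_{-k}$ for the upper horizontal side. The set of singular lengths is $$\mathcal S_i=\{L\in(0,+\infty):\ 2\gamma/L\in\mathbb N_0+\gamma(a^i_k-a^i_{k-1})\text{ for some }k\}.$$ For $n\in\mathbb Z$, $L>0$ and $N\in\mathbb N_0$ let $$v_i^{n,L}(N)=-2N+L\,a^i_{n+N}+\frac L{2\gamma}N(N+1).$$ For $L\notin\mathcal S_i$ the minimizer of $v_i^{n,L}$ over $\mathbb N_0$ is unique for every $n$. Starting from $n_0\in\mathbb Z$ define recursively $N_{l+1}=\operatorname{argmin}_Nv_i^{n_l,L}(N)$, $n_{l+1}=n_l+N_{l+1}$. There are integers $\tilde l\ge0$, $T_i\ge1$, $M_i\ge0$ with $n_{l+T_i}-n_l=M_im$ for all $l\ge\tilde l$, and $M_i/T_i$ does not depend on $n_0$; the effective velocity $v_i^{\mathrm{eff}}:(0,+\infty)\setminus\mathcal S_i\to[0,+\infty)$ is $v_i^{\mathrm{eff}}(L)=M_im/T_i$. For $L>0$, $(v_i^{\mathrm{eff}})^{(-)}(L)=\liminf_{y\to L}v_i^{\mathrm{eff}}(y)$ and $(v_i^{\mathrm{eff}})^{(+)}(L)=\limsup_{y\to L}v_i^{\mathrm{eff}}(y)$, with $y$ in the domain of $v_i^{\mathrm{eff}}$. **Conventions.** A coordinate rectangle is a (non-degenerate) rectangle with all sides parallel to the coordinate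 axes. $\mathcal H^1$ is the one-dimensional Hausdorff measure. Let $T\in(0,+\infty]$ be the extinction time. Convergence locally in time means convergence in the Hausdorff metric, uniformly for $t$ in compact subsets of $[0,T)$. ''Moves inward with velocity $v_i$'' means that the position of side $S_i(t)$, measured along the coordinate direction orthogonal to it and oriented towards the interior of the rectangle, is a locally Lipschitz function of $t\in[0,T)$ with derivative $v_i(t)$ for a.e. $t$; the inclusions are understood for a.e. $t\in[0,T)$. *)

(* Defs.v *)
From HB Require Import structures.
From mathcomp Require Import all_boot all_order all_algebra.
From mathcomp Require Import all_classical all_reals all_analysis.

Set Implicit Arguments.
Unset Strict Implicit.
Unset Printing Implicit Defensive.

Import Order.TTheory GRing.Theory Num.Theory.
Import numFieldNormedType.Exports.

Local Open Scope classical_set_scope.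
Local Open Scope ring_scope.

Section Plane.
Context {R : realType}.
Implicit Types (x y : R * R) (A B S : set (R * R)).

(* The library norm on a product is the maximum norm. *)
Definition enorm x : R := Num.sqrt (x.1 ^+ 2 + x.2 ^+ 2).

Definition infnorm x : R := Num.max `|x.1| `|x.2|.

Definition point_dist x B : \bar R :=
  ereal_inf [set (enorm (x - y))%:E | y in B].

Definition set_dist A B : \bar R := ereal_inf [set point_dist x B | x in A].

(* The constant 0 only matters for A = B = set0, where the suprema are -oo. *)
Definition hausdorff_dist A B : \bar R :=
  maxe 0%E (maxe (ereal_sup [set point_dist x B | x in A])
                 (ereal_sup [set point_dist y A | y in B])).

Definition topological_boundary A : set (R * R) := closure A `\` interior A.

(* The constant 0 only matters for A = set0, where the supremum is -oo. *)
Definition diam A : \bar R :=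
  maxe 0%E (ereal_sup [set (enorm (x - y))%:E | x in A & y in A]).

Definition hausdorff_premeasure1 (delta : R) S : \bar R :=
  ereal_inf [set (\sum_(0 <= n <oo) diam (U n))%E | U in
    [set U : nat -> set (R * R) |
       S `<=` \bigcup_n U n /\ forall n, (diam (U n) <= delta%:E)%E]].

(* The premeasures are nonincreasing in delta: this is the limit as delta
   tends to 0. The normalizing constant of the 1-dimensional measure is 1. *)
Definition hausdorff_measure1 S : \bar R :=
  ereal_sup [set hausdorff_premeasure1 delta S | delta in [set d : R | 0 < d]].

Definition zpoint (z : int * int) : R * R := (z.1%:~R, z.2%:~R).

(* The midpoints (i + j) / 2 of nearest neighbours i, j of Z^2; the sum of
   squares is the squared Euclidean norm of i - j. *)
Definition dual_lattice : set (R * R) :=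
  [set xi | exists i j : int * int,
     (i.1 - j.1) ^+ 2 + (i.2 - j.2) ^+ 2 = 1 /\
     xi = ((i.1 + j.1)%:~R / 2, (i.2 + j.2)%:~R / 2)].

End Plane.

(* A field is indexed by the whole plane; only its values on dual_lattice are
   ever used. *)
Section RandomField.
Context {R : realType} {d : measure_display} {T : measurableType d}.
Variable P : probability T R.
Implicit Types (c : R * R -> {RV P >-> R}) (alpha : nat -> R).

Definition measure_preserving_action (tau : int * int -> T -> T) : Prop :=
  [/\ forall z, measurable_fun setT (tau z),
      tau 0 = id,
      forall z1 z2, tau (z1 + z2) = tau z2 \o tau z1 &
      forall z (B : set T), measurable B -> P (tau z @` B) = P B].

Definition stationary_field (m : nat) c : Prop :=
  exists2 tau, measure_preserving_action tau &
    forall z xi w, dual_lattice xi ->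
      c xi (tau (z *+ m) w) = c (xi + zpoint (z *+ m)) w.

Definition field_sigma_algebra c (I : set (R * R)) : set (set T) :=
  <<s \bigcup_(xi in I) preimage_set_system setT (c xi) measurable >>.

Definition alpha_mixing c alpha : Prop :=
  alpha @ \oo --> (0 : R) /\
  forall (n : nat) (I1 I2 : set (R * R)), (0 < n)%N ->
    I1 `<=` dual_lattice -> I2 `<=` dual_lattice ->
    ((n%:R)%:E <= set_dist I1 I2)%E ->
    (ereal_sup [set `|P (A `&` B) - P A * P B|%E
       | A in field_sigma_algebra c I1 & B in field_sigma_algebra c I2]
     <= (alpha n)%:E)%E.

Definition mean_vertical (m : nat) c (k : int) : R :=
  let k' := (k %% m%:Z)%Z in
  fine ('E_P[(fun w => m%:R^-1 *
               \sum_(j < m) c (k'%:~R + 2^-1, j%:R) w)%R]).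

Definition mean_horizontal (m : nat) c (k : int) : R :=
  let k' := (k %% m%:Z)%Z in
  fine ('E_P[(fun w => m%:R^-1 *
               \sum_(j < m) c (j%:R, k'%:~R + 2^-1) w)%R]).

End RandomField.

Section MinimizingMovement.
Context {R : realType}.
Implicit Types (eps gamma : R) (x i : R * R) (A F : set (R * R)).

Definition eps_lattice eps : set (R * R) :=
  [set x | exists z : int * int, x = eps *: zpoint z].

Definition cell eps i : set (R * R) :=
  [set x | i.1 - eps / 2 <= x.1 < i.1 + eps / 2 /\
           i.2 - eps / 2 <= x.2 < i.2 + eps / 2].

Definition lattice_set eps A : Prop :=
  exists2 I, I `<=` eps_lattice eps & A = \bigcup_(i in I) cell eps i.

(* The centre i of the unique cell containing x. *)
Definition cell_center eps x : R * R :=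
  (eps * (Num.floor (x.1 / eps + 2^-1))%:~R,
   eps * (Num.floor (x.2 / eps + 2^-1))%:~R).

Definition lattice_dist eps F x : \bar R :=
  let i := cell_center eps x in
  if i \in F then
    ereal_inf [set (infnorm (i - j))%:E | j in eps_lattice eps `\` F]
  else
    ereal_inf [set (infnorm (i - j))%:E | j in eps_lattice eps `&` F].

Definition perimeter_term eps (c : R * R -> R) (xi : R * R) : \bar R :=
  (eps * (1 + eps * c xi))%:E.

(* esum is meant for nonnegative families. All terms are nonnegative once
   eps * sup |c| <= 1; splitting keeps the sum meaningful for larger eps. *)
Definition perimeter eps (c : R * R -> R) A : \bar R :=
  let D := [set xi | dual_lattice xi /\ topological_boundary A (eps *: xi)] in
  (esum D (perimeter_term eps c)^\+ - esum D (perimeter_term eps c)^\-)%E.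

Definition energy gamma eps (c : R * R -> R) A F : \bar R :=
  (perimeter eps c A +
   ((gamma * eps)^-1)%:E *
   \int[(@lebesgue_measure R \x @lebesgue_measure R)%E]_(x in A `+` F)
      lattice_dist eps F x)%E.

Definition discrete_flat_flow gamma eps (c : R * R -> R) A0
    (At : R -> set (R * R)) : Prop :=
  exists Ak : nat -> set (R * R),
    [/\ Ak 0%N = A0,
        forall k, lattice_set eps (Ak k),
        forall k A, lattice_set eps A ->
          (energy gamma eps c (Ak k.+1) (Ak k) <= energy gamma eps c A (Ak k))%E &
        forall t, 0 <= t -> At t = Ak (Num.truncn (t / (gamma * eps)))].

End MinimizingMovement.

Inductive side := LeftSide | RightSide | LowerSide | UpperSide.

Section Rectangles.
Context {R : realType}.

Record box := Box { xmin : R ; xmax : R ; ymin : R ; ymax : R }.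

Implicit Types (q : box) (s : side) (A : set (R * R)).

(* Elements of lattice_set are unions of half-open cells, so the part of the
   boundary that belongs to the rectangle is left free. *)
Definition rectangle_with_box q A : Prop :=
  [/\ xmin q < xmax q, ymin q < ymax q,
      [set x : R * R | xmin q < x.1 < xmax q /\ ymin q < x.2 < ymax q] `<=` A &
      A `<=` [set x : R * R |
                xmin q <= x.1 <= xmax q /\ ymin q <= x.2 <= ymax q]].

Definition coordinate_rectangle A : Prop := exists q, rectangle_with_box q A.

Definition box_side q s : set (R * R) :=
  match s with
  | LeftSide  => [set x | x.1 = xmin q /\ ymin q <= x.2 <= ymax q]
  | RightSide => [set x | x.1 = xmax q /\ ymin q <= x.2 <= ymax q]
  | LowerSide => [set x | x.2 = ymin q /\ xmin q <= x.1 <= xmax q]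
  | UpperSide => [set x | x.2 = ymax q /\ xmin q <= x.1 <= xmax q]
  end.

Definition side_length q s : R := fine (hausdorff_measure1 (box_side q s)).

Definition inward_position q s : R :=
  match s with
  | LeftSide  => xmin q
  | RightSide => - xmax q
  | LowerSide => ymin q
  | UpperSide => - ymax q
  end.

End Rectangles.

Arguments box R : clear implicits.

Section EffectiveVelocity.
Context {R : realType}.
Variables (gamma : R) (m : nat) (a : int -> R).
Implicit Types (L : R) (n : int) (N : nat).

Definition singular_lengths : set R :=
  [set L | 0 < L /\
     exists (N : nat) (k : int), 2 * gamma / L = N%:R + gamma * (a k - a (k - 1))].

Definition step_energy L n N : R :=
  - (2 * N%:R) + L * a (n + N%:Z) + L / (2 * gamma) * (N%:R * (N%:R + 1)).

Definition argmin_step L n : nat :=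
  get [set N | forall N', step_energy L n N <= step_energy L n N'].

Definition orbit_step L n : int := n + (argmin_step L n)%:Z.

Definition step_orbit L (n0 : int) (l : nat) : int := iter l (orbit_step L) n0.

Definition is_effective_velocity L (v : R) : Prop :=
  forall n0 : int, exists l0 tt M : nat,
    [/\ (0 < tt)%N,
        forall l, (l0 <= l)%N ->
          step_orbit L n0 (l + tt) - step_orbit L n0 l = (M * m)%:Z &
        v = (M * m)%:R / tt%:R].

(* Meaningful for L in effective_domain only. *)
Definition effective_velocity L : R := get (is_effective_velocity L).

Definition effective_domain : set R := [set L | 0 < L] `\` singular_lengths.

Definition effective_velocity_inf L : \bar R :=
  limf_einf (fun y => (effective_velocity y)%:E)
            (within effective_domain (nbhs L)).

Definition effective_velocity_sup L : \bar R :=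
  limf_esup (fun y => (effective_velocity y)%:E)
            (within effective_domain (nbhs L)).

Definition velocity_law L (v : R) : Prop :=
  (~ singular_lengths L -> v = gamma^-1 * effective_velocity L) /\
  (singular_lengths L ->
     ((gamma^-1)%:E * effective_velocity_inf L <= v%:E)%E /\
     (v%:E <= (gamma^-1)%:E * effective_velocity_sup L)%E).

End EffectiveVelocity.

Definition side_sequence {R : realType} {d : measure_display}
    {T : measurableType d} (P : probability T R) (m : nat)
    (c : R * R -> {RV P >-> R}) (s : side) (k : int) : R :=
  match s with
  | LeftSide  => mean_vertical m c k
  | RightSide => mean_vertical m c (- k)
  | LowerSide => mean_horizontal m c k
  | UpperSide => mean_horizontal m c (- k)
  end.

Section Evolution.
Context {R : realType}.

(* [0, T), where T may be infinite. *)
Definition lifetime (T : \bar R) : set R :=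
  [set t | 0 <= t /\ (t%:E < T)%E].

Definition locally_lipschitz_on (D : set R) (f : R -> R) : Prop :=
  forall t, D t -> exists (K : R) (U : set R),
    nbhs t U /\ K.-lipschitz_(D `&` U) f.

Definition converges_locally_in_time (T : \bar R)
    (F : nat -> R -> set (R * R)) (A : R -> set (R * R)) : Prop :=
  forall K : set R, compact K -> K `<=` lifetime T ->
  forall e : R, 0 < e ->
    \forall j \near \oo, forall t, K t ->
      (hausdorff_dist (F j t) (A t) <= e%:E)%E.

(* All boxes are non-degenerate on [0, T) and their sides move inward, so T is
   the first time at which a side length vanishes as soon as one side length
   tends to 0 at T. *)
Definition extinction_time (T : \bar R) (q : R -> box R) : Prop :=
  (0 < T)%E /\
  forall T' : R, T = T'%:E ->
    exists s, side_length (q t) s @[t --> T'^'-] --> (0 : R).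

End Evolution.

(* Main.v *)
Require Import Defs.
From HB Require Import structures.
From mathcomp Require Import all_boot all_order all_algebra.
From mathcomp Require Import all_classical all_reals all_analysis measurable_realfun.
From mathcomp Require Import ring lra zify.

(* Record each side of a lattice rectangle by an integer that increases as the
   side moves inward.  Submodularity of the perimeter shows that a minimizer A
   of the energy with respect to a rectangle F is contained in F.  Cells of F
   lost far from the boundary are too expensive, so only boundedly many rows
   and columns of F next to its sides become empty, and comparing A with the
   rectangle spanned by the remaining ones shows that A is a rectangle.
   Comparing A with the rectangle in which one side is moved by a further cell
   shows that the displacement N of that side satisfies, up to an error
   vanishing with eps, the first-order condition for minimality of the step
   energy v^{n,L}: by the law of large numbers the sums of c along the sides
   can be replaced by their means.

   This law must hold along all lattice segments of macroscopic length at once.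
   A segment is cut into blocks of length 2^p.  Two non-adjacent blocks on the
   same line both deviate with probability at most (K/2^p)^2 + alpha(2^p) (the
   bound of the second moment and mixing), and since the summability of alpha
   gives that of 2^p alpha(2^p), Borel-Cantelli allows at most two bad blocks on
   every line.

   The positions of the sides converge along an ultrafilter.  The step is
   monotone in n and antitone in L, so that while the side length stays between
   L2 and L1 the discrete positions are squeezed between the orbits for L1 and
   L2, which advance by their effective velocities per step up to a bounded
   error.  Hence difference quotients of the limit position lie between
   v_eff(L1)/gamma and v_eff(L2)/gamma for all L2 < L < L1.  The limit positions
   are monotone and locally Lipschitz, hence differentiable almost everywhere. *)

Set Implicit Arguments.
Unset Strict Implicit.
Unset Printing Implicit Defensive.

Import Order.TTheory GRing.Theory Num.Theory.
Import numFieldNormedType.Exports.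

Local Open Scope classical_set_scope.
Local Open Scope ring_scope.

(** * Finite sets of unit cells *)

(** The bound 4 sup|c| < 1/gamma enters in two ways. A cell has four edges, whose weights deviate
    from 1 by at most eps sup|c|, while changing the state of a cell costs at least eps / gamma in
    dissipation; so the dissipation outweighs the fluctuation of the perimeter in the comparisons
    with rectangles. It also makes the step energy convex in [N], so that a first-order condition
    describes its minimizers, and such a condition, unlike exact minimality, tolerates small errors.
    An error in it is absorbed by a slight change of the length, after which only monotonicity is
    used.

    Pairs of blocks are considered because a single block of length l is bad with probability of
    order 1/l only, while a macroscopic window meets about l lines: the union bound over single
    blocks does not tend to 0. For two distant blocks the product of the probabilities gains another
    factor 1/l.

    Limits along an ultrafilter exist for every bounded family at once, so the subsequence is chosen
    only after the limit flow has been constructed. *)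

Definition window (n : nat) : seq int := [seq i%:Z - n%:Z | i <- iota 0 n.*2].

Lemma mem_window n k : (k \in window n) = (- n%:Z <= k < n%:Z).
Proof.
apply/mapP/idP => [[i]|].
  rewrite mem_iota => h ->; lia.
move=> h; exists (absz (k + n%:Z)); last by lia.
rewrite mem_iota; lia.
Qed.

Lemma window_uniq n : uniq (window n).
Proof. rewrite map_inj_uniq ?iota_uniq// => i j; lia. Qed.

Notation gset := (int -> int -> bool).

(** The lower bounds are strict, although [window n] starts at -n, so that the edges to the left of
    and below the set also have their index in the window. *)
Definition inside (n : nat) (A : gset) :=
  forall k j, A k j -> - n%:Z < k < n%:Z /\ - n%:Z < j < n%:Z.

Definition grect (l r b t : int) : gset :=
  fun k j => (l <= k < r) && (b <= j < t).

(** An edge carries the index of the cell to its left or below it; its midpoint is [vmid k j] or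
    [hmid k j]. *)
Definition vedge (A : gset) k j := A k j (+) A (k + 1) j.
Definition hedge (A : gset) k j := A k j (+) A k (j + 1).

Section WindowSums.
Context {R : realType}.
Implicit Types (f g : int -> int -> R) (n : nat) (A B : gset).

Definition wsum n f : R := \sum_(k <- window n) \sum_(j <- window n) f k j.

Lemma wsumD n f g : wsum n (fun k j => f k j + g k j) = wsum n f + wsum n g.
Proof.
rewrite /wsum -big_split; apply: eq_bigr => k _; exact: big_split.
Qed.

Lemma wsumZ n (x : R) f : wsum n (fun k j => x * f k j) = x * wsum n f.
Proof.
rewrite /wsum mulr_sumr; apply: eq_bigr => k _; by rewrite mulr_sumr.
Qed.

Lemma wsumB n f g : wsum n (fun k j => f k j - g k j) = wsum n f - wsum n g.
Proof.
rewrite -[- wsum n g]mulN1r -wsumZ -wsumD; congr wsum.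
by apply/funext => k; apply/funext => j; rewrite mulN1r.
Qed.

Lemma ler_wsum n f g : (forall k j, f k j <= g k j) -> wsum n f <= wsum n g.
Proof. by move=> h; apply: ler_sum => k _; apply: ler_sum => j _. Qed.

Lemma eq_wsum n f g : (forall k j, f k j = g k j) -> wsum n f = wsum n g.
Proof. by move=> h; apply: eq_bigr => k _; apply: eq_bigr => j _. Qed.

Lemma wsumC n f : wsum n f = wsum n (fun k j => f j k).
Proof. exact: exchange_big. Qed.

Lemma window_term n (g : int -> R) k : k \in window n -> (forall i, 0 <= g i) ->
  g k <= \sum_(i <- window n) g i.
Proof.
move=> kn g0; rewrite (bigD1_seq k)//= ?window_uniq// lerDl.
by apply: sumr_ge0.
Qed.

Lemma wsum_term n f k j : k \in window n -> j \in window n ->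
  (forall k j, 0 <= f k j) -> f k j <= wsum n f.
Proof.
move=> kn jn f0; apply: (le_trans (window_term jn (f0 k))).
apply: (@window_term n (fun k => \sum_(j <- window n) f k j)) => // i.
by apply: sumr_ge0.
Qed.

Lemma window_shift n (g : int -> R) :
  g (- n%:Z) = 0 -> g n%:Z = 0 ->
  \sum_(k <- window n) g (k + 1) = \sum_(k <- window n) g k.
Proof.
move=> g0 g1; apply/eqP; rewrite -subr_eq0 -sumrB /window big_map.
rewrite -[n.*2]subn0 -/(index_iota 0 n.*2).
rewrite (@telescope_sumr_eq _ _ _ (fun i => g (i%:Z - n%:Z)))//.
  have -> : n.*2%:Z - n%:Z = n%:Z by lia.
  by rewrite g1 sub0r oppr_eq0 add0r g0.
by move=> k _; congr (g _ - _); lia.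
Qed.

Lemma window_delta n (a : int) : a \in window n ->
  \sum_(k <- window n) ((k == a)%R)%:R = 1 :> R.
Proof.
move=> an; rewrite (bigD1_seq a)//= ?window_uniq// eqxx big1 ?addr0//.
by move=> i /negPf ->.
Qed.

Lemma window_itv n (a : int) (m : nat) : - n%:Z <= a -> a + m%:Z <= n%:Z ->
  \sum_(k <- window n) ((a <= k < a + m%:Z)%R)%:R = m%:R :> R.
Proof.
move=> an; elim: m => [|m IH] am.
  by rewrite big1// => i _; have -> : (a <= i < a + 0%:Z) = false by lia.
have h := @window_delta n (a + m%:Z).
rewrite -[in RHS](addn1 m) [RHS]natrD -IH; last lia.
rewrite -[1%:R]h; last by rewrite mem_window; lia.
rewrite -big_split; apply: eq_bigr => k _ /=.
rewrite -natrD; congr (_%:R); lia.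
Qed.

(* The number of k with f k <> f (k+1) is at least 2 for a nonempty f. *)
Lemma window_switch n (f : int -> bool) k0 :
  (forall k, f k -> - n%:Z < k < n%:Z) -> f k0 ->
  2 <= \sum_(k <- window n) ((f k (+) f (k + 1))%R)%:R :> R.
Proof.
move=> fin fk0; have k0n := fin _ fk0.
have path (a : int) (m : nat) : ((f a (+) f (a + m%:Z))%R)%:R <=
    \sum_(i <- iota 0 m) ((f (a + i%:Z) (+) f (a + i%:Z + 1))%R)%:R :> R.
  elim: m => [|m IH]; first by rewrite addr0 addbb big_nil.
  rewrite -(addn1 m) iotaD big_cat /= big_cons big_nil addr0 add0n.
  apply: le_trans (lerD IH (lexx _)).
  rewrite PoszD addrA -natrD ler_nat.
  by case: (f a) (f (a + m%:Z)) (f (a + m%:Z + 1)) => [] [] [].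
have := path (- n%:Z) (absz (k0 + n%:Z)).
have -> : - n%:Z + (absz (k0 + n%:Z))%:Z = k0 by lia.
rewrite fk0.
have -> : f (- n%:Z) = false by apply/negP => /fin; lia.
have := path k0 (absz (n%:Z - k0)).
have -> : k0 + (absz (n%:Z - k0))%:Z = n%:Z by lia.
have -> : f (n%:Z) = false by apply/negP => /fin; lia.
rewrite fk0 /window big_map => h1 h2.
have -> : n.*2 = addn (absz (k0 + n%:Z)%R) (absz (n%:Z - k0)%R) by lia.
rewrite iotaD big_cat/= -[2](natrD R 1 1); apply: lerD.
  apply: le_trans h2 _; rewrite le_eqVlt; apply/orP; left; apply/eqP.
  by apply: eq_bigr => i _; rewrite [- _ + _]addrC.
apply: le_trans h1 _; rewrite le_eqVlt; apply/orP; left; apply/eqP.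
rewrite -[in RHS](addn0 (0 + _)%N) iotaDl big_map; apply: eq_bigr => i _.
congr (((f _ (+) f _)%R)%:R); lia.
Qed.

Lemma window_switch_itv n (l r : int) : l < r -> - n%:Z < l -> r <= n%:Z ->
  \sum_(k <- window n) (((l <= k < r) (+) (l <= k + 1 < r))%R)%:R = 2 :> R.
Proof.
move=> lr ln rn.
transitivity (\sum_(k <- window n) (k == l - 1)%R%:R +
              \sum_(k <- window n) (k == r - 1)%R%:R : R); last first.
  by rewrite !window_delta ?mem_window -?natrD//; lia.
rewrite -big_split; apply: eq_bigr => k _ /=; rewrite -natrD; congr (_%:R); lia.
Qed.

Definition gcard n A : R := wsum n (fun k j => (A k j)%:R).

Definition gcount n A : R :=
  wsum n (fun k j => (vedge A k j)%:R) + wsum n (fun k j => (hedge A k j)%:R).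

Definition gper n (wv wh : int -> int -> R) A : R :=
  wsum n (fun k j => wv k j * (vedge A k j)%:R) +
  wsum n (fun k j => wh k j * (hedge A k j)%:R).

(** The energy divided by [eps], in units of [eps]: [g] stands for eps / gamma and [d] for the
    distance to the boundary of [F]. *)
Definition genergy n wv wh (g : R) (d : int -> int -> R) (F A : gset) : R :=
  gper n wv wh A + g * wsum n (fun k j => ((A k j (+) F k j)%R)%:R * d k j).

Lemma gcard0 n A : inside n A -> gcard n A <= 0 -> forall k j, ~~ A k j.
Proof.
move=> Ain A0 k j; apply/negP => Akj; have [kn jn] := Ain _ _ Akj.
have : (A k j)%:R <= gcard n A.
  by apply: (@wsum_term n (fun k j => (A k j)%:R)) => //; rewrite mem_window; lia.
by rewrite Akj => /le_trans/(_ A0); rewrite ler10.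
Qed.

Lemma wsum_shiftv n A : inside n A ->
  wsum n (fun k j => ((A (k + 1) j)%R)%:R) = gcard n A.
Proof.
move=> Ain; rewrite /gcard wsumC [RHS]wsumC; apply: eq_bigr => j _.
apply: (@window_shift n (fun k => (A k j)%:R));
  by case: (boolP (A _ _)) => // /Ain[]; lia.
Qed.

Lemma wsum_shifth n A : inside n A ->
  wsum n (fun k j => ((A k (j + 1))%R)%:R) = gcard n A.
Proof.
move=> Ain; rewrite /gcard; apply: eq_bigr => k _.
apply: (@window_shift n (fun j => (A k j)%:R));
  by case: (boolP (A _ _)) => // /Ain[]; lia.
Qed.

(** A bounded nonempty row is entered and left at least once, which gives two vertical edges;
    likewise for columns. Rectangles attain equality, by [gcount_rect]. *)
Lemma gcount_rows n A : inside n A ->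
  2 * \sum_(j <- window n) (`[< exists k, A k j >])%:R +
  2 * \sum_(k <- window n) (`[< exists j, A k j >])%:R <= gcount n A.
Proof.
move=> Ain; rewrite /gcount; apply: lerD.
  rewrite wsumC mulr_sumr; apply: ler_sum => j _.
  case: asboolP => [[k0 Ak0]|_]; last by rewrite mulr0; apply: sumr_ge0.
  by rewrite mulr1; apply: (@window_switch n (A^~ j) k0) => // k /Ain[].
rewrite mulr_sumr; apply: ler_sum => k _.
case: asboolP => [[k0 Ak0]|_]; last by rewrite mulr0; apply: sumr_ge0.
by rewrite mulr1; apply: (@window_switch n (A k) k0) => // j /Ain[].
Qed.

Lemma gcount_rect n l r b t : l < r -> b < t -> inside n (grect l r b t) ->
  gcount n (grect l r b t) =
  2 * \sum_(j <- window n) ((b <= j < t)%R)%:R +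
  2 * \sum_(k <- window n) ((l <= k < r)%R)%:R.
Proof.
move=> lr bt Gin.
have [h1 h2] : - n%:Z < l < n%:Z /\ - n%:Z < b < n%:Z.
  by apply: Gin; rewrite /grect; lia.
have [h3 h4] : - n%:Z < r - 1 < n%:Z /\ - n%:Z < t - 1 < n%:Z.
  by apply: Gin; rewrite /grect; lia.
rewrite /gcount; congr (_ + _).
  rewrite wsumC mulr_sumr; apply: eq_bigr => j _.
  rewrite -(@window_switch_itv n l r)//; last lia; last lia.
  rewrite mulr_suml; apply: eq_bigr => k _; rewrite -natrM mulnb; congr (_%:R).
  by rewrite /vedge /grect; case: (b <= j < t); rewrite ?andbT ?andbF.
rewrite mulr_sumr; apply: eq_bigr => k _.
rewrite -(@window_switch_itv n b t)//; last lia; last lia.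
rewrite mulr_suml; apply: eq_bigr => j _; rewrite -natrM mulnb; congr (_%:R).
by rewrite /hedge /grect; case: (l <= k < r); rewrite ?andbT ?andbF.
Qed.

End WindowSums.

(** Used with [p N] saying that the N-th column or row counted from a side is empty: the resulting
    [N] is the displacement of that side, 0 if none of the first [m] is empty. *)
Lemma ex_last_true (p : nat -> bool) (m : nat) :
  exists N, [/\ (N <= m)%N, N = 0%N \/ p N & forall i, (N < i <= m)%N -> ~~ p i].
Proof.
elim: m => [|m [N [Nm pN hN]]].
  by exists 0%N; split=> // [|i]; [left|lia].
case pm : (p m.+1).
  by exists m.+1; split=> //; [right|move=> i; lia].
exists N; split=> //; first exact: leqW.
move=> i /andP[Ni]; rewrite leq_eqVlt => /orP[/eqP->|im]; first by rewrite pm.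
by apply: hN; rewrite Ni.
Qed.

(** * Minimizers of the discrete energy with respect to a rectangle are rectangles *)

Section GridMin.
Context {R : realType}.
Variables (n : nat) (wv wh : int -> int -> R) (e g : R).
Hypotheses (e0 : 0 <= e) (e2 : e <= 1 / 2) (eg : 4 * e < g).
Hypothesis wv1 : forall k j, `|wv k j - 1| <= e.
Hypothesis wh1 : forall k j, `|wh k j - 1| <= e.
Implicit Types A B : gset.

Let wge (x : R) : `|x - 1| <= e -> 1 - e <= x.
Proof. by rewrite ler_norml => /andP[h _]; lra. Qed.

Lemma gper_ge A : (1 - e) * gcount n A <= gper n wv wh A.
Proof.
rewrite /gcount /gper mulrDr -!wsumZ; apply: lerD; apply: ler_wsum => k j;
  apply: ler_wpM2r; rewrite ?ler0n//; exact: wge.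
Qed.

Lemma gper_le A : gper n wv wh A <= (1 + e) * gcount n A.
Proof.
rewrite /gcount /gper mulrDr -!wsumZ; apply: lerD; apply: ler_wsum => k j;
  apply: ler_wpM2r; rewrite ?ler0n//.
- have := wv1 k j; rewrite ler_norml => /andP[_ h]; lra.
- have := wh1 k j; rewrite ler_norml => /andP[_ h]; lra.
Qed.

Definition gxor A B : gset := fun k j => A k j (+) B k j.
Definition gand A B : gset := fun k j => A k j && B k j.
Definition gor A B : gset := fun k j => A k j || B k j.
Definition gdiff A B : gset := fun k j => A k j && ~~ B k j.

Lemma gxor_inside A B : inside n A -> inside n B -> inside n (gxor A B).
Proof.
move=> hA hB k j; rewrite /gxor; case Akj: (A k j); first by move=> _; apply: hA.
by move=> Bkj; apply: hB.
Qed.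

Let term_le (x : R) (a b : bool) : `|x - 1| <= e ->
  x * a%:R - x * b%:R <= a%:R - b%:R + e * (a (+) b)%:R.
Proof.
rewrite ler_norml => /andP[h1 h2].
by case: a b => [] [] /=; rewrite ?mulr0 ?mulr1 ?subrr ?addr0 ?lexx//; lra.
Qed.

(** The weights matter only on edges where the boundaries of [A] and [B] differ. Such an edge has an
    end in the symmetric difference, each cell has four edges, and each weight is within [e] of
    1. *)
Lemma gper_diff A B : inside n A -> inside n B ->
  gper n wv wh A - gper n wv wh B <=
  gcount n A - gcount n B + 4 * e * gcard n (gxor A B).
Proof.
move=> Ain Bin; have Xin := gxor_inside Ain Bin.
have -> : 4 * e * gcard n (gxor A B) =
    wsum n (fun k j => e * ((gxor A B k j)%:R + (gxor A B (k + 1)%R j)%:R)) +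
    wsum n (fun k j => e * ((gxor A B k j)%:R + (gxor A B k (j + 1)%R)%:R)).
  by rewrite !wsumZ !wsumD wsum_shiftv// wsum_shifth// /gcard; ring.
rewrite /gper /gcount.
set v1 := wsum n _; set h1 := wsum n _; set v2 := wsum n _; set h2 := wsum n _.
set v3 := wsum n _; set h3 := wsum n _; set v4 := wsum n _; set h4 := wsum n _.
set xv := wsum n _; set xh := wsum n _.
suff [hv hh] : v1 - v2 <= v3 - v4 + xv /\ h1 - h2 <= h3 - h4 + xh by lra.
split; rewrite /v1 /v2 /v3 /v4 /xv /h1 /h2 /h3 /h4 /xh -!wsumB -wsumD.
  apply: ler_wsum => k j; apply: le_trans (term_le _ _ (wv1 k j)) _.
  rewrite lerD2l ler_wpM2l// /vedge /gxor -natrD ler_nat.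
  by case: (A k j) (A (k + 1) j) (B k j) (B (k + 1) j) => [] [] [] [].
apply: ler_wsum => k j; apply: le_trans (term_le _ _ (wh1 k j)) _.
rewrite lerD2l ler_wpM2l// /hedge /gxor -natrD ler_nat.
by case: (A k j) (A k (j + 1)) (B k j) (B k (j + 1)) => [] [] [] [].
Qed.

(** A set that meets all rows and columns of the rectangle has at least as many boundary edges, by
    [gcount_rows]; the weights are then handled by [gper_diff]. *)
Lemma rect_min l r b t B : l < r -> b < t -> inside n (grect l r b t) ->
  inside n B ->
  (forall k, l <= k < r -> exists j, B k j) ->
  (forall j, b <= j < t -> exists k, B k j) ->
  gper n wv wh (grect l r b t) <=
  gper n wv wh B + 4 * e * gcard n (gxor (grect l r b t) B).
Proof.
move=> lr bt Gin Bin hcol hrow.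
have := gper_diff Gin Bin.
have : gcount n (grect l r b t) <= gcount n B :> R.
  apply: le_trans (gcount_rows Bin); rewrite gcount_rect//.
  apply: lerD; rewrite ler_wpM2l//; apply: ler_sum => i _; rewrite ler_nat;
    case: asboolP => h; try by case: (_ && _).
    by case: (boolP (b <= i < t)) => // /hrow/h.
  by case: (boolP (l <= i < r)) => // /hcol/h.
lra.
Qed.

Lemma gper_submod A B : gper n wv wh (gand A B) + gper n wv wh (gor A B) <=
  gper n wv wh A + gper n wv wh B.
Proof.
have w0 (x : R) : `|x - 1| <= e -> 0 <= x by move=> /wge h; move: (e2); lra.
rewrite /gper.
set v1 := wsum n _; set h1 := wsum n _; set v2 := wsum n _; set h2 := wsum n _.
set v3 := wsum n _; set h3 := wsum n _; set v4 := wsum n _; set h4 := wsum n _.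
suff [hv hh] : v1 + v2 <= v3 + v4 /\ h1 + h2 <= h3 + h4 by lra.
split; rewrite /v1 /v2 /v3 /v4 /h1 /h2 /h3 /h4 -!wsumD; apply: ler_wsum => k j;
  rewrite -!mulrDr ler_wpM2l ?w0// -!natrD ler_nat /vedge /hedge /gand /gor.
  by case: (A k j) (A (k + 1) j) (B k j) (B (k + 1) j) => [] [] [] [].
by case: (A k j) (A k (j + 1)) (B k j) (B k (j + 1)) => [] [] [] [].
Qed.

Variables (l r b t : int) (d : int -> int -> R).
Hypotheses (lr : l < r) (bt : b < t).
Let F := grect l r b t.
Hypothesis Fin : inside n F.
Hypothesis d1 : forall k j, 1 <= d k j.
Hypothesis dF : forall k j, F k j ->
  d k j = (Num.min (Num.min (k - l + 1) (r - k)) (Num.min (j - b + 1) (t - j)))%:~R.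
Let J := genergy n wv wh g d F.

Variable A : gset.
Hypothesis Ain : inside n A.
Hypothesis Amin : forall B, inside n B -> J A <= J B.

Let g0 : 0 < g. Proof. move: (e0) (eg); lra. Qed.
Let d0 k j : 0 <= d k j. Proof. by have := d1 k j; lra. Qed.

(** Cutting [A] down to its intersection with [F] changes the perimeter by at most P(F) - P(A or F),
    by submodularity, hence by at most 4 e times the number of cells outside [F], by [rect_min].
    Each of these cells saves at least [g] in dissipation, and 4 e < g. *)
Lemma min_subset k j : A k j -> F k j.
Proof.
suff D0 : gcard n (gdiff A F) <= 0 :> R.
  have Din : inside n (gdiff A F) by move=> x y /andP[/Ain].
  by have /= := gcard0 Din D0 k j; rewrite /gdiff negb_and negbK => /orP[/negPf->|->].
have ain : inside n (gand A F) by move=> x y /andP[/Ain].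
have oin : inside n (gor A F) by move=> x y /orP[/Ain|/Fin].
have /= := Amin ain; rewrite /J /genergy => hJ.
have hs := gper_submod A F.
have hr : gper n wv wh F <= gper n wv wh (gor A F) + 4 * e * gcard n (gdiff A F).
  have -> : gdiff A F = gxor F (gor A F).
    apply/funext => x; apply/funext => y; rewrite /gdiff /gxor /gor.
    by case: (A x y) (F x y) => [] [].
  apply: rect_min => // i hi.
    by exists b; apply/orP; right; rewrite /F /grect hi/= lexx.
  by exists l; apply/orP; right; rewrite /F /grect hi/= andbT lexx.
have hd : wsum n (fun k j => (gand A F k j (+) F k j)%:R * d k j) +
    gcard n (gdiff A F) <= wsum n (fun k j => (A k j (+) F k j)%:R * d k j).
  rewrite -wsumD; apply: ler_wsum => x y; rewrite /gand /gdiff.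
  by case: (A x y) (F x y) => [] [] /=; rewrite ?mul0r ?mul1r ?addr0 ?add0r.
have := ler_wpM2l (ltW g0) hd; rewrite mulrDr => hgd.
have : (g - 4 * e) * gcard n (gdiff A F) <= 0 by rewrite mulrBl; lra.
by rewrite pmulr_rle0// subr_gt0.
Qed.

Let colempty k := `[< forall j, ~~ A k j >].
Let rowempty j := `[< forall k, ~~ A k j >].
Let x : R := \sum_(k <- window n) ((l <= k < r)%R && colempty k)%:R.
Let y : R := \sum_(j <- window n) ((b <= j < t)%R && rowempty j)%:R.
Let S : R := wsum n (fun k j => (A k j (+) F k j)%:R * d k j).

Let Fcorner : [/\ - n%:Z < l, r <= n%:Z, - n%:Z < b & t <= n%:Z].
Proof.
have [] := @Fin l b; first by rewrite /F /grect; lia.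
have [] := @Fin (r - 1) (t - 1); first by rewrite /F /grect; lia.
by move=> *; split; lia.
Qed.

Let window_itvz (u v : int) : - n%:Z <= u -> u <= v -> v <= n%:Z ->
  \sum_(k <- window n) ((u <= k < v)%R)%:R = (v - u)%:~R :> R.
Proof.
move=> h1 h2 h3; have -> : v = u + (absz (v - u))%:Z by lia.
rewrite window_itv//; last lia.
by rewrite [u + _]addrC addrK pmulrn.
Qed.

Let xcount : \sum_(k <- window n) `[< exists j, A k j >]%:R + x = (r - l)%:~R.
Proof.
have [h1 h2 h3 h4] := Fcorner.
rewrite -window_itvz//; [|lia|lia].
rewrite /x -big_split; apply: eq_bigr => k _; rewrite /= -natrD; congr (_%:R).
rewrite /colempty; case: asboolP => [[j Akj]|h].
  have := min_subset Akj; rewrite /F /grect => /andP[-> _] /=.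
  case: asboolP => // /(_ j); by rewrite Akj.
rewrite add0n; case: (l <= k < r) => //=.
by case: asboolP => // h'; exfalso; apply: h' => j; apply/negP => Akj; apply: h; exists j.
Qed.

Let ycount : \sum_(j <- window n) `[< exists k, A k j >]%:R + y = (t - b)%:~R.
Proof.
have [h1 h2 h3 h4] := Fcorner.
rewrite -window_itvz//; [|lia|lia].
rewrite /y -big_split; apply: eq_bigr => j _; rewrite /= -natrD; congr (_%:R).
rewrite /rowempty; case: asboolP => [[k Akj]|h].
  have := min_subset Akj; rewrite /F /grect => /andP[_ ->] /=.
  case: asboolP => // /(_ k); by rewrite Akj.
rewrite add0n; case: (b <= j < t) => //=.
by case: asboolP => // h'; exfalso; apply: h' => k; apply/negP => Akj; apply: h; exists k.
Qed.

Variables (sigma C1 : R).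
Hypothesis sigma0 : 0 < sigma.
Hypotheses (sa : sigma <= g * (r - l)%:~R) (sb : sigma <= g * (t - b)%:~R).
Hypothesis C1ge : 4 * e * ((r - l)%:~R + (t - b)%:~R) <= C1.

Let x0 : 0 <= x. Proof. exact: sumr_ge0. Qed.
Let y0 : 0 <= y. Proof. exact: sumr_ge0. Qed.

(** Comparison with [F] itself. Losing [x] columns and [y] rows shortens the unweighted perimeter by
    at most 2 (x + y), and [C1] covers the deviation of the weights from 1. *)
Lemma dissipation_le : g * S <= 2 * (x + y) + C1.
Proof.
have [h1 h2 h3 h4] := Fcorner.
have := Amin Fin; rewrite /J /genergy -/S.
have -> : wsum n (fun k j => (F k j (+) F k j)%:R * d k j) = 0.
  by rewrite /wsum big1// => k _; rewrite big1// => j _; rewrite addbb mul0r.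
rewrite mulr0 addr0 => hJ.
have e1 : 0 <= 1 - e by move: (e2); lra.
have := gper_le F; have := gper_ge A.
have := ler_wpM2l e1 (gcount_rows (R := R) Ain).
have cF := gcount_rect (R := R) lr bt Fin.
have cr : \sum_(k <- window n) ((l <= k < r)%R)%:R = (r - l)%:~R :> R.
  by rewrite window_itvz// ltW.
have ct : \sum_(k <- window n) ((b <= k < t)%R)%:R = (t - b)%:~R :> R.
  by rewrite window_itvz// ltW.
rewrite cr ct in cF; rewrite cF.
have -> : \sum_(k <- window n) `[< exists j, A k j >]%:R = (r - l)%:~R - x.
  by rewrite -xcount addrK.
have -> : \sum_(j <- window n) `[< exists k, A k j >]%:R = (t - b)%:~R - y.
  by rewrite -ycount addrK.
have : 0 <= e * (x + y) by rewrite mulr_ge0// addr_ge0.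
move: C1ge; rewrite -/S; nra.
Qed.

(** The first column has distance 1 from the boundary, so this range consists of the columns at
    distance at least [kappa] from the left and right sides. *)
Let deepcol (kappa : nat) k := (l + kappa%:Z - 1 <= k < r - kappa%:Z + 1) && colempty k.
Let deeprow (kappa : nat) j := (b + kappa%:Z - 1 <= j < t - kappa%:Z + 1) && rowempty j.

Let wsum_prod (f h : int -> R) : wsum n (fun k j => f k * h j) =
  (\sum_(k <- window n) f k) * (\sum_(j <- window n) h j).
Proof. by rewrite /wsum mulr_suml; apply: eq_bigr => k _; rewrite mulr_sumr. Qed.

(** As 4 kappa is at most the height, at least half of the cells of a deep empty column are also at
    distance [kappa] from the lower and upper sides, and each of them costs at least [kappa]. One
    factor 1/2 accounts for cells lying in an empty column and in an empty row at once, the other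
    for the half column. *)
Lemma deep_le (kappa : nat) : (0 < kappa)%N ->
  4 * kappa%:Z <= r - l -> 4 * kappa%:Z <= t - b ->
  sigma / 4 * kappa%:R * (\sum_(k <- window n) (deepcol kappa k)%:R +
                          \sum_(j <- window n) (deeprow kappa j)%:R) <= g * S.
Proof.
move=> k0 ka kb; have [h1 h2 h3 h4] := Fcorner.
set x' := \sum_(k <- window n) _; set y' := \sum_(j <- window n) _.
have x'0 : 0 <= x' by apply: sumr_ge0.
have y'0 : 0 <= y' by apply: sumr_ge0.
pose cx (k : int) : R := (l + kappa%:Z - 1 <= k < r - kappa%:Z + 1)%R%:R.
pose cy (j : int) : R := (b + kappa%:Z - 1 <= j < t - kappa%:Z + 1)%R%:R.
have main : kappa%:R / 2 * (wsum n (fun k j => (deepcol kappa k)%:R * cy j) +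
    wsum n (fun k j => cx k * (deeprow kappa j)%:R)) <= S.
  rewrite -wsumD -wsumZ; apply: ler_wsum => k j.
  have [dk|] := boolP ((l + kappa%:Z - 1 <= k < r - kappa%:Z + 1) &&
                       (b + kappa%:Z - 1 <= j < t - kappa%:Z + 1)); last first.
    rewrite /deepcol /deeprow /cx /cy.
    case: (l + kappa%:Z - 1 <= k < r - kappa%:Z + 1) => /=;
    case: (b + kappa%:Z - 1 <= j < t - kappa%:Z + 1) => //=;
    by rewrite ?mul0r ?mulr0 ?addr0 ?mulr0 => _; exact: mulr_ge0.
  have Fkj : F k j by rewrite /F /grect; move: dk k0; clear; lia.
  rewrite /deepcol /deeprow /cx /cy; move/andP: (dk) => [-> ->] /=.
  rewrite !(mulr1, mul1r) Fkj addbT.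
  have dk' : kappa%:R <= d k j.
    rewrite dF// -[kappa%:R]/(kappa%:Z%:~R) ler_int; move: dk; clear; lia.
  rewrite /colempty /rowempty; case Akj : (A k j) => /=.
    case: asboolP => [/(_ j)|_]; first by rewrite Akj.
    case: asboolP => [/(_ k)|_]; first by rewrite Akj.
    by rewrite mul0r addr0 mulr0.
  have : 0 <= kappa%:R :> R by [].
  rewrite mul1r; move: dk'; do 2 case: asboolP => _ /=; lra.
have sx : \sum_(k <- window n) cx k >= (r - l)%:~R / 2.
  rewrite (@window_itvz (l + kappa%:Z - 1) (r - kappa%:Z + 1));
    try by move: h1 h2 h3 h4 k0 ka kb; clear; lia.
  have : (4 * kappa%:Z)%:~R <= (r - l)%:~R :> R by rewrite ler_int.
  rewrite !(rmorphB, rmorphD, rmorphM) /=; lra.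
have sy : \sum_(k <- window n) cy k >= (t - b)%:~R / 2.
  rewrite (@window_itvz (b + kappa%:Z - 1) (t - kappa%:Z + 1));
    try by move: h1 h2 h3 h4 k0 ka kb; clear; lia.
  have : (4 * kappa%:Z)%:~R <= (t - b)%:~R :> R by rewrite ler_int.
  rewrite !(rmorphB, rmorphD, rmorphM) /=; lra.
move: main; rewrite !wsum_prod -/x' -/y'.
have := ler_wpM2l x'0 sy; have := ler_wpM2l y'0 sx.
move: (\sum_(k <- window n) cx k) (\sum_(k <- window n) cy k) => u v hu hv main.
have m3 : g * (kappa%:R / 2 * (x' * ((t - b)%:~R / 2) + y' * ((r - l)%:~R / 2))) <= g * S.
  apply: ler_wpM2l; first exact: ltW.
  apply: le_trans main; apply: ler_wpM2l; first by rewrite divr_ge0.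
  by rewrite [u * y']mulrC lerD.
apply: le_trans m3.
have -> : g * (kappa%:R / 2 * (x' * ((t - b)%:~R / 2) + y' * ((r - l)%:~R / 2))) =
  (kappa%:R / 4) * (x' * (g * (t - b)%:~R) + y' * (g * (r - l)%:~R)) by field.
have -> : sigma / 4 * kappa%:R * (x' + y') = kappa%:R / 4 * (x' * sigma + y' * sigma).
  by field.
apply: ler_wpM2l; first by rewrite divr_ge0.
by apply: lerD; apply: ler_wpM2l.
Qed.

Variables (kappa0 kappa : nat).
Hypothesis kappa0_gt0 : (0 < kappa0)%N.
Hypothesis kappa0_le : (kappa0 <= kappa)%N.
Hypothesis kappa0_ge : 16 <= sigma * kappa0%:R.
Hypothesis kappa_gt : 16 * kappa0%:R + 2 * C1 < sigma / 4 * kappa%:R.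
Hypotheses (kappa_col : 4 * kappa%:Z <= r - l) (kappa_row : 4 * kappa%:Z <= t - b).
Hypothesis kappa_small : g * kappa%:R ^+ 2 < 1 / 2.

Let shallow (u v : int) (E : int -> bool) :
  - n%:Z < u -> v <= n%:Z -> 4 * kappa%:Z <= v - u ->
  \sum_(k <- window n) ((u <= k < v)%R && E k)%:R <=
  \sum_(k <- window n) ((u + kappa0%:Z - 1 <= k < v - kappa0%:Z + 1)%R && E k)%:R
    + 2 * kappa0%:R :> R.
Proof.
move=> h1 h2 h3.
have w1 : \sum_(k <- window n) ((u <= k < u + kappa0%:Z)%R)%:R = kappa0%:R :> R.
  by apply: window_itv; move: h1 h2 h3 kappa0_le; clear; lia.
have w2 : \sum_(k <- window n)
    ((v - kappa0%:Z <= k < v - kappa0%:Z + kappa0%:Z)%R)%:R = kappa0%:R :> R.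
  by apply: window_itv; move: h1 h2 h3 kappa0_le; clear; lia.
rewrite [2]/(1 + 1) mulrDl mul1r -{1}w1 -w2 -!big_split.
apply: ler_sum => k _ /=; rewrite -!natrD ler_nat; case: (E k);
  by rewrite ?andbT ?andbF//; clear; lia.
Qed.

(** Two scales are needed because [dissipation_le] contains the unknown [x + y]. At scale [kappa0] a
    deep empty line costs at least 4, which beats the gain of 2 and yields 2 (x + y) <= 16 kappa0 +
    C1. With this bound, a single empty line at depth [kappa] would already cost too much. *)
Lemma no_deep : (forall k, l + kappa%:Z - 1 <= k < r - kappa%:Z + 1 -> exists j, A k j) /\
                (forall j, b + kappa%:Z - 1 <= j < t - kappa%:Z + 1 -> exists k, A k j).
Proof.
have [h1 h2 h3 h4] := Fcorner.
have D0 := dissipation_le.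
have k00 : (0 < kappa)%N by exact: leq_trans kappa0_le.
have kc : 4 * kappa0%:Z <= r - l by move: kappa0_le kappa_col; clear; lia.
have kr : 4 * kappa0%:Z <= t - b by move: kappa0_le kappa_row; clear; lia.
have D1 := le_trans (deep_le kappa0_gt0 kc kr) D0.
have D2 := le_trans (deep_le k00 kappa_col kappa_row) D0.
have xs := shallow colempty h1 h2 kappa_col; have ys := shallow rowempty h3 h4 kappa_row.
rewrite -/x in xs; rewrite -/y in ys.
set x' := \sum_(k <- window n) _ in xs; set y' := \sum_(k <- window n) _ in ys.
rewrite -/(deepcol kappa0) -/x' in D1.
have x'0 : 0 <= x' by apply: sumr_ge0.
have y'0 : 0 <= y' by apply: sumr_ge0.
have D1' : sigma / 4 * kappa0%:R * (x' + y') <= 2 * (x + y) + C1 by exact: D1.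
have D3 : 2 * (x + y) <= 16 * kappa0%:R + C1.
  have : 4 * (x' + y') <= sigma / 4 * kappa0%:R * (x' + y').
    apply: ler_wpM2r; first exact: addr_ge0.
    by move: kappa0_ge; lra.
  move: D1' xs ys; lra.
set X := \sum_(k <- window n) _ in D2; set Y := \sum_(k <- window n) _ in D2.
have X0 : 0 <= X by apply: sumr_ge0.
have Y0 : 0 <= Y by apply: sumr_ge0.
have sk : 0 < sigma / 4 * kappa%:R by rewrite mulr_gt0 ?divr_gt0 ?ltr0n.
have XY : X + Y < 1.
  rewrite -(@ltr_pM2l _ (sigma / 4 * kappa%:R))// mulr1.
  apply: le_lt_trans D2 _; move: D3 kappa_gt; lra.
split=> [k hk|j hj].
  apply: contrapT => hn.
  have : (deepcol kappa k)%:R <= X.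
    apply: (@window_term _ n (fun k => (deepcol kappa k)%:R)) => //.
    rewrite mem_window; move: hk h1 h2 k00; clear; lia.
  have -> : deepcol kappa k.
    rewrite /deepcol hk/=; apply/asboolP => j; apply/negP => Akj.
    by apply: hn; exists j.
  move=> h; have : X < 1 by apply: le_lt_trans XY; rewrite lerDl.
  by rewrite ltNge h.
apply: contrapT => hn.
have : (deeprow kappa j)%:R <= Y.
  apply: (@window_term _ n (fun j => (deeprow kappa j)%:R)) => //.
  rewrite mem_window; move: hj h3 h4 k00; clear; lia.
have -> : deeprow kappa j.
  rewrite /deeprow hj/=; apply/asboolP => k; apply/negP => Akj.
  by apply: hn; exists k.
move=> h; have : Y < 1 by apply: le_lt_trans XY; rewrite lerDr.
by rewrite ltNge h.
Qed.

(** Let [G] be spanned by what remains after the last empty line within depth [kappa] of each side.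
    The part [T] of [A] outside [G] is detached and lies in thin strips, so its perimeter exceeds
    the dissipation caused by removing it; hence [T] is empty. Then [A] lies in [G] and meets all
    its rows and columns, and [rect_min] shows that filling up [G] does not raise the energy unless
    [A] is [G]. *)
Lemma min_rect : exists N1 N2 N3 N4 : nat,
  [/\ (N1 <= kappa)%N, (N2 <= kappa)%N, (N3 <= kappa)%N, (N4 <= kappa)%N &
      forall k j, A k j =
        grect (l + N1%:Z) (r - N2%:Z) (b + N3%:Z) (t - N4%:Z) k j].
Proof.
have [h1 h2 h3 h4] := Fcorner.
have k00 : (0 < kappa)%N by exact: leq_trans kappa0_le.
have [N1 [N1k e1 f1]] := ex_last_true (fun N => colempty (l + N%:Z - 1)) kappa.
have [N2 [N2k e2' f2]] := ex_last_true (fun N => colempty (r - N%:Z)) kappa.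
have [N3 [N3k e3 f3]] := ex_last_true (fun N => rowempty (b + N%:Z - 1)) kappa.
have [N4 [N4k e4 f4]] := ex_last_true (fun N => rowempty (t - N%:Z)) kappa.
exists N1, N2, N3, N4; split => //.
pose l' := l + N1%:Z; pose r' := r - N2%:Z; pose b' := b + N3%:Z; pose t' := t - N4%:Z.
rewrite -/l' -/r' -/b' -/t'.
have lr' : l' < r' by rewrite /l' /r'; move: N1k N2k kappa_col k00; clear; lia.
have bt' : b' < t' by rewrite /b' /t'; move: N3k N4k kappa_row k00; clear; lia.
have hcol k : l' <= k < r' -> exists j, A k j.
  move=> hk; have [hd _] := no_deep.
  have [hk1|hk1] := leP (l + kappa%:Z - 1) k; last first.
    have : ~~ colempty (l + (absz (k - l + 1))%:Z - 1).
      by apply: f1; move: hk hk1 N2k kappa_col; rewrite /l' /r'; clear; lia.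
    have -> : l + (absz (k - l + 1))%:Z - 1 = k by move: hk; rewrite /l'; clear; lia.
    by move/asboolPn/existsNP => [j /negP]; rewrite negbK => Akj; exists j.
  have [hk2|hk2] := ltP k (r - kappa%:Z + 1); first by apply: hd; rewrite hk1.
  have : ~~ colempty (r - (absz (r - k))%:Z).
    by apply: f2; move: hk hk2 N1k kappa_col; rewrite /l' /r'; clear; lia.
  have -> : r - (absz (r - k))%:Z = k by move: hk; rewrite /r'; clear; lia.
  by move/asboolPn/existsNP => [j /negP]; rewrite negbK => Akj; exists j.
have hrow j : b' <= j < t' -> exists k, A k j.
  move=> hk; have [_ hd] := no_deep.
  have [hk1|hk1] := leP (b + kappa%:Z - 1) j; last first.
    have : ~~ rowempty (b + (absz (j - b + 1))%:Z - 1).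
      by apply: f3; move: hk hk1 N4k kappa_row; rewrite /b' /t'; clear; lia.
    have -> : b + (absz (j - b + 1))%:Z - 1 = j by move: hk; rewrite /b'; clear; lia.
    by move/asboolPn/existsNP => [k /negP]; rewrite negbK => Akj; exists k.
  have [hk2|hk2] := ltP j (t - kappa%:Z + 1); first by apply: hd; rewrite hk1.
  have : ~~ rowempty (t - (absz (t - j))%:Z).
    by apply: f4; move: hk hk2 N3k kappa_row; rewrite /b' /t'; clear; lia.
  have -> : t - (absz (t - j))%:Z = j by move: hk; rewrite /t'; clear; lia.
  by move/asboolPn/existsNP => [k /negP]; rewrite negbK => Akj; exists k.
pose G := grect l' r' b' t'.
have GF k j : G k j -> F k j.
  rewrite /G /F /grect /l' /r' /b' /t'; clear; lia.
have Gin : inside n G by move=> k j /GF/Fin.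
(* The part of A outside G is separated from G by empty rows and columns. *)
have sepv k j : A k j -> A (k + 1) j -> G k j = G (k + 1) j.
  move=> A1 A2; have F1 := min_subset A1; have F2 := min_subset A2.
  have n1 : k + 1 != l' - 1 + 1.
    apply/eqP => kl; case: e1 => [N10|].
      by move: F1 kl; rewrite /F /grect /l' N10; clear; lia.
    rewrite (_ : l + N1%:Z - 1 = k); last by move: kl; rewrite /l'; clear; lia.
    by move/asboolP => /(_ j); rewrite A1.
  have n2 : k + 1 != r'.
    apply/eqP => kl; case: e2' => [N20|].
      by move: F2 kl; rewrite /F /grect /r' N20; clear; lia.
    rewrite (_ : r - N2%:Z = k + 1); last by rewrite kl.
    by move/asboolP => /(_ j); rewrite A2.
  by move: n1 n2; rewrite /G /grect; clear; lia.
have seph k j : A k j -> A k (j + 1) -> G k j = G k (j + 1).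
  move=> A1 A2; have F1 := min_subset A1; have F2 := min_subset A2.
  have n1 : j + 1 != b' - 1 + 1.
    apply/eqP => kl; case: e3 => [N10|].
      by move: F1 kl; rewrite /F /grect /b' N10; clear; lia.
    rewrite (_ : b + N3%:Z - 1 = j); last by move: kl; rewrite /b'; clear; lia.
    by move/asboolP => /(_ k); rewrite A1.
  have n2 : j + 1 != t'.
    apply/eqP => kl; case: e4 => [N20|].
      by move: F2 kl; rewrite /F /grect /t' N20; clear; lia.
    rewrite (_ : t - N4%:Z = j + 1); last by rewrite kl.
    by move/asboolP => /(_ k); rewrite A2.
  by move: n1 n2; rewrite /G /grect; clear; lia.
pose T := gdiff A G.
have Tin : inside n T by move=> k j /andP[/Ain].
have AGin : inside n (gand A G) by move=> k j /andP[/Ain].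
have perA : gper n wv wh A = gper n wv wh (gand A G) + gper n wv wh T.
  rewrite /gper addrACA; congr (_ + _); rewrite -wsumD; apply: eq_wsum => k j;
    rewrite -mulrDr -natrD; congr (_ * _%:R).
    have := @sepv k j; rewrite /vedge /gand /T /gdiff.
    case: (A k j) (A (k + 1) j) (G k j) (G (k + 1) j) => [] [] [] [] //=;
      by move=> /(_ isT isT).
  have := @seph k j; rewrite /hedge /gand /T /gdiff.
  case: (A k j) (A k (j + 1)) (G k j) (G k (j + 1)) => [] [] [] [] //=;
    by move=> /(_ isT isT).
(* A cell of [T] has its column or its row outside the range of [G]. In a given row at most 2 kappa
   cells are of the first kind, and a nonempty row of [T] has at least two vertical edges. *)
have cardT : gcard n T <= kappa%:R * gcount n T :> R.
  have split_T : gcard n T <= wsum n (fun k j => (T k j && ~~ (l' <= k < r'))%:R) +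
      wsum n (fun k j => (T k j && ~~ (b' <= j < t'))%:R) :> R.
    rewrite -wsumD; apply: ler_wsum => k j; rewrite -natrD ler_nat /T /gdiff /G /grect.
    by case: (A k j) (l' <= k < r') (b' <= j < t') => [] [] [].
  apply: le_trans split_T _.
  have w (u v : int) (N N' : nat) (p : int -> bool) (q : bool) :
      (N <= kappa)%N -> (N' <= kappa)%N -> - n%:Z < u -> v <= n%:Z -> 
      4 * kappa%:Z <= v - u ->
      (forall k, p k -> q && (u <= k < v)) ->
      \sum_(k <- window n) (p k && ~~ (u + N%:Z <= k < v - N'%:Z)%R)%:R <=
      kappa%:R * 2 * q%:R :> R.
    move=> Nk N'k un vn uv pq; case: q pq => pq; last first.
      by rewrite mulr0 big1// => k _; case pk : (p k) => //; move: (pq _ pk).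
    have w1 : \sum_(k <- window n) ((u <= k < u + N%:Z)%R)%:R = N%:R :> R.
      by apply: window_itv; move: un vn uv Nk; clear; lia.
    have w2 : \sum_(k <- window n)
        ((v - N'%:Z <= k < v - N'%:Z + N'%:Z)%R)%:R = N'%:R :> R.
      by apply: window_itv; move: un vn uv N'k; clear; lia.
    apply: (@le_trans _ _ (N%:R + N'%:R)); last first.
      by rewrite mulr1 mulr_natr mulr2n lerD// ler_nat.
    rewrite -{}w1 -{}w2 -big_split; apply: ler_sum => k _ /=.
    rewrite -natrD ler_nat; case pk : (p k) => //=.
    by move: (pq _ pk); clear; lia.
  have sub k j : T k j -> (l <= k < r) && (b <= j < t).
    by move=> /andP[/min_subset].
  rewrite mulrDr; apply: lerD.
    rewrite wsumC -wsumZ [leRHS]wsumC; apply: ler_sum => j _.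
    apply: (@le_trans _ _ (kappa%:R * 2 * (`[< exists k, T k j >])%:R)).
      apply: w => // k Tkj; have /andP[-> _] := sub _ _ Tkj.
      by rewrite andbT; apply/asboolP; exists k.
    rewrite -mulr_sumr -mulrA ler_wpM2l//.
    case: asboolP => [[k0 Tk0]|_]; last by rewrite mulr0 sumr_ge0.
    by rewrite mulr1; apply: (@window_switch _ n (T^~ j) k0) => // k /Tin[].
  rewrite -wsumZ; apply: ler_sum => k _.
  apply: (@le_trans _ _ (kappa%:R * 2 * (`[< exists j, T k j >])%:R)).
    apply: w => // j Tkj; have /andP[_ ->] := sub _ _ Tkj.
    by rewrite andbT; apply/asboolP; exists j.
  rewrite -mulr_sumr -mulrA ler_wpM2l//.
  case: asboolP => [[k0 Tk0]|_]; last by rewrite mulr0 sumr_ge0.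
  by rewrite mulr1; apply: (@window_switch _ n (T k) k0) => // j /Tin[].
have dT : wsum n (fun k j => (T k j)%:R * d k j) <= kappa%:R * gcard n T.
  rewrite -wsumZ; apply: ler_wsum => k j; case Tkj : (T k j) => /=; last by rewrite mul0r mulr0.
  rewrite mul1r mulr1; have /andP[/min_subset Fkj Gkj] : T k j by [].
  rewrite dF// -[kappa%:R]/(kappa%:Z%:~R) ler_int.
  move: Gkj Fkj N1k N2k N3k N4k; rewrite /G /F /grect /l' /r' /b' /t'; clear; lia.
have T0 : gcard n T <= 0 :> R.
  have := Amin AGin; rewrite /J /genergy perA => hJ.
  have hD : wsum n (fun k j => (gand A G k j (+) F k j)%:R * d k j) =
      wsum n (fun k j => (A k j (+) F k j)%:R * d k j) + wsum n (fun k j => (T k j)%:R * d k j).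
    rewrite -wsumD; apply: eq_wsum => k j; rewrite -mulrDl -natrD; congr (_%:R * _).
    have := @min_subset k j; rewrite /T /gand /gdiff.
    by case: (A k j) (F k j) (G k j) => [] [] [] // /(_ isT).
  move: hJ; rewrite hD mulrDr => hJ.
  (* The cells of [T] have distance at most [kappa], so removing them costs at most g kappa^2 times
     their perimeter; this is less than the gain because g kappa^2 < 1/2 <= 1 - e. *)
  have pT : (1 - e) * gcount n T <= g * (kappa%:R * (kappa%:R * gcount n T)).
    apply: le_trans (gper_ge T) _.
    apply: (@le_trans _ _ (g * wsum n (fun k j => (T k j)%:R * d k j))).
      by move: hJ; lra.
    apply: ler_wpM2l; first exact: ltW.
    by apply: le_trans dT _; apply: ler_wpM2l.
  have cT : gcount n T <= 0 :> R.
    rewrite leNgt; apply/negP => c0.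
    move: pT; have -> : g * (kappa%:R * (kappa%:R * gcount n T)) =
      (g * kappa%:R ^+ 2) * gcount n T by ring.
    rewrite ler_pM2r//; move: (e2) kappa_small; lra.
  by apply: le_trans cardT _; rewrite mulr_ge0_le0.
have AG k j : A k j -> G k j.
  move=> Akj; have := gcard0 Tin T0 k j.
  by rewrite /T /gdiff Akj /= negbK.
suff X0 : gcard n (gxor G A) <= 0 :> R.
  move=> k j; have := gcard0 (gxor_inside Gin Ain) X0 k j.
  by rewrite -/G /gxor; case: (A k j) (G k j) => [] [].
have hp := rect_min lr' bt' Gin Ain hcol hrow.
have := Amin Gin; rewrite /J /genergy => hJ.
have hd : wsum n (fun k j => (G k j (+) F k j)%:R * d k j) + gcard n (gxor G A) <=
    wsum n (fun k j => (A k j (+) F k j)%:R * d k j).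
  rewrite -wsumD; apply: ler_wsum => k j; rewrite /gxor.
  have := @AG k j; have := @GF k j; have := d1 k j.
  case: (A k j) (F k j) (G k j) => [] [] [] /= dkj gf ag;
    rewrite ?mul0r ?mul1r ?addr0 ?add0r //; by [have := gf isT | have := ag isT].
have := ler_wpM2l (ltW g0) hd; rewrite mulrDr => hgd.
have : (g - 4 * e) * gcard n (gxor G A) <= 0.
  by rewrite mulrBl; move: hgd hJ hp; rewrite -/G; lra.
by rewrite pmulr_rle0// subr_gt0.
Qed.

End GridMin.

(** * Energy differences of rectangles and the conditions for moving one side by one cell *)

Section RectEnergy.
Context {R : realType}.
Variable n : nat.
Implicit Types (wv wh d : int -> int -> R) (F : gset).

Definition isum (u v : int) (f : int -> R) : R :=
  \sum_(k <- window n) ((u <= k < v)%R)%:R * f k.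

Lemma isumD u v (f h : int -> R) :
  isum u v (fun k => f k + h k) = isum u v f + isum u v h.
Proof. by rewrite /isum -big_split; apply: eq_bigr => k _; rewrite mulrDr. Qed.

Lemma isumZ u v x (f : int -> R) : isum u v (fun k => x * f k) = x * isum u v f.
Proof. by rewrite /isum mulr_sumr; apply: eq_bigr => k _; rewrite mulrCA. Qed.

Lemma isumB u v (f h : int -> R) :
  isum u v (fun k => f k - h k) = isum u v f - isum u v h.
Proof.
rewrite -[- isum u v h]mulN1r -isumZ -isumD; congr isum.
by apply/funext => k; rewrite mulN1r.
Qed.

Lemma ler_isum u v (f h : int -> R) : (forall k, u <= k < v -> f k <= h k) ->
  isum u v f <= isum u v h.
Proof.
move=> fh; apply: ler_sum => k _; case: (boolP (u <= k < v)) => [/fh|_].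
  by rewrite !mul1r.
by rewrite !mul0r.
Qed.

Lemma isum_cst u v (x : R) : - n%:Z <= u -> u <= v -> v <= n%:Z ->
  isum u v (fun=> x) = (v - u)%:~R * x.
Proof.
move=> h1 h2 h3; rewrite /isum -mulr_suml; congr (_ * _).
have -> : v = u + (absz (v - u))%:Z by lia.
rewrite window_itv//; last lia.
by rewrite [u + _]addrC addrK pmulrn.
Qed.

Lemma isum_delta (a : int) (f : int -> R) : a \in window n ->
  \sum_(k <- window n) ((k == a)%R)%:R * f k = f a.
Proof.
move=> an; rewrite (bigD1_seq a)//= ?window_uniq// eqxx mul1r big1 ?addr0//.
by move=> i /negPf ->; rewrite mul0r.
Qed.

Lemma isum_first u v f : - n%:Z <= u -> u < v -> v <= n%:Z ->
  isum u v f = f u + isum (u + 1) v f.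
Proof.
move=> h1 h2 h3; rewrite -{1}(@isum_delta u f); last by rewrite mem_window; lia.
rewrite /isum -big_split; apply: eq_bigr => k _ /=.
rewrite -mulrDl -natrD; congr (_%:R * _); lia.
Qed.

Lemma isum_last u v f : - n%:Z <= u -> u < v -> v <= n%:Z ->
  isum u v f = f (v - 1) + isum u (v - 1) f.
Proof.
move=> h1 h2 h3; rewrite -{1}(@isum_delta (v - 1) f); last by rewrite mem_window; lia.
rewrite /isum -big_split; apply: eq_bigr => k _ /=.
rewrite -mulrDl -natrD; congr (_%:R * _); lia.
Qed.

Definition rectJ wv wh g d F (l r b t : int) : R :=
  genergy n wv wh g d F (grect l r b t).

Lemma genergy_rect wv wh g d F l r b t : l < r -> b < t ->
  inside n (grect l r b t) -> (forall k j, grect l r b t k j -> F k j) ->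
  rectJ wv wh g d F l r b t =
  isum b t (fun j => wv (l - 1) j + wv (r - 1) j) +
  isum l r (fun k => wh k (b - 1) + wh k (t - 1)) +
  g * (wsum n (fun k j => (F k j)%:R * d k j) - isum l r (fun k => isum b t (d k))).
Proof.
move=> lr bt Gin GF.
have [h1 h2] : - n%:Z < l < n%:Z /\ - n%:Z < b < n%:Z.
  by apply: Gin; rewrite /grect; lia.
have [h3 h4] : - n%:Z < r - 1 < n%:Z /\ - n%:Z < t - 1 < n%:Z.
  by apply: Gin; rewrite /grect; lia.
have sw (u v k : int) : u < v ->
    ((u <= k < v) (+) (u <= k + 1 < v))%:R = ((k == u - 1)%R)%:R + ((k == v - 1)%R)%:R :> R.
  move=> uv; rewrite -natrD; congr (_%:R); lia.
rewrite /rectJ /genergy /gper; congr (_ + _ + _ * _).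
- rewrite wsumC /wsum /isum; apply: eq_bigr => j _.
  rewrite -(@isum_delta (l - 1) (wv^~ j)); last by rewrite mem_window; lia.
  rewrite -(@isum_delta (r - 1) (wv^~ j)); last by rewrite mem_window; lia.
  rewrite -big_split mulr_sumr; apply: eq_bigr => k _ /=.
  rewrite -mulrDl -(sw _ _ _ lr) /vedge /grect.
  by case: (b <= j < t); rewrite ?andbT ?andbF /= ?mul1r ?mul0r ?mulr0 // mulrC.
- rewrite /wsum /isum; apply: eq_bigr => k _.
  rewrite -(@isum_delta (b - 1) (wh k)); last by rewrite mem_window; lia.
  rewrite -(@isum_delta (t - 1) (wh k)); last by rewrite mem_window; lia.
  rewrite -big_split mulr_sumr; apply: eq_bigr => j _ /=.
  rewrite -mulrDl -(sw _ _ _ bt) /hedge /grect.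
  by case: (l <= k < r); rewrite /= ?mul1r ?mul0r ?mulr0 // mulrC.
- apply/eqP; rewrite eq_sym subr_eq; apply/eqP.
  have -> : isum l r (fun k => isum b t (d k)) =
      wsum n (fun k j => (grect l r b t k j)%:R * d k j).
    apply: eq_bigr => k _; rewrite mulr_sumr; apply: eq_bigr => j _.
    by rewrite mulrA -natrM mulnb.
  rewrite -wsumD; apply: eq_wsum => k j; rewrite -mulrDl -natrD; congr (_%:R * _).
  by have := GF k j; case: (grect _ _ _ _ k j) (F k j) => [] [] // /(_ isT).
Qed.

(** Dropping the column [l] moves the left side across one cell, removes the two horizontal edges at
    the ends of the column, and adds its cells to the dissipation. *)
Lemma rectJ_left wv wh g d F l r b t : l + 1 < r -> b < t ->
  inside n (grect l r b t) -> (forall k j, grect l r b t k j -> F k j) ->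
  rectJ wv wh g d F l r b t - rectJ wv wh g d F (l + 1) r b t =
  isum b t (fun j => wv (l - 1) j - wv l j) + wh l (b - 1) + wh l (t - 1) -
  g * isum b t (d l).
Proof.
move=> lr bt Gin GF.
have [h1 h2] : - n%:Z < l < n%:Z /\ - n%:Z < b < n%:Z.
  by apply: Gin; rewrite /grect; lia.
have [h3 h4] : - n%:Z < r - 1 < n%:Z /\ - n%:Z < t - 1 < n%:Z.
  by apply: Gin; rewrite /grect; lia.
have sub k j : grect (l + 1) r b t k j -> grect l r b t k j by rewrite /grect; lia.
rewrite !genergy_rect//; try by [move=> k j /sub/Gin|move=> k j /sub/GF|lia].
rewrite ![isum l r _]isum_first//; [|lia..].
rewrite addrK isumB !isumD; ring.
Qed.

Lemma rectJ_right wv wh g d F l r b t : l + 1 < r -> b < t ->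
  inside n (grect l r b t) -> (forall k j, grect l r b t k j -> F k j) ->
  rectJ wv wh g d F l r b t - rectJ wv wh g d F l (r - 1) b t =
  isum b t (fun j => wv (r - 1) j - wv (r - 2) j) +
  wh (r - 1) (b - 1) + wh (r - 1) (t - 1) - g * isum b t (d (r - 1)).
Proof.
move=> lr bt Gin GF.
have [h1 h2] : - n%:Z < l < n%:Z /\ - n%:Z < b < n%:Z.
  by apply: Gin; rewrite /grect; lia.
have [h3 h4] : - n%:Z < r - 1 < n%:Z /\ - n%:Z < t - 1 < n%:Z.
  by apply: Gin; rewrite /grect; lia.
have sub k j : grect l (r - 1) b t k j -> grect l r b t k j by rewrite /grect; lia.
rewrite !genergy_rect//; try by [move=> k j /sub/Gin|move=> k j /sub/GF|lia].
rewrite ![isum l r _]isum_last//; [|lia..].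
have -> : r - 1 - 1 = r - 2 by lia.
rewrite isumB !isumD; ring.
Qed.

(** Exchanging the axes reduces the conditions on the lower and upper sides to those on the left and
    right ones. *)
Lemma rectJ_transpose wv wh g d F l r b t :
  rectJ wv wh g d F l r b t =
  rectJ (fun k j => wh j k) (fun k j => wv j k) g (fun k j => d j k)
        (fun k j => F j k) b t l r.
Proof.
rewrite /rectJ /genergy /gper [X in X + _]addrC; congr (_ + _ + _ * _).
- rewrite wsumC; apply: eq_wsum => k j; congr (_ * _%:R).
  by rewrite /hedge /vedge /grect andbC [X in _ (+) X]andbC.
- rewrite wsumC; apply: eq_wsum => k j; congr (_ * _%:R).
  by rewrite /hedge /vedge /grect andbC [X in _ (+) X]andbC.
- rewrite wsumC; apply: eq_wsum => k j; congr ((_ (+) _)%:R * _).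
  by rewrite /grect andbC.
Qed.

Section Thresholds.
Variables (e g : R) (kappa : nat) (l r b t : int).
Variables (d : int -> int -> R) (wv wh : int -> int -> R).
Hypotheses (g0 : 0 < g).
Hypothesis wh1 : forall k j, `|wh k j - 1| <= e.
Let F := grect l r b t.
Hypothesis Fin : inside n F.
Hypothesis dF : forall k j, F k j ->
  d k j = (Num.min (Num.min (k - l + 1) (r - k)) (Num.min (j - b + 1) (t - j)))%:~R.
Hypotheses (kappa_col : 4 * kappa%:Z <= r - l) (kappa_row : 4 * kappa%:Z <= t - b).
Hypothesis kappa_gt0 : (0 < kappa)%N.
Variables N1 N2 N3 N4 : nat.
Hypotheses (N1k : (N1 <= kappa)%N) (N2k : (N2 <= kappa)%N).
Hypotheses (N3k : (N3 <= kappa)%N) (N4k : (N4 <= kappa)%N).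
Let l' := l + N1%:Z.
Let r' := r - N2%:Z.
Let b' := b + N3%:Z.
Let t' := t - N4%:Z.
Hypothesis rect_opt : forall u v x y, inside n (grect u v x y) ->
  rectJ wv wh g d F l' r' b' t' <= rectJ wv wh g d F u v x y.

Let corners : [/\ - n%:Z < l, r <= n%:Z, - n%:Z < b & t <= n%:Z].
Proof.
have [] := @Fin l b.
  by rewrite /F /grect; move: kappa_gt0 kappa_col kappa_row; clear; lia.
have [] := @Fin (r - 1) (t - 1).
  by rewrite /F /grect; move: kappa_gt0 kappa_col kappa_row; clear; lia.
by clear; move=> *; split; lia.
Qed.

Let isum_d_le k (N : nat) :
  (forall j, b' <= j < t' -> d k j <= N%:R) ->
  isum b' t' (d k) <= (t' - b')%:~R * N%:R.
Proof.
have [h1 h2 h3 h4] := corners.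
move=> dN; rewrite -isum_cst; first exact: ler_isum.
- by rewrite /b'; move: h3; clear; lia.
- by rewrite /b' /t'; move: kappa_row N3k N4k; clear; lia.
- by rewrite /t'; move: h4; clear; lia.
Qed.

(** Along a column the distance can be smaller than that to the vertical side only near the corners:
    at most 2 kappa cells, each losing at most [kappa]. *)
Let isum_d_ge k (N : nat) : (N <= kappa)%N ->
  (forall j, b' <= j < t' -> 0 <= d k j) ->
  (forall j, b' <= j < t' -> kappa%:Z <= j - b + 1 -> kappa%:Z <= t - j -> N%:R <= d k j) ->
  (t' - b')%:~R * N%:R - 2 * kappa%:R ^+ 2 <= isum b' t' (d k).
Proof.
have [h1 h2 h3 h4] := corners.
move=> Nk d0 dN; rewrite -isum_cst; first last.
- by rewrite /t'; move: h4; clear; lia.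
- by rewrite /b' /t'; move: kappa_row N3k N4k; clear; lia.
- by rewrite /b'; move: h3; clear; lia.
have w1 : \sum_(k <- window n) ((b <= k < b + kappa%:Z)%R)%:R = kappa%:R :> R.
  by apply: window_itv; move: h3 h4 kappa_row; clear; lia.
have w2 : \sum_(k <- window n)
    ((t - kappa%:Z <= k < t - kappa%:Z + kappa%:Z)%R)%:R = kappa%:R :> R.
  by apply: window_itv; move: h3 h4 kappa_row; clear; lia.
rewrite lerBlDr.
have -> : 2 * kappa%:R ^+ 2 = (\sum_(k <- window n) ((b <= k < b + kappa%:Z)%R)%:R + 
  \sum_(k <- window n)
    ((t - kappa%:Z <= k < t - kappa%:Z + kappa%:Z)%R)%:R) * kappa%:R :> R.
  by rewrite w1 w2; ring.
rewrite -big_split mulr_suml -big_split; apply: ler_sum => j _ /=.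
rewrite -natrD; case: (boolP (b' <= j < t')) => hj; last by rewrite !mul0r add0r mulr_ge0.
rewrite !mul1r.
case: (boolP ((kappa%:Z <= j - b + 1) && (kappa%:Z <= t - j))) => [/andP[j1 j2]|j12].
  by apply: (le_trans (dN _ hj j1 j2)); rewrite lerDl mulr_ge0.
have q : (1 <= (b <= j < b + kappa%:Z)%R + (t - kappa%:Z <= j < t - kappa%:Z + kappa%:Z)%R)%N.
  by move: hj j12; rewrite /b' /t'; clear; lia.
have : kappa%:R <= ((b <= j < b + kappa%:Z)%R +
    (t - kappa%:Z <= j < t - kappa%:Z + kappa%:Z)%R)%N%:R * kappa%:R :> R.
  by rewrite -{1}[kappa%:R]mul1r; apply: ler_wpM2r => //; rewrite (ler_nat R 1).
have : N%:R <= kappa%:R :> R by rewrite ler_nat.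
have := d0 _ hj; move: (_%:R * kappa%:R) => X; lra.
Qed.

Let wh_bound k j : 1 - e <= wh k j <= 1 + e.
Proof.
by have := wh1 k j; rewrite ler_norml => /andP[? ?]; apply/andP; split; lra.
Qed.

Let N_bounds : (l' + kappa%:Z < r' /\ b' < t') /\ [/\ l <= l', r' <= r, b <= b' & t' <= t].
Proof.
move: kappa_gt0 kappa_col kappa_row N1k N2k N3k N4k; rewrite /l' /r' /b' /t'.
by clear; move=> *; split; split; lia.
Qed.

(** Optimality against removing one further column, whose cells have distance at most [N1 + 1]. The
    constant 2 - 2 e bounds from below the two edges at the ends of the column. *)
Lemma left_remove :
  2 - 2 * e <= isum b' t' (fun j => wv l' j - wv (l' - 1) j) +
               g * (N1.+1%:R * (t' - b')%:~R).
Proof.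
have [h1 h2 h3 h4] := corners; have [[q1 q2] [q3 q4 q5 q6]] := N_bounds.
have Gin : inside n (grect l' r' b' t').
  by move=> k j; rewrite /grect; move: h1 h2 h3 h4 q3 q4 q5 q6; clear; lia.
have GF k j : grect l' r' b' t' k j -> F k j.
  by rewrite /F /grect; move: q3 q4 q5 q6; clear; lia.
have G'in : inside n (grect (l' + 1) r' b' t').
  by move=> k j h; apply: Gin; move: h; rewrite /grect; clear; lia.
have lr : l' + 1 < r' by move: kappa_gt0 q1; clear; lia.
have := rectJ_left wv wh g d lr q2 Gin GF.
have := rect_opt G'in.
have dle : isum b' t' (d l') <= (t' - b')%:~R * N1.+1%:R.
  apply: isum_d_le => j hj; rewrite dF.
    by rewrite -[_%:R]/(N1.+1%:Z%:~R) ler_int /l'; clear; lia.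
  by apply: GF; rewrite /grect hj; move: lr; clear; lia.
have := ler_wpM2l (ltW g0) dle; rewrite [(t' - b')%:~R * _]mulrC.
have /andP[+ _] := wh_bound l' (b' - 1); have /andP[+ _] := wh_bound l' (t' - 1).
by rewrite !isumB; lra.
Qed.

(** Optimality against restoring the last removed column, whose cells have distance [N1] away from
    the corners; the last term on the right is the corner error of [isum_d_ge]. *)
Lemma left_add : (0 < N1)%N ->
  isum b' t' (fun j => wv (l' - 1) j - wv (l' - 2) j) +
    g * (N1%:R * (t' - b')%:~R) <= 2 + 2 * e + 2 * (g * kappa%:R ^+ 2).
Proof.
move=> N10.
have [h1 h2 h3 h4] := corners; have [[q1 q2] [q3 q4 q5 q6]] := N_bounds.
have l1 : l <= l' - 1 by rewrite /l'; move: N10; clear; lia.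
have Gin : inside n (grect (l' - 1) r' b' t').
  by move=> k j; rewrite /grect; move: l1 h1 h2 h3 h4 q3 q4 q5 q6; clear; lia.
have GF k j : grect (l' - 1) r' b' t' k j -> F k j.
  by rewrite /F /grect; move: l1 q3 q4 q5 q6; clear; lia.
have lr : l' - 1 + 1 < r' by move: kappa_gt0 q1; clear; lia.
have := rectJ_left wv wh g d lr q2 Gin GF.
have := rect_opt Gin.
have -> : l' - 1 - 1 = l' - 2 by clear; lia.
rewrite subrK.
have dge : (t' - b')%:~R * N1%:R - 2 * kappa%:R ^+ 2 <= isum b' t' (d (l' - 1)).
  have dFj j : b' <= j < t' -> F (l' - 1) j.
    by move=> hj; apply: GF; rewrite /grect hj; move: lr; clear; lia.
  apply: isum_d_ge => // j hj.
    rewrite dF; last exact: dFj.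
    rewrite ler0z; move: (dFj _ hj); rewrite /F /grect; clear; lia.
  move=> j1 j2; rewrite dF; last exact: dFj.
  rewrite -[_%:R]/(N1%:Z%:~R) ler_int; move: j1 j2 q1 q4 N1k.
  by rewrite /l' /r'; clear; lia.
have := ler_wpM2l (ltW g0) dge; rewrite [(t' - b')%:~R * _]mulrC mulrBr.
have /andP[_ +] := wh_bound (l' - 1) (b' - 1); have /andP[_ +] := wh_bound (l' - 1) (t' - 1).
by rewrite !isumB; lra.
Qed.

Lemma right_remove :
  2 - 2 * e <= isum b' t' (fun j => wv (r' - 2) j - wv (r' - 1) j) +
               g * (N2.+1%:R * (t' - b')%:~R).
Proof.
have [h1 h2 h3 h4] := corners; have [[q1 q2] [q3 q4 q5 q6]] := N_bounds.
have Gin : inside n (grect l' r' b' t').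
  by move=> k j; rewrite /grect; move: h1 h2 h3 h4 q3 q4 q5 q6; clear; lia.
have GF k j : grect l' r' b' t' k j -> F k j.
  by rewrite /F /grect; move: q3 q4 q5 q6; clear; lia.
have G'in : inside n (grect l' (r' - 1) b' t').
  by move=> k j h; apply: Gin; move: h; rewrite /grect; clear; lia.
have lr : l' + 1 < r' by move: kappa_gt0 q1; clear; lia.
have := rectJ_right wv wh g d lr q2 Gin GF.
have := rect_opt G'in.
have dle : isum b' t' (d (r' - 1)) <= (t' - b')%:~R * N2.+1%:R.
  apply: isum_d_le => j hj; rewrite dF.
    by rewrite -[_%:R]/(N2.+1%:Z%:~R) ler_int /r'; clear; lia.
  by apply: GF; rewrite /grect hj; move: lr; clear; lia.
have := ler_wpM2l (ltW g0) dle; rewrite [(t' - b')%:~R * _]mulrC.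
have /andP[+ _] := wh_bound (r' - 1) (b' - 1).
have /andP[+ _] := wh_bound (r' - 1) (t' - 1).
by rewrite !isumB; lra.
Qed.

Lemma right_add : (0 < N2)%N ->
  isum b' t' (fun j => wv (r' - 1) j - wv r' j) +
    g * (N2%:R * (t' - b')%:~R) <= 2 + 2 * e + 2 * (g * kappa%:R ^+ 2).
Proof.
move=> N10.
have [h1 h2 h3 h4] := corners; have [[q1 q2] [q3 q4 q5 q6]] := N_bounds.
have l1 : r' + 1 <= r by rewrite /r'; move: N10; clear; lia.
have Gin : inside n (grect l' (r' + 1) b' t').
  by move=> k j; rewrite /grect; move: l1 h1 h2 h3 h4 q3 q4 q5 q6; clear; lia.
have GF k j : grect l' (r' + 1) b' t' k j -> F k j.
  by rewrite /F /grect; move: l1 q3 q4 q5 q6; clear; lia.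
have lr : l' + 1 < r' + 1 by move: kappa_gt0 q1; clear; lia.
have := rectJ_right wv wh g d lr q2 Gin GF.
have := rect_opt Gin.
have -> : r' + 1 - 2 = r' - 1 by clear; lia.
rewrite addrK.
have dge : (t' - b')%:~R * N2%:R - 2 * kappa%:R ^+ 2 <= isum b' t' (d r').
  have dFj j : b' <= j < t' -> F r' j.
    by move=> hj; apply: GF; rewrite /grect hj; move: lr; clear; lia.
  apply: isum_d_ge => // j hj.
    rewrite dF; last exact: dFj.
    rewrite ler0z; move: (dFj _ hj); rewrite /F /grect; clear; lia.
  move=> j1 j2; rewrite dF; last exact: dFj.
  rewrite -[_%:R]/(N2%:Z%:~R) ler_int; move: j1 j2 q1 q3 N2k.
  by rewrite /l' /r'; clear; lia.
have := ler_wpM2l (ltW g0) dge; rewrite [(t' - b')%:~R * _]mulrC mulrBr.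
have /andP[_ +] := wh_bound r' (b' - 1); have /andP[_ +] := wh_bound r' (t' - 1).
by rewrite !isumB; lra.
Qed.

End Thresholds.
End RectEnergy.

(** * Lattice sets as sets of cells *)

Section Cells.
Context {R : realType}.
Variable eps : R.
Hypothesis eps_gt0 : 0 < eps.
Implicit Types (A B G : gset) (k j : int).

Definition idx (u : R) : int := Num.floor (u / eps + 2^-1).

Definition lat k j : R * R := (eps * k%:~R, eps * j%:~R).

Definition gcells A : set (R * R) := [set x | A (idx x.1) (idx x.2)].

Lemma latE k j : eps *: zpoint (k, j) = lat k j.
Proof. by []. Qed.

Lemma idxP (u : R) k : idx u = k <-> eps * k%:~R - eps / 2 <= u < eps * k%:~R + eps / 2.
Proof.
have -> : (eps * k%:~R - eps / 2 <= u < eps * k%:~R + eps / 2) =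
    (k%:~R <= u / eps + 2^-1 < (k + 1)%:~R).
  rewrite rmorphD /=; congr andb.
    rewrite -lerBlDr ler_pdivlMr// mulrBl [k%:~R * _]mulrC; congr (_ - _ <= _).
    by rewrite mulrC.
  rewrite -ltrBrDr ltr_pdivrMr// [_ * eps]mulrC -addrA mulrDr; congr (_ < _ + _).
  by congr (_ * _); lra.
by split=> [<-|h]; [rewrite Num.Theory.floor_itv//|apply/Num.Theory.floor_def].
Qed.

Lemma idx_lat k : idx (eps * k%:~R) = k.
Proof. by apply/idxP; apply/andP; split; move: eps_gt0; lra. Qed.

Lemma cellP k j x : cell eps (lat k j) x <-> idx x.1 = k /\ idx x.2 = j.
Proof.
by rewrite /cell/=; split=> [[/idxP -> /idxP ->]|[/idxP + /idxP +]].
Qed.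

Lemma gcells_lat A k j : gcells A (lat k j) = A k j.
Proof. by rewrite /gcells /= !idx_lat. Qed.

Lemma lattice_set_gcells A : lattice_set eps (gcells A).
Proof.
exists [set x | exists k j, A k j /\ x = lat k j].
  by move=> x [k [j [_ ->]]]; exists (k, j).
apply/seteqP; split=> [x Ax|x [_ [k [j [Akj ->]]]]].
  by exists (lat (idx x.1) (idx x.2)); [exists (idx x.1), (idx x.2)|exact/cellP].
by move=> /cellP[h1 h2]; rewrite /gcells/= h1 h2.
Qed.

Lemma lattice_setP (E : set (R * R)) : lattice_set eps E ->
  E = gcells (fun k j => `[< E (lat k j) >]).
Proof.
move=> [I Il BE]; apply/seteqP; split=> x.
  rewrite /gcells/= => Bx; apply/asboolP; move: Bx; rewrite BE => -[i Ii].
  have [[k j] ik] := Il _ Ii; rewrite ik latE => /cellP[-> ->].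
  by exists i => //; rewrite ik latE; apply/cellP; rewrite !idx_lat.
rewrite /gcells/= => /asboolP; rewrite BE => -[i Ii].
have [[k j] ik] := Il _ Ii; rewrite ik latE => /cellP; rewrite !idx_lat => -[h1 h2].
by exists i => //; rewrite ik latE; apply/cellP.
Qed.

Lemma gcellsY A B : gcells A `+` gcells B = gcells (fun k j => A k j (+) B k j).
Proof.
apply/seteqP; split=> x; rewrite /gcells/= /setY /=.
  by move=> -[[+ /negP/negPf ->]|[+ /negP/negPf ->]] => [-> | ->].
by case: (A _ _) (B _ _) => [] [] //= _; [left|right].
Qed.

(* Only the cells i1, i2 meet small balls around x, and both meet all of them. *)
Lemma boundary_two_cells A (x : R * R) (k1 j1 k2 j2 : int) :
  (forall e, 0 < e -> exists y, [/\ ball x e y, idx y.1 = k1 & idx y.2 = j1]) ->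
  (forall e, 0 < e -> exists y, [/\ ball x e y, idx y.1 = k2 & idx y.2 = j2]) ->
  (exists2 e, 0 < e & forall y, ball x e y ->
     (idx y.1 = k1 /\ idx y.2 = j1) \/ (idx y.1 = k2 /\ idx y.2 = j2)) ->
  topological_boundary (gcells A) x <-> A k1 j1 (+) A k2 j2.
Proof.
move=> h1 h2 [e e0 h]; rewrite /topological_boundary.
split=> [[cl ni]|].
  have [y [Ay /h]] := cl _ (nbhsx_ballx x e e0).
  move: Ay; rewrite /gcells /= => Ay yk.
  have A12 : A k1 j1 || A k2 j2.
    by move: Ay; case: yk => -[-> ->] ->; rewrite ?orbT.
  apply/negP => A12'; apply: ni; apply/nbhs_ballP; exists e => // z /h.
  rewrite /gcells/=; move: A12 A12'.
  by case E1 : (A k1 j1); case E2 : (A k2 j2) => //= _ _ [] [-> ->].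
move=> A12; split.
  move=> B /nbhs_ballP[e' e'0 eB].
  have [y1 [b1 k1y j1y]] := h1 _ e'0; have [y2 [b2 k2y j2y]] := h2 _ e'0.
  case E1 : (A k1 j1); first by exists y1; split; [rewrite /gcells/= k1y j1y|exact: eB].
  exists y2; split; last exact: eB.
  by rewrite /gcells/= k2y j2y; move: A12; rewrite E1.
move=> /nbhs_ballP[e' e'0 eB].
have [y1 [b1 k1y j1y]] := h1 _ e'0; have [y2 [b2 k2y j2y]] := h2 _ e'0.
by move: (eB _ b1) (eB _ b2) A12; rewrite /gcells/= k1y j1y k2y j2y => -> ->.
Qed.

Definition vmid k j : R * R := (k%:~R + 2^-1, j%:~R).
Definition hmid k j : R * R := (k%:~R, j%:~R + 2^-1).

Let idx_mid (e : R) k : 0 < e -> exists2 u, ball (eps * (k%:~R + 2^-1)) e u & idx u = k.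
Proof.
move=> e0; pose q := Num.min (e / 2) (eps / 2).
have q0 : 0 < q by rewrite /q lt_min !divr_gt0.
have [q1 q2] : q <= e / 2 /\ q <= eps / 2 by rewrite /q !ge_min !lexx orbT.
exists (eps * (k%:~R + 2^-1) - q).
  by rewrite /ball/= opprB addrC subrK gtr0_norm//; lra.
by apply/idxP; apply/andP; split; move: eps_gt0; lra.
Qed.

Let idx_mid' k : idx (eps * (k%:~R + 2^-1)) = k + 1.
Proof. by apply/idxP; rewrite rmorphD/=; apply/andP; split; move: eps_gt0; lra. Qed.

Let idx_near (u : R) k : ball (eps * (k%:~R + 2^-1)) (eps / 2) u -> idx u = k \/ idx u = k + 1.
Proof.
rewrite /ball/= ltr_norml => /andP[h1 h2].
have [h|h] := ltP u (eps * (k%:~R + 2^-1)); [left|right]; apply/idxP;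
  rewrite ?rmorphD/=; apply/andP; split; move: eps_gt0; lra.
Qed.

Let idx_near0 (u : R) k : ball (eps * k%:~R) (eps / 2) u -> idx u = k.
Proof.
by rewrite /ball/= ltr_norml => /andP[h1 h2]; apply/idxP; apply/andP; split; lra.
Qed.

Lemma boundary_vmid A k j :
  topological_boundary (gcells A) (eps *: vmid k j) <-> vedge A k j.
Proof.
apply: boundary_two_cells.
- move=> e e0; have [u bu uk] := idx_mid k e0.
  exists (u, eps * j%:~R); split=> //=; last exact: idx_lat.
  by split => //=; exact: ballxx.
- move=> e e0; exists (eps *: vmid k j); split; first exact: ballxx.
    exact: idx_mid'.
  exact: idx_lat.
- exists (eps / 2); first by rewrite divr_gt0.
  by move=> y [/idx_near /= [->|->] /idx_near0 ->]; [left|right].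
Qed.

Lemma boundary_hmid A k j :
  topological_boundary (gcells A) (eps *: hmid k j) <-> hedge A k j.
Proof.
apply: boundary_two_cells.
- move=> e e0; have [u bu uk] := idx_mid j e0.
  exists (eps * k%:~R, u); split=> //=; first by split => //=; exact: ballxx.
  exact: idx_lat.
- move=> e e0; exists (eps *: hmid k j); split; first exact: ballxx.
    exact: idx_lat.
  exact: idx_mid'.
- exists (eps / 2); first by rewrite divr_gt0.
  by move=> y [/idx_near0 -> /idx_near /= [->|->]]; [left|right].
Qed.

End Cells.

Lemma dual_latticeP (R : realType) (xi : R * R) :
  dual_lattice xi <-> (exists k j, xi = vmid k j) \/ (exists k j, xi = hmid k j).
Proof.
split=> [[[i1 i2] [[j1 j2] /= [ij ->]]]|].
  have [h|h] : (i2 = j2 /\ (i1 = j1 + 1 \/ j1 = i1 + 1)) \/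
         (i1 = j1 /\ (i2 = j2 + 1 \/ j2 = i2 + 1)).
    have sq (x : int) : x ^+ 2 = (absz x ^ 2)%N%:Z by rewrite -abszX; lia.
    move: ij; rewrite !sq; set a := absz _; set b := absz _.
    have : (a = 0 \/ a = 1 \/ 2 <= a)%N by lia.
    have : (b = 0 \/ b = 1 \/ 2 <= b)%N by lia.
    rewrite /a /b; nia.
  - left; case: h => [-> [->|->]].
      exists j1, j2; rewrite /vmid !rmorphD/=; congr (_, _); by field.
    exists i1, j2; rewrite /vmid !rmorphD/=; congr (_, _); by field.
  - right; case: h => [-> [->|->]].
      exists j1, j2; rewrite /hmid !rmorphD/=; congr (_, _); by field.
    exists j1, i2; rewrite /hmid !rmorphD/=; congr (_, _); by field.
case=> -[k [j ->]].
  exists (k, j), (k + 1, j) => /=; split; first by ring.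
  rewrite /vmid !rmorphD/=; congr (_, _); by field.
exists (k, j), (k, j + 1) => /=; split; first by ring.
rewrite /hmid !rmorphD/=; congr (_, _); by field.
Qed.

(** * Perimeter, dissipation and energy of lattice sets in terms of cells *)

Section Perimeter.
Context {R : realType}.
Variables (eps : R) (c : R * R -> R).
Hypothesis eps_gt0 : 0 < eps.
Hypothesis term_ge0 : forall xi, dual_lattice xi -> 0 <= 1 + eps * c xi.
Implicit Types (A B G : gset) (k j : int).

Definition wvert k j : R := 1 + eps * c (vmid k j).
Definition whoriz k j : R := 1 + eps * c (hmid k j).

Let vmid_inj : injective (fun p : int * int => vmid p.1 p.2 : R * R).
Proof. by move=> [a b] [a' b'] [/addIr/intr_inj -> /intr_inj ->]. Qed.

Let hmid_inj : injective (fun p : int * int => hmid p.1 p.2 : R * R).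
Proof. by move=> [a b] [a' b'] [/intr_inj -> /addIr/intr_inj ->]. Qed.

Let vhmid k j k' j' : vmid k j != hmid k' j' :> R * R.
Proof.
apply/eqP => -[h _].
have h2 : (2 * (k - k') + 1)%:~R = 0 :> R.
  by rewrite rmorphD rmorphM rmorphB /=; lra.
by move/eqP: h2; rewrite intr_eq0; lia.
Qed.

Let pairs n : seq (int * int) := [seq (k, j) | k <- window n, j <- window n].

Let pairs_uniq n : uniq (pairs n).
Proof. by apply: allpairs_uniq; rewrite ?window_uniq// => -[? ?] [? ?]. Qed.

Let boundary_seq n A : seq (R * R) :=
  [seq vmid p.1 p.2 | p <- pairs n & vedge A p.1 p.2] ++
  [seq hmid p.1 p.2 | p <- pairs n & hedge A p.1 p.2].

Let boundary_seq_uniq n A : uniq (boundary_seq n A).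
Proof.
rewrite cat_uniq !map_inj_uniq ?filter_uniq ?pairs_uniq//= andbT.
apply/hasPn => _ /mapP[p _ ->]; apply/negP => /mapP[q _ h].
by move: (vhmid q.1 q.2 p.1 p.2); rewrite h eqxx.
Qed.

Let vedge_window n A k j : inside n A -> vedge A k j -> (k, j) \in pairs n.
Proof.
move=> Ain; rewrite /vedge => h; apply: allpairs_f; rewrite mem_window.
  by case E1 : (A k j) h => [|/=]; [have := Ain _ _ E1; lia|move/Ain; lia].
by case E1 : (A k j) h => [|/=]; [have := Ain _ _ E1; lia|move/Ain; lia].
Qed.

Let hedge_window n A k j : inside n A -> hedge A k j -> (k, j) \in pairs n.
Proof.
move=> Ain; rewrite /hedge => h; apply: allpairs_f; rewrite mem_window.
  by case E1 : (A k j) h => [|/=]; [have := Ain _ _ E1; lia|move/Ain; lia].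
by case E1 : (A k j) h => [|/=]; [have := Ain _ _ E1; lia|move/Ain; lia].
Qed.

Lemma boundary_seqE n A : inside n A ->
  [set xi | dual_lattice xi /\ topological_boundary (gcells eps A) (eps *: xi)] =
  [set` boundary_seq n A].
Proof.
move=> Ain; apply/seteqP; split=> xi /=.
  case=> /dual_latticeP[] [k [j ->]].
    move/(boundary_vmid eps_gt0) => e; rewrite mem_cat; apply/orP; left.
    apply/mapP; exists (k, j) => //; rewrite mem_filter/= e/=.
    exact: vedge_window e.
  move/(boundary_hmid eps_gt0) => e; rewrite mem_cat; apply/orP; right.
  apply/mapP; exists (k, j) => //; rewrite mem_filter/= e/=.
  exact: hedge_window e.
rewrite mem_cat => /orP[] /mapP[[k j]]; rewrite mem_filter/= => /andP[e _] ->.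
  split; first by apply/dual_latticeP; left; exists k, j.
  exact/boundary_vmid.
split; first by apply/dual_latticeP; right; exists k, j.
exact/boundary_hmid.
Qed.

Lemma perimeter_ge0 (E : set (R * R)) : (0 <= perimeter eps c E)%E.
Proof.
rewrite /perimeter/=; set D := [set _ | _].
rewrite [X in (_ - X)%E]esum1 ?sube0.
  by apply: esum_ge0 => xi _; rewrite funeposE le_max lexx orbT.
move=> xi [dxi _]; rewrite funenegE; apply/max_idPr.
by rewrite leeNl oppe0 lee_fin mulr_ge0 ?(ltW eps_gt0) ?term_ge0.
Qed.

Lemma perimeterE n A : inside n A ->
  perimeter eps c (gcells eps A) = (eps * gper n wvert whoriz A)%:E.
Proof.
move=> Ain; rewrite /perimeter/= (boundary_seqE Ain).
have dual xi : xi \in boundary_seq n A -> dual_lattice xi.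
  move=> h; have : [set` boundary_seq n A] xi by [].
  by rewrite -boundary_seqE// => -[].
have t0 xi : xi \in boundary_seq n A -> (0 <= perimeter_term eps c xi)%E.
  by move=> /dual dxi; rewrite lee_fin mulr_ge0 ?(ltW eps_gt0) ?term_ge0.
rewrite [X in (_ - X)%E]esum1 ?sube0; last first.
  by move=> xi /= /t0 h; rewrite funenegE; apply/max_idPr; rewrite leeNl oppe0.
rewrite esum_fset; [|exact: finite_seq|by move=> xi _; rewrite funeposE le_max lexx orbT].
rewrite -fsbig_seq//.
rewrite (@eq_big_seq _ _ _ _ _ _ (fun xi => (eps * (1 + eps * c xi))%:E)); last first.
  by move=> xi /t0 h; rewrite funeposE; apply/max_idPl.
rewrite sumEFin; congr EFin; rewrite -mulr_sumr; congr (_ * _).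
rewrite big_cat /gper; congr (_ + _); rewrite big_map big_filter big_mkcond
  /= big_allpairs_dep /=; apply: eq_bigr => k _; apply: eq_bigr => j _ /=.
  by rewrite /wvert; case: ifP; rewrite ?mulr1 ?mulr0.
by rewrite /whoriz; case: ifP; rewrite ?mulr1 ?mulr0.
Qed.

End Perimeter.

Section Dissipation.
Context {R : realType}.
Variable eps : R.
Hypothesis eps_gt0 : 0 < eps.
Implicit Types (A B G : gset) (k j : int).

Let mu := ((@lebesgue_measure R) \x (@lebesgue_measure R))%E.

Lemma cellE k j : cell eps (lat eps k j) =
  `[eps * k%:~R - eps / 2, eps * k%:~R + eps / 2[%classic `*`
  `[eps * j%:~R - eps / 2, eps * j%:~R + eps / 2[%classic.
Proof. by apply/seteqP; split=> x /=; rewrite !in_itv. Qed.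

Lemma measurable_cell k j : measurable (cell eps (lat eps k j)).
Proof. by rewrite cellE; apply: measurableX; exact: measurable_itv. Qed.

Lemma cell_measure k j : mu (cell eps (lat eps k j)) = (eps ^+ 2)%:E.
Proof.
rewrite cellE /mu product_measure1E; [|exact: measurable_itv|exact: measurable_itv].
have len (i : int) : (@lebesgue_measure R)
    `[eps * i%:~R - eps / 2, eps * i%:~R + eps / 2[%classic = eps%:E.
  rewrite lebesgue_measure_itv/= lte_fin ifT; last by move: eps_gt0; lra.
  by rewrite -EFinB; congr EFin; field.
transitivity (eps%:E * eps%:E)%E; last by rewrite -EFinM.
congr (_ * _)%E; exact: len.
Qed.

Lemma measurable_gcells A : measurable (gcells eps A).
Proof.
have -> : gcells eps A = \bigcup_p (if A p.1 p.2 then cell eps (lat eps p.1 p.2) else set0).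
  apply/seteqP; split=> [x Ax|x [[k j] _ /=]].
    by exists (idx eps x.1, idx eps x.2) => //=; rewrite /gcells /= in Ax; rewrite Ax; exact/cellP.
  by case: ifP => // Akj /(cellP eps_gt0)[h1 h2]; rewrite /gcells/= h1 h2.
apply: countable_bigcupT_measurable => // -[k j] /=.
by case: ifP => _; [exact: measurable_cell|exact: measurable0].
Qed.

Lemma measurable_cellwise (phi : int -> int -> \bar R) :
  measurable_fun [set: R * R] ((fun x => phi (idx eps x.1) (idx eps x.2)) : R * R -> \bar R).
Proof.
move=> _ Y mY; rewrite setTI.
rewrite (_ : _ @^-1` _ = gcells eps (fun k j => `[< Y (phi k j) >])).
  exact: measurable_gcells.
by apply/seteqP; split=> x; rewrite /gcells/=; [move/asboolP|move=> /asboolP].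
Qed.

Lemma integral_cell (phi : int -> int -> \bar R) k j :
  (\int[mu]_(x in cell eps (lat eps k j)) phi (idx eps x.1) (idx eps x.2) =
   phi k j * (eps ^+ 2)%:E)%E.
Proof.
rewrite -(cell_measure k j) -integral_cst; last exact: measurable_cell.
by apply: eq_integral => x; rewrite inE => /(cellP eps_gt0)[-> ->].
Qed.

Lemma integral_gcells n (phi : int -> int -> R) A : inside n A ->
  (forall k j, 0 <= phi k j) ->
  (\int[mu]_(x in gcells eps A) (phi (idx eps x.1) (idx eps x.2))%:E)%E =
  (eps ^+ 2 * wsum n (fun k j => (A k j)%:R * phi k j))%:E.
Proof.
move=> Ain phi0.
pose s := [seq p <- [seq (k, j) | k <- window n, j <- window n] | A p.1 p.2].
have su : uniq s.
  by rewrite filter_uniq// allpairs_uniq ?window_uniq// => -[? ?] [? ?].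
have sE : gcells eps A = \big[setU/set0]_(p <- s) cell eps (lat eps p.1 p.2).
  rewrite -bigcup_seq; apply/seteqP; split=> [x Ax|x [[k j]]].
    exists (idx eps x.1, idx eps x.2); last exact/cellP.
    rewrite /s /= mem_filter /=; move: Ax; rewrite /gcells /= => Ax; rewrite Ax/=.
    by have := Ain _ _ Ax => -[? ?]; apply: allpairs_f; rewrite mem_window; lia.
  by rewrite /= mem_filter => /andP[/= Akj _] /(cellP eps_gt0)[h1 h2]; rewrite /gcells/= h1 h2.
rewrite sE ge0_integral_bigsetU//; first last.
- by move=> x _; rewrite lee_fin.
- apply: measurable_funTS; exact: (measurable_cellwise (fun k j => (phi k j)%:E)).
- move=> [k j] [k' j'] _ _ [x [/(cellP eps_gt0)[h1 h2] /(cellP eps_gt0)[/= h3 h4]]].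
  by move: h1 h2 => /=; rewrite h3 h4 => -> ->.
- by move=> p; exact: measurable_cell.
rewrite (eq_bigr (fun p => (phi p.1 p.2 * eps ^+ 2)%:E)); last first.
  by move=> p _; rewrite (integral_cell (fun k j => (phi k j)%:E)).
rewrite sumEFin; congr EFin; rewrite /s big_filter big_mkcond /= big_allpairs_dep/=.
rewrite /wsum mulr_sumr; apply: eq_bigr => k _; rewrite mulr_sumr; apply: eq_bigr => j _.
by case: (A k j); rewrite ?mul1r ?mul0r ?mulr0// mulrC.
Qed.

Lemma integral_gcells_ge (phi : int -> int -> \bar R) A k j : A k j ->
  (forall k j, 0 <= phi k j)%E ->
  (phi k j * (eps ^+ 2)%:E <=
   \int[mu]_(x in gcells eps A) phi (idx eps x.1) (idx eps x.2))%E.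
Proof.
move=> Akj phi0; rewrite -integral_cell; apply: ge0_subset_integral => //.
- exact: measurable_cell.
- exact: measurable_gcells.
- by apply: measurable_funTS; exact: measurable_cellwise.
- by move=> x /(cellP eps_gt0)[h1 h2]; rewrite /gcells/= h1 h2.
Qed.

Lemma infnorm_lat k j k' j' :
  infnorm (lat eps k j - lat eps k' j') = eps * (Num.max `|k - k'| `|j - j'|)%:~R.
Proof.
rewrite /infnorm/= -!mulrBr -!rmorphB/= !normrM !(gtr0_norm eps_gt0) -!intr_norm.
case: (leP `|k - k'| `|j - j'|) => h; [apply/max_idPr|apply/max_idPl];
  by rewrite ler_pM2l// ler_int// ltW.
Qed.

Definition ldist G k j : \bar R := lattice_dist eps (gcells eps G) (lat eps k j).

(** Distances in units of [eps]. Taking [fine] loses nothing for a bounded nonempty [G], by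
    [ldist_fin]. *)
Definition gdist G k j : R := fine (ldist G k j) / eps.

Lemma cell_center_lat x : cell_center eps x = lat eps (idx eps x.1) (idx eps x.2).
Proof. by []. Qed.

Lemma lattice_distE G x :
  lattice_dist eps (gcells eps G) x = ldist G (idx eps x.1) (idx eps x.2).
Proof. by rewrite /ldist /lattice_dist !cell_center_lat/= !(idx_lat eps_gt0). Qed.

Lemma ldist_in G k j : G k j -> ldist G k j =
  ereal_inf [set z | exists k' j', ~~ G k' j' /\
    z = (eps * (Num.max `|k - k'| `|j - j'|)%:~R)%:E].
Proof.
move=> Gkj; rewrite /ldist /lattice_dist cell_center_lat !(idx_lat eps_gt0).
rewrite ifT; last by rewrite inE gcells_lat.
congr ereal_inf; apply/seteqP; split=> [_ [_ [[[k' j'] ->] nG] <-]|_ [k' [j' [nG ->]]]].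
  exists k', j'; rewrite -infnorm_lat; split => //.
  by apply/negP => G'; apply: nG; rewrite latE gcells_lat.
exists (lat eps k' j'); last by rewrite infnorm_lat.
by split; [exists (k', j')|rewrite gcells_lat//; exact/negP].
Qed.

Lemma ldist_out G k j : ~~ G k j -> ldist G k j =
  ereal_inf [set z | exists k' j', G k' j' /\
    z = (eps * (Num.max `|k - k'| `|j - j'|)%:~R)%:E].
Proof.
move=> Gkj; rewrite /ldist /lattice_dist cell_center_lat !(idx_lat eps_gt0).
rewrite ifF; last by apply/negP; rewrite inE gcells_lat//; exact/negP.
congr ereal_inf; apply/seteqP; split=> [_ [_ [[[k' j'] ->] nG] <-]|_ [k' [j' [nG ->]]]].
  exists k', j'; rewrite -infnorm_lat; split => //.
  by move: nG; rewrite latE gcells_lat.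
exists (lat eps k' j'); last by rewrite infnorm_lat.
by split; [exists (k', j')|rewrite gcells_lat].
Qed.

Lemma ldist_ge G k j : (eps%:E <= ldist G k j)%E.
Proof.
case: (boolP (G k j)) => Gkj; [rewrite ldist_in//|rewrite ldist_out//];
  apply/ereal_infP => _ [k' [j' [G' ->]]]; rewrite lee_fin;
  apply: ler_peMr; rewrite ?(ltW eps_gt0)// ler1z.
  have : ~ (k' = k /\ j' = j) by move=> [h1 h2]; move: G'; rewrite h1 h2 Gkj.
  lia.
have : ~ (k' = k /\ j' = j) by move=> [h1 h2]; move: Gkj; rewrite -h1 -h2 G'.
lia.
Qed.

Lemma ldist_fin n G k j : inside n G -> (exists k j, G k j) ->
  ldist G k j = (eps * gdist G k j)%:E.
Proof.
move=> Gin [k0 [j0 G0]].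
suff fin : ldist G k j \is a fin_num.
  by rewrite /gdist mulrCA divff ?gt_eqF// mulr1 fineK.
rewrite fin_real//; apply/andP; split.
  by apply: lt_le_trans (ldist_ge G k j); rewrite ltNyr.
case: (boolP (G k j)) => Gkj; [rewrite ldist_in//|rewrite ldist_out//].
  apply: (@le_lt_trans _ _ (eps * (Num.max `|k - n%:Z| `|j - n%:Z|)%:~R)%:E); last by rewrite ltry.
  apply: ereal_inf_lbound; exists n%:Z, n%:Z; split=> //; apply/negP => /Gin; lia.
apply: (@le_lt_trans _ _ (eps * (Num.max `|k - k0| `|j - j0|)%:~R)%:E); last by rewrite ltry.
by apply: ereal_inf_lbound; exists k0, j0.
Qed.

Lemma gdist_ge1 n G k j : inside n G -> (exists k j, G k j) -> 1 <= gdist G k j.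
Proof.
move=> Gin G0; have := ldist_ge G k j.
by rewrite (ldist_fin k j Gin G0) lee_fin -{1}[eps]mulr1 ler_pM2l.
Qed.

Lemma gdist_rect n l r b t k j : inside n (grect l r b t) -> grect l r b t k j ->
  gdist (grect l r b t) k j =
  (Num.min (Num.min (k - l + 1) (r - k)) (Num.min (j - b + 1) (t - j)))%:~R.
Proof.
set q := Num.min (Num.min _ _) _ => Gin Gkj.
suff : ldist (grect l r b t) k j = (eps * q%:~R)%:E.
  rewrite (ldist_fin k j Gin); last by exists k, j.
  by move=> -[] /mulfI; apply; rewrite gt_eqF.
rewrite ldist_in//; apply/eqP; rewrite eq_le; apply/andP; split.
  have wit k' j' : ~~ grect l r b t k' j' -> Num.max `|k - k'| `|j - j'| = q ->
      (ereal_inf [set z | exists k' j', ~~ grect l r b t k' j' /\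
       z = (eps * (Num.max `|k - k'| `|j - j'|)%:~R)%:E] <= (eps * q%:~R)%:E)%E.
    by move=> h1 h2; apply: ereal_inf_lbound; exists k', j'; rewrite h2.
  have [h|[h|[h|h]]] : q = k - l + 1 \/ (q = r - k \/ (q = j - b + 1 \/ q = t - j)).
    by rewrite /q; lia.
  - apply: (wit (l - 1) j); first by rewrite /grect; lia.
    by rewrite h; move: Gkj; rewrite /grect; lia.
  - apply: (wit r j); first by rewrite /grect; lia.
    by rewrite h; move: Gkj; rewrite /grect; lia.
  - apply: (wit k (b - 1)); first by rewrite /grect; lia.
    by rewrite h; move: Gkj; rewrite /grect; lia.
  - apply: (wit k t); first by rewrite /grect; lia.
    by rewrite h; move: Gkj; rewrite /grect; lia.
apply/ereal_infP => _ [k' [j' [G' ->]]]; rewrite lee_fin ler_pM2l// ler_int.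
by move: G' Gkj; rewrite /q /grect; lia.
Qed.

Lemma ldist_out_ge n G k j (N : nat) : inside n G ->
  (n%:Z + N%:Z <= `|k| \/ n%:Z + N%:Z <= `|j|) -> ((eps * N%:R)%:E <= ldist G k j)%E.
Proof.
move=> Gin h.
rewrite ldist_out; last by apply/negP => /Gin; move: h; lia.
apply/ereal_infP => _ [k' [j' [/Gin G' ->]]]; rewrite lee_fin ler_pM2l//.
by rewrite -[N%:R]/(N%:Z%:~R) ler_int; move: G' h; lia.
Qed.

End Dissipation.

Section EnergyFormula.
Context {R : realType}.
Variables (gamma eps : R) (c : R * R -> R).
Hypotheses (gamma_gt0 : 0 < gamma) (eps_gt0 : 0 < eps).
Hypothesis term_ge0 : forall xi, dual_lattice xi -> 0 <= 1 + eps * c xi.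
Implicit Types (A G : gset).

Lemma energyE n A G : inside n A -> inside n G -> (exists k j, G k j) ->
  energy gamma eps c (gcells eps A) (gcells eps G) =
  (eps * genergy n (wvert eps c) (whoriz eps c) (eps / gamma) (gdist eps G) G A)%:E.
Proof.
move=> Ain Gin G0; rewrite /energy (perimeterE eps_gt0 term_ge0 Ain) gcellsY.
under eq_integral do rewrite (lattice_distE eps_gt0).
under eq_integral do rewrite (ldist_fin eps_gt0 _ _ Gin G0).
have Xin : inside n (fun k j => A k j (+) G k j).
  by move=> k j; case Akj : (A k j); [move=> _; apply: Ain|move/Gin].
rewrite (integral_gcells eps_gt0 (phi := fun k j => eps * gdist eps G k j) Xin); last first.
  by move=> k j; rewrite mulr_ge0 ?(ltW eps_gt0)// (le_trans ler01)// (gdist_ge1 eps_gt0 _ _ Gin).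
rewrite -EFinM -EFinD; congr EFin; rewrite /genergy [RHS]mulrDr; congr (_ + _).
rewrite (_ : wsum n _ = eps * wsum n (fun k j => (A k j (+) G k j)%:R * gdist eps G k j)).
  by field; rewrite !gt_eqF.
by rewrite -wsumZ; apply: eq_wsum => k j; rewrite mulrCA.
Qed.

(** A lattice set may be unbounded, but a cell [N] layers outside the window of [G] alone
    contributes at least eps^2 / gamma times [N] to the energy, which exceeds [M] for large [N]. *)
Lemma energy_lt_inside (E : set (R * R)) n G (M : R) : lattice_set eps E ->
  inside n G -> (exists k j, G k j) ->
  (energy gamma eps c E (gcells eps G) <= M%:E)%E ->
  exists n' A, inside n' A /\ E = gcells eps A.
Proof.
move=> /(lattice_setP eps_gt0) EE Gin G0; set A := (fun k j => _) in EE.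
rewrite EE => EM.
pose q := (gamma * eps)^-1 * eps ^+ 3.
have q0 : 0 < q by rewrite mulr_gt0 ?invr_gt0 ?mulr_gt0 ?exprn_gt0.
have [N MN] : exists N : nat, M < q * N%:R.
  exists (Num.truncn (M / q)).+1; rewrite mulrC -ltr_pdivrMr//.
  exact: truncnS_gt.
exists (n + N)%N, A; split => // k j Akj.
apply: contrapT => kj.
have kj' : n%:Z + N%:Z <= `|k| \/ n%:Z + N%:Z <= `|j|.
  apply: contrapT => h; apply: kj; rewrite PoszD; split; lia.
have Gkj : ~~ G k j by apply/negP => /Gin; move: kj'; lia.
move: EM; rewrite /energy gcellsY leNgt => /negP; apply.
apply: (@lt_le_trans _ _ (((gamma * eps)^-1)%:E * ((eps * N%:R)%:E * (eps ^+ 2)%:E))%E).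
  by rewrite -!EFinM lte_fin (lt_le_trans MN)// /q le_eqVlt; apply/orP; left; apply/eqP; ring.
under eq_integral do rewrite (lattice_distE eps_gt0).
rewrite -[leLHS]add0e; apply: leeD; first exact: perimeter_ge0.
apply: lee_wpmul2l; first by rewrite lee_fin invr_ge0 ltW// mulr_gt0.
apply: le_trans (integral_gcells_ge eps_gt0 (A := fun k j => A k j (+) G k j) (k := k) (j := j) _ _).
- by apply: lee_wpmul2r; [rewrite lee_fin sqr_ge0|exact: ldist_out_ge Gin kj'].
- by rewrite Akj (negPf Gkj).
- by move=> k' j'; apply: le_trans (ldist_ge eps_gt0 G k' j'); rewrite lee_fin ltW.
Qed.

End EnergyFormula.

(** * The effective velocity *)

Section NearMinimal.
Context {R : realType}.
Variable gamma : R.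
(* The discrete first-order condition for N to minimize step_energy gamma a L n,
   relaxed by eta; for eta = 0 it characterizes the minimizers. *)
Definition near_minimal (eta L : R) (a : int -> R) (n : int) (N : nat) : Prop :=
  2 - eta <= L * (a (n + N%:Z + 1) - a (n + N%:Z) + N.+1%:R / gamma) /\
  ((0 < N)%N -> L * (a (n + N%:Z) - a (n + N%:Z - 1) + N%:R / gamma) <= 2 + eta).
End NearMinimal.

Section EffectiveVelocityTheory.
Context {R : realType}.
Variables (gamma C : R) (m : nat) (a : int -> R).
Hypotheses (gamma_gt0 : 0 < gamma) (m_gt0 : (0 < m)%N).
Hypothesis a_per : forall k, a (k + m%:Z) = a k.
Hypotheses (a_le : forall k, `|a k| <= C) (C_le : 4 * C <= gamma^-1).
Implicit Types (L eta : R) (n x y : int) (N : nat).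

(** [L * slope n p - 2] is the increment of the step energy when a side started at [n] moves from
    [p] to [p + 1]. Indexing by the position instead of the displacement makes orbits with different
    starting points comparable. *)
Definition slope (n p : int) : R := a (p + 1) - a p + (p - n + 1)%:~R / gamma.

Lemma near_minimalE eta L n N : near_minimal gamma eta L a n N <->
  2 - eta <= L * slope n (n + N%:Z) /\
  ((0 < N)%N -> L * slope n (n + N%:Z - 1) <= 2 + eta).
Proof.
rewrite /near_minimal /slope.
have -> : n + N%:Z - n + 1 = N.+1 by lia.
have -> : n + N%:Z - 1 - n + 1 = N by lia.
by rewrite subrK.
Qed.

(** The second difference of [a] is at least -4 C, hence at least -1/gamma, and the linear part
    gains 1/gamma at each unit step. So the step energy is convex in the displacement. *)
Lemma slope_mono n p p' : p <= p' -> slope n p <= slope n p'.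
Proof.
move=> pp'; have -> : p' = p + (absz (p' - p))%:Z by lia.
elim: (absz _) => [|q IH]; first by rewrite addr0.
apply: le_trans IH _; rewrite /slope; set u := p + q%:Z.
have -> : p + q.+1%:Z = u + 1 by rewrite /u; lia.
have -> : (u + 1 - n + 1)%:~R / gamma = (u - n + 1)%:~R / gamma + gamma^-1.
  have -> : u + 1 - n + 1 = (u - n + 1) + 1 by lia.
  by rewrite rmorphD/= mulrDl mul1r.
have := a_le u; have := a_le (u + 1); have := a_le (u + 1 + 1).
rewrite !ler_norml => /andP[? ?] /andP[? ?] /andP[? ?]; move: C_le; lra.
Qed.

Lemma slope_start n n' p : n <= n' -> slope n' p <= slope n p.
Proof.
move=> nn'; rewrite /slope lerD2l ler_pM2r ?invr_gt0// ler_int; lia.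
Qed.

Lemma step_energyS L n N : step_energy gamma a L n N.+1 - step_energy gamma a L n N =
  L * slope n (n + N%:Z) - 2.
Proof.
rewrite /step_energy /slope.
have -> : n + N%:Z - n + 1 = N.+1 by lia.
have -> : n + N.+1%:Z = n + N%:Z + 1 by lia.
rewrite -[N.+1%:~R]/(N.+1%:R) -(addn1 N) natrD; field; rewrite gt_eqF//.
Qed.

(** By convexity the inequalities at the two neighbours of [N] propagate to all displacements. *)
Lemma argminP L n N : 0 < L ->
  (forall N', step_energy gamma a L n N <= step_energy gamma a L n N') <->
  near_minimal gamma 0 L a n N.
Proof.
move=> L0; rewrite near_minimalE; split=> [h|[h1 h2] N'].
  split.
    by have := h N.+1; have := step_energyS L n N; lra.
  case: N h => // N h _; have := h N; have := step_energyS L n N.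
  have -> : n + N.+1%:Z - 1 = n + N%:Z by lia.
  lra.
have up q : step_energy gamma a L n N <= step_energy gamma a L n (N + q).
  elim: q => [|q IH]; first by rewrite addn0.
  apply: le_trans IH _; rewrite addnS; have := step_energyS L n (N + q).
  have : slope n (n + N%:Z) <= slope n (n + (N + q)%N%:Z) by apply: slope_mono; lia.
  move=> /(ler_wpM2l (ltW L0)); lra.
have down q : (q <= N)%N -> step_energy gamma a L n N <= step_energy gamma a L n (N - q).
  elim: q => [|q IH] qN; first by rewrite subn0.
  apply: (le_trans (IH (ltnW qN))).
  have -> : (N - q = (N - q.+1).+1)%N by lia.
  have := step_energyS L n (N - q.+1).
  have : slope n (n + (N - q.+1)%N%:Z) <= slope n (n + N%:Z - 1) by apply: slope_mono; lia.
  have N0 : (0 < N)%N by lia.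
  move=> /(ler_wpM2l (ltW L0)); have := h2 N0; lra.
have [NN'|N'N] := leqP N N'; first by rewrite -(subnKC NN').
by rewrite -(subKn (ltnW N'N)); apply: down; rewrite leq_subr.
Qed.

Lemma argmin_stepP L n : 0 < L -> near_minimal gamma 0 L a n (argmin_step gamma a L n).
Proof.
move=> L0; apply/(argminP _ _ L0).
suff [N hN] : exists N, near_minimal gamma 0 L a n N.
  have : [set N | forall N', step_energy gamma a L n N <= step_energy gamma a L n N'] N.
    by apply/argminP.
  by move=> /getI.
have ex : exists N, 2 <= L * slope n (n + N%:Z).
  pose N := (Num.truncn ((2 / L + 2 * C) * gamma)).+1; exists N.
  rewrite mulrC -ler_pdivrMr// /slope.
  have : 2 / L + 2 * C <= N%:R / gamma.
    by rewrite ler_pdivlMr// ltW//; exact: truncnS_gt.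
  have -> : n + N%:Z - n + 1 = N.+1 by lia.
  have : N%:R / gamma <= N.+1%:~R / gamma.
    by rewrite ler_pM2r ?invr_gt0// -[N.+1%:~R]/(N.+1%:R) ler_nat.
  have := a_le (n + N%:Z); have := a_le (n + N%:Z + 1).
  rewrite !ler_norml => /andP[? ?] /andP[? ?]; lra.
exists (ex_minn ex); case: ex_minnP => N h1 h2; apply/near_minimalE; split; first by rewrite subr0.
move=> N0; rewrite addr0 leNgt; apply/negP => h; have /h2 : 2 <= L * slope n (n + N.-1%:Z).
  by have -> : n + N.-1%:Z = n + N%:Z - 1; [lia|exact: ltW].
lia.
Qed.

(** Otherwise the last cell crossed from [x] lies at or beyond [y + N2], where the slope for the
    start [y] is at least 2 / L2. For the earlier start [x] it is at least as large, and multiplied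
    by [L] it exceeds 2 + eta. The gap between [L2] and [L] thus absorbs [eta]. *)
Lemma near_minimal_le eta L L2 x y N N2 : 0 < L -> 0 < L2 ->
  (2 + eta) * L2 < 2 * L -> x <= y -> near_minimal gamma eta L a x N ->
  near_minimal gamma 0 L2 a y N2 -> x + N%:Z <= y + N2%:Z.
Proof.
move=> L0 L20 LL xy /near_minimalE[_ h1] /near_minimalE[h2 _].
rewrite leNgt; apply/negP => hN.
have N0 : (0 < N)%N by lia.
have := h1 N0; rewrite leNgt => /negP; apply.
have s1 : slope y (y + N2%:Z) <= slope x (x + N%:Z - 1).
  by apply: le_trans (slope_start _ xy) _; apply: slope_mono; lia.
have s2 : 2 / L2 <= slope y (y + N2%:Z).
  by rewrite ler_pdivrMr// mulrC; move: h2; rewrite subr0.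
apply: (@lt_le_trans _ _ (L * (2 / L2))); last by rewrite ler_pM2l//; exact: le_trans s1.
by rewrite mulrA ltr_pdivlMr// [L * 2]mulrC.
Qed.

Lemma near_minimal_ge eta L L1 x y N N1 : 0 < L -> 0 < L1 ->
  2 * L < (2 - eta) * L1 -> y <= x -> near_minimal gamma eta L a x N ->
  near_minimal gamma 0 L1 a y N1 -> y + N1%:Z <= x + N%:Z.
Proof.
move=> L0 L10 LL yx /near_minimalE[h1 _] /near_minimalE[_ h2].
rewrite leNgt; apply/negP => hN.
have N0 : (0 < N1)%N by lia.
have := h2 N0; rewrite addr0 leNgt => /negP; apply.
have s1 : slope x (x + N%:Z) <= slope y (y + N1%:Z - 1).
  by apply: le_trans (slope_start _ yx) _; apply: slope_mono; lia.
have s2 : (2 - eta) / L <= slope x (x + N%:Z) by rewrite ler_pdivrMr// mulrC.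
apply: (@lt_le_trans _ _ (L1 * ((2 - eta) / L))); last by rewrite ler_pM2l//; exact: le_trans s1.
by rewrite mulrA ltr_pdivlMr// [L1 * _]mulrC.
Qed.

(** With equal lengths there is no gap as in [near_minimal_le]; strictness comes from the starting
    points, since for x < y the slope at a given position is strictly larger for the start [x].
    Hence the choice among several minimizers does not spoil monotonicity. *)
Lemma orbit_step_mono L x y : 0 < L -> x <= y ->
  orbit_step gamma a L x <= orbit_step gamma a L y.
Proof.
move=> L0; rewrite le_eqVlt => /orP[/eqP->//|xy].
have /near_minimalE[_ h1] := argmin_stepP x L0.
have /near_minimalE[h2 _] := argmin_stepP y L0.
rewrite /orbit_step; set N := argmin_step _ _ _ x in h1 *.
set N2 := argmin_step _ _ _ y in h2 *.
rewrite leNgt; apply/negP => hN.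
have N0 : (0 < N)%N by lia.
have := h1 N0; rewrite addr0 leNgt => /negP; apply.
rewrite subr0 in h2; apply: (le_lt_trans h2); rewrite ltr_pM2l//.
apply: (@lt_le_trans _ _ (slope x (y + N2%:Z))); last by apply: slope_mono; lia.
by rewrite /slope ltrD2l ltr_pM2r ?invr_gt0// ltr_int; lia.
Qed.

Lemma a_perM k (q : int) : a (k + q * m%:Z) = a k.
Proof.
have pos (i : nat) k' : a (k' + i%:Z * m%:Z) = a k'.
  elim: i k' => [|i IH] k'; first by rewrite mul0r addr0.
  by have -> : k' + i.+1%:Z * m%:Z = k' + i%:Z * m%:Z + m%:Z; [ring|rewrite a_per].
case: q => q; first exact: pos.
by rewrite -(pos q.+1 (k + _)); congr a; rewrite NegzE; ring.
Qed.

(** The two step energies coincide as functions of [N], so [get] makes the same choice even at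
    singular lengths, where minimizers are not unique. *)
Lemma orbit_step_shift L n (q : int) :
  orbit_step gamma a L (n + q * m%:Z) = orbit_step gamma a L n + q * m%:Z.
Proof.
rewrite /orbit_step; suff -> : argmin_step gamma a L (n + q * m%:Z) = argmin_step gamma a L n.
  by rewrite addrAC.
rewrite /argmin_step; congr get; apply/funext => N.
have e N' : step_energy gamma a L (n + q * m%:Z) N' = step_energy gamma a L n N'.
  by rewrite /step_energy [_ + N'%:Z]addrAC a_perM.
by apply/propext; split=> h N'; have := h N'; rewrite !e.
Qed.

Notation orb L := (step_orbit gamma a L).

Lemma orbS L n l : orb L n l.+1 = orbit_step gamma a L (orb L n l).
Proof. by []. Qed.

Lemma orb_shift L n (q : int) l : orb L (n + q * m%:Z) l = orb L n l + q * m%:Z.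
Proof. by elim: l => // l IH; rewrite !orbS IH orbit_step_shift. Qed.

Lemma orb_mono L x y l : 0 < L -> x <= y -> orb L x l <= orb L y l.
Proof. by move=> L0 xy; elim: l => // l IH; rewrite !orbS orbit_step_mono. Qed.

Lemma orb_add L n l l' : orb L n (l + l') = orb L (orb L n l') l.
Proof. by rewrite /step_orbit iterD. Qed.

Lemma orb_le L n l l' : (l <= l')%N -> orb L n l <= orb L n l'.
Proof.
move=> /subnKC <-; elim: (_ - _)%N => [|q IH]; first by rewrite addn0.
by apply: (le_trans IH); rewrite addnS orbS /orbit_step lerDl.
Qed.

(** Among the first m + 1 positions two agree modulo [m]; from the first of them on, the orbit
    repeats itself up to a translation. *)
Lemma orbit_rate_exists L n : exists l0 tt M : nat,
  (0 < tt)%N /\ forall l, (l0 <= l)%N -> orb L n (l + tt) - orb L n l = (M * m)%:Z.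
Proof.
pose f (i : 'I_m.+1) : 'I_m := Ordinal (ltn_pmod (absz ((orb L n i %% m%:Z)%Z)) m_gt0).
have /injectivePn[i [j ij fij]] : ~~ injectiveb f.
  apply/negP => /injectiveP /leq_card; rewrite !card_ord; lia.
wlog lij : i j ij fij / (i < j)%N.
  move=> H; have [h|h|h] := ltngtP i j; first exact: (H i j).
    by apply: (H j i) => //; rewrite eq_sym.
  by move/eqP: ij; case; exact: val_inj.
have mod_eq : (orb L n i %% m%:Z = orb L n j %% m%:Z)%Z.
  have m0 : m%:Z != 0 by lia.
  move: fij => /(congr1 val)/=.
  have h1 := modz_ge0 (orb L n i) m0; have h2 := modz_ge0 (orb L n j) m0.
  have h3 : (orb L n i %% m%:Z < m%:Z)%Z by rewrite ltz_pmod//; lia.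
  have h4 : (orb L n j %% m%:Z < m%:Z)%Z by rewrite ltz_pmod//; lia.
  by rewrite !modn_small; lia.
have le_ij : orb L n i <= orb L n j by apply: orb_le; exact: ltnW.
pose M := absz ((orb L n j %/ m%:Z)%Z - (orb L n i %/ m%:Z)%Z).
have dM : orb L n j = orb L n i + M%:Z * m%:Z.
  have m0 : 0 < m%:Z by lia.
  have := divz_eq (orb L n j) m%:Z; have := divz_eq (orb L n i) m%:Z.
  rewrite mod_eq => e1 e2.
  have qq : ((orb L n i %/ m%:Z)%Z <= (orb L n j %/ m%:Z)%Z).
    rewrite -(ler_pM2r m0) -(lerD2r ((orb L n j %% m%:Z)%Z)) -e2.
    by rewrite -e1.
  have -> : M%:Z = (orb L n j %/ m%:Z)%Z - (orb L n i %/ m%:Z)%Z.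
    by rewrite /M; move: qq; clear; lia.
  by rewrite {1}e2 {1}e1; ring.
exists i, (j - i)%N, M; split; first by rewrite subn_gt0.
move=> l il; have -> : (l + (j - i) = (l - i) + j)%N by lia.
rewrite orb_add dM orb_shift -orb_add subnK//.
by rewrite addrC addKr PoszM.
Qed.

(** The deviation from linear growth is periodic from [l0] on, so its values at the first [l0 + tt]
    steps bound it. *)
Lemma deviation_bounded L n l0 tt M : (0 < tt)%N ->
  (forall l, (l0 <= l)%N -> orb L n (l + tt) - orb L n l = (M * m)%:Z) ->
  exists B, forall l, `|(orb L n l)%:~R - l%:R * ((M * m)%:R / tt%:R) : R| <= B.
Proof.
move=> tt0 h; set v := _ / _; pose dev l : R := (orb L n l)%:~R - l%:R * v.
exists (\sum_(i < l0 + tt) `|dev i|) => l; rewrite -/(dev l).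
elim/ltn_ind: l => l IH.
have [ll|ll] := ltnP l (l0 + tt).
  by rewrite (bigD1 (Ordinal ll))//= lerDl sumr_ge0.
have /IH : (l - tt < l)%N by lia.
suff -> : dev l = dev (l - tt)%N by [].
have ltl : (l0 <= l - tt)%N by lia.
have := h _ ltl; rewrite /dev subnK; last lia.
move=> /(congr1 (fun z : int => z%:~R : R)); rewrite rmorphB/= => e.
have -> : (orb L n l)%:~R = (orb L n (l - tt))%:~R + (M * m)%:R :> R.
  by rewrite -[(M * m)%:R]/((M * m)%:Z%:~R) -e addrC subrK.
rewrite natrB; last lia.
have : tt%:R * v = (M * m)%:R by rewrite /v mulrC divfK// pnatr_eq0 -lt0n.
by move=> tv; rewrite mulrBl tv opprB addrA addrAC.
Qed.

Let rate_unique (v v' B : R) : (forall l : nat, `|l%:R * (v - v')| <= B) -> v = v'.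
Proof.
move=> h; apply/eqP; rewrite -subr_eq0; apply/negPn/negP => vv.
have p : 0 < `|v - v'| by rewrite normr_gt0.
have := h (Num.truncn (B / `|v - v'|)).+1.
by rewrite normrM normr_nat -ler_pdivlMr// leNgt truncnS_gt.
Qed.

(** The rate does not depend on the start: by monotonicity the orbit of [n] stays between two
    translates of the orbit of 0 by multiples of [m], so the two differ by a bounded amount. *)
Lemma is_effective_velocity_exists L : 0 < L ->
  exists v, is_effective_velocity gamma m a L v.
Proof.
move=> L0; have [l0 [tt [M [tt0 h]]]] := orbit_rate_exists L 0.
exists ((M * m)%:R / tt%:R) => n.
have [l0' [tt' [M' [tt0' h']]]] := orbit_rate_exists L n.
exists l0', tt', M'; split=> //.
have [B hB] := deviation_bounded tt0 h; have [B' hB'] := deviation_bounded tt0' h'.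
set v := (M * m)%:R / _ in hB *; set v' := (M' * m)%:R / _ in hB' *.
have mR : 0 < m%:R :> R by rewrite ltr0n.
pose q := absz n.
have near l : `|(orb L n l)%:~R - (orb L 0 l)%:~R : R| <= (q * m)%:R.
  have up : orb L n l <= orb L 0 l + q%:Z * m%:Z.
    by rewrite -orb_shift; apply: orb_mono => //; rewrite add0r /q; nia.
  have dn : orb L 0 l - q%:Z * m%:Z <= orb L n l.
    have -> : orb L 0 l - q%:Z * m%:Z = orb L 0 l + (- q%:Z) * m%:Z by ring.
    by rewrite -orb_shift; apply: orb_mono => //; rewrite add0r /q; nia.
  rewrite -rmorphB/= -intr_norm -[(q * m)%:R]/((q * m)%:Z%:~R) ler_int PoszM; lia.
apply: (@rate_unique _ _ (B + B' + (q * m)%:R)) => l.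
have := hB l; have := hB' l; have := near l.
by rewrite !ler_norml mulrBr => /andP[? ?] /andP[? ?] /andP[? ?]; apply/andP; split; lra.
Qed.

Lemma effective_velocityP L : 0 < L ->
  is_effective_velocity gamma m a L (effective_velocity gamma m a L).
Proof.
by move=> L0; have [v hv] := is_effective_velocity_exists L0; exact: (getI hv).
Qed.

(** Up to translation there are only [m] orbits, so the bound is uniform in the starting point. This
    is needed because the discrete position at a given time is not controlled modulo [m]. *)
Lemma orbit_deviation L : 0 < L -> exists B, forall n l,
  `|(orb L n l - n)%:~R - l%:R * effective_velocity gamma m a L| <= B.
Proof.
move=> L0; set v := effective_velocity _ _ _ _.
have hn (i : 'I_m) : exists B, forall l, `|(orb L i%:Z l)%:~R - l%:R * v| <= B.
  have [l0 [tt [M [tt0 h vE]]]] := effective_velocityP L0 i%:Z.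
  by have [B hB] := deviation_bounded tt0 h; exists B => l; rewrite /v vE.
have [B hB] := choice hn.
exists (\sum_(i < m) `|B i| + m%:R) => n l.
have m0 : m%:Z != 0 by lia.
have r0 := modz_ge0 n m0.
have rm : (n %% m%:Z < m%:Z)%Z by rewrite ltz_pmod//; lia.
have im : (absz (n %% m%:Z)%Z < m)%N by lia.
have nE : n = (Ordinal im : nat)%:Z + (n %/ m%:Z)%Z * m%:Z.
  have := divz_eq n m%:Z => /=.
  have -> : (absz (n %% m%:Z)%Z)%:Z = (n %% m%:Z)%Z by lia.
  by move=> {1}->; ring.
move: (Ordinal im) nE => i ->; rewrite orb_shift.
have -> : orb L i%:Z l + (n %/ m%:Z)%Z * m%:Z - (i%:Z + (n %/ m%:Z)%Z * m%:Z) = orb L i%:Z l - i%:Z.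
  by ring.
rewrite rmorphB/= addrAC.
apply: (le_trans (ler_normB _ _)); apply: lerD.
  by apply: (le_trans (hB i l)); rewrite (bigD1 i)//= ler_wpDr ?sumr_ge0 ?ler_norm.
by rewrite -[i%:~R]/(i%:R) normr_nat ler_nat ltnW.
Qed.

(** At a nonsingular length the first-order inequalities are strict, so they persist for nearby
    lengths with the same minimizer. Only the [m] residues have to be considered, and nearby lengths
    thus have identical orbits. *)
Lemma effective_velocity_near L : 0 < L -> ~ singular_lengths gamma a L ->
  \forall L' \near L, effective_velocity gamma m a L' = effective_velocity gamma m a L.
Proof.
move=> L0 nsing.
(* Equality would exhibit [L] as singular, with the integer [N + 1] and the index
   [k = n + N + 1]. *)
have strict n (N : nat) : 2 - 0 <= L * slope n (n + N%:Z) -> 2 < L * slope n (n + N%:Z).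
  rewrite subr0 le_eqVlt => /orP[/eqP e|//]; exfalso; apply: nsing; split=> //.
  exists N.+1, (n + N%:Z + 1); rewrite e /slope addrK.
  have -> : n + N%:Z - n + 1 = N.+1 by lia.
  by rewrite -[N.+1%:~R]/(N.+1%:R); field; rewrite !gt_eqF.
suff : \forall L' \near L, forall i : 'I_m,
    argmin_step gamma a L' i%:Z = argmin_step gamma a L i%:Z.
  apply: filterS => L' h.
  have e n : orbit_step gamma a L' n = orbit_step gamma a L n.
    have m0 : m%:Z != 0 by lia.
    have r0 := modz_ge0 n m0.
    have rm : (n %% m%:Z < m%:Z)%Z by rewrite ltz_pmod//; lia.
    have im : (absz (n %% m%:Z)%Z < m)%N by lia.
    have nE : n = (Ordinal im : nat)%:Z + (n %/ m%:Z)%Z * m%:Z.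
      have := divz_eq n m%:Z => /=.
      have -> : (absz (n %% m%:Z)%Z)%:Z = (n %% m%:Z)%Z by lia.
      by move=> {1}->; ring.
    by rewrite nE !orbit_step_shift /orbit_step h.
  rewrite /effective_velocity; congr get; apply/funext => v.
  rewrite /is_effective_velocity.
  have -> : step_orbit gamma a L' = step_orbit gamma a L => //.
  apply/funext => n; apply/funext => l.
  by elim: l => // l IH; rewrite !orbS IH e.
apply: (@filter_forall R 'I_m (fun i L' => argmin_step gamma a L' i%:Z =
  argmin_step gamma a L i%:Z) (nbhs L)) => i; set n := i%:Z.
pose N := argmin_step gamma a L n.
have /near_minimalE[h1 h2] := argmin_stepP n L0.
rewrite -/N in h1 h2 *; have {}h1 := strict _ _ h1.
have {}h2 : (0 < N)%N -> L * slope n (n + N%:Z - 1) < 2.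
  move=> N0; have := h2 N0; rewrite addr0 le_eqVlt => /orP[/eqP e|//].
  have := strict n N.-1; have -> : n + N.-1%:Z = n + N%:Z - 1 by lia.
  by rewrite e subr0 lexx ltxx => /(_ isT).
have cv (x : R) : (fun L' => L' * x) @ L --> L * x.
  by apply: cvgMr_tmp; exact: cvg_id.
have nr (x : R) : 2 < L * x -> \forall L' \near L, 2 < L' * x.
  by move=> h; exact: (cv x _ (lt_nbhsr h)).
have nl (x : R) : L * x < 2 -> \forall L' \near L, L' * x < 2.
  by move=> h; exact: (cv x _ (lt_nbhsl h)).
have hg2 : \forall L' \near L, (0 < N)%N -> L' * slope n (n + N%:Z - 1) < 2.
  have [N0|_] := boolP (0 < N)%N; last by apply: filterE.
  by apply: filterS (nl _ (h2 N0)).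
near=> L'.
have L'0 : 0 < L' by near: L'; exact: lt_nbhsr.
have g1 : 2 < L' * slope n (n + N%:Z).
  by near: L'; exact: nr.
have g2 : (0 < N)%N -> L' * slope n (n + N%:Z - 1) < 2 by near: L'.
have /near_minimalE[k1 k2] := argmin_stepP n L'0.
set N' := argmin_step gamma a L' n in k1 k2 *.
apply/eqP; rewrite eqn_leq; apply/andP; split; rewrite leqNgt; apply/negP => NN.
  have N'0 : (0 < N')%N by exact: leq_ltn_trans NN.
  have := k2 N'0; rewrite addr0 leNgt => /negP; apply; apply: lt_le_trans g1 _.
  by rewrite ler_pM2l//; apply: slope_mono; lia.
have N0 : (0 < N)%N by exact: leq_ltn_trans NN.
move: k1; rewrite subr0 leNgt => /negP; apply; apply: le_lt_trans (g2 N0).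
by rewrite ler_pM2l//; apply: slope_mono; lia.
Unshelve. all: by end_near. Qed.

Lemma countable_singular : countable (singular_lengths gamma a).
Proof.
pose f (p : nat * int) : R := 2 * gamma / (p.1%:R + gamma * (a p.2 - a (p.2 - 1))).
apply: (@sub_countable _ _ _ (range f)); last first.
  by apply: (card_le_trans (card_image_le _ _)); exact: countableP.
apply: subset_card_le => L [L0 [N [k e]]]; exists (N, k) => //.
by rewrite /f/= -e invf_div mulrCA divff ?mulr1// mulf_neq0 ?gt_eqF.
Qed.

Lemma regular_between (x y : R) : x < y ->
  exists z, x < z < y /\ ~ singular_lengths gamma a z.
Proof.
move=> xy; apply: contrapT => h.
have sub : `]x, y[%classic `<=` singular_lengths gamma a.
  move=> z /=; rewrite in_itv/= => zxy; apply: contrapT => nz.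
  by apply: h; exists z.
have c : countable `]x, y[%classic by exact: sub_countable (subset_card_le sub) countable_singular.
have := countable_lebesgue_measure0 c.
rewrite lebesgue_measure_itv/= lte_fin xy -EFinB => -[] /eqP.
by rewrite subr_eq0 => /eqP e; move: xy; rewrite e ltxx.
Qed.

(** At a nonsingular length the effective velocity is locally constant and the two bounds coincide.
    At a singular one, every neighbourhood contains nonsingular lengths on both sides of [L], whose
    velocities bound [gamma * v] from below and from above. *)
Lemma velocity_law_sandwich L (v : R) : 0 < L ->
  (forall L1 L2, 0 < L2 -> L2 < L -> L < L1 ->
    effective_velocity gamma m a L1 <= gamma * v <= effective_velocity gamma m a L2) ->
  velocity_law gamma m a L v.
Proof.
move=> L0 hv; split=> [ns|sing].
  have /nbhs_ballP[e e0 he] := effective_velocity_near L0 ns.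
  pose q := Num.min (e / 2) (L / 2).
  have q0 : 0 < q by rewrite lt_min !divr_gt0.
  have [q1 q2] : q <= e / 2 /\ q <= L / 2 by rewrite /q !ge_min !lexx orbT.
  have e1 : effective_velocity gamma m a (L + q) = effective_velocity gamma m a L.
    by apply: he; rewrite /ball/= opprD addrA subrr sub0r normrN gtr0_norm//; lra.
  have e2 : effective_velocity gamma m a (L - q) = effective_velocity gamma m a L.
    by apply: he; rewrite /ball/= opprB addrC subrK gtr0_norm//; lra.
  have := hv (L + q) (L - q); rewrite e1 e2 => /(_ ltac:(lra) ltac:(lra) ltac:(lra)) h.
  have gv : gamma * v = effective_velocity gamma m a L by apply/eqP; rewrite eq_le andbC.
  by rewrite -gv mulKf// gt_eqF.
have gi : (0 <= (gamma^-1)%:E)%E by rewrite lee_fin invr_ge0 ltW.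
have vE : v%:E = ((gamma^-1)%:E * (gamma * v)%:E)%E by rewrite -EFinM mulKf// gt_eqF.
split; rewrite vE; apply: lee_wpmul2l => //.
- rewrite /effective_velocity_inf limf_einfE.
  apply: ge_ereal_sup => _ [V /nbhs_ballP[e e0 eV] <-].
  have Le : L < L + e by rewrite ltrDl.
  have [L1 [/andP[h1 h2] ns]] := regular_between Le.
  apply: ge_ereal_inf; exists (effective_velocity gamma m a L1)%:E; last first.
    by rewrite lee_fin; have /andP[] := hv L1 (L / 2) ltac:(lra) ltac:(lra) h1.
  exists L1 => //; apply: eV; last by split=> //=; lra.
  by rewrite /ball/= distrC gtr0_norm ?subr_gt0// ltrBlDl.
- rewrite /effective_velocity_sup limf_esupE.
  apply: le_ereal_inf_tmp => _ [V /nbhs_ballP[e e0 eV] <-].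
  pose q := Num.min e L.
  have q0 : 0 < q by rewrite lt_min e0.
  have [q1 q2] : q <= e /\ q <= L by rewrite /q !ge_min !lexx orbT.
  have Lq : L - q < L by rewrite ltrBlDr ltrDl.
  have [L2 [/andP[h1 h2] ns]] := regular_between Lq.
  apply: (@le_trans _ _ (effective_velocity gamma m a L2)%:E).
    by rewrite lee_fin; have /andP[_] := hv (L + 1) L2 ltac:(lra) ltac:(lra) ltac:(lra).
  apply: ereal_sup_ubound; exists L2 => //; apply: eV; last by split=> //=; lra.
  by rewrite /ball/= gtr0_norm ?subr_gt0// (lt_le_trans _ q1)// ltrBlDr addrC -ltrBlDr.
Qed.

End EffectiveVelocityTheory.

(** * One step of the scheme *)

Definition zsum {R : realType} (u v : int) (f : int -> R) : R :=
  \sum_(i < absz (v - u)) f (u + i%:Z).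

Lemma zsumE (R : realType) u (m : nat) (f : int -> R) :
  zsum u (u + m%:Z) f = \sum_(i < m) f (u + i%:Z).
Proof. by rewrite /zsum; have -> : absz (u + m%:Z - u)%R = m by lia. Qed.

Lemma isum_zsum (R : realType) n u v (f : int -> R) :
  - n%:Z <= u -> u <= v -> v <= n%:Z -> isum n u v f = zsum u v f.
Proof.
move=> un uv vn; have -> : v = u + (absz (v - u))%:Z by lia.
have : u + (absz (v - u))%:Z <= n%:Z by lia.
elim: (absz (v - u)) => [|m IH] h.
  rewrite zsumE addr0 big_ord0 /isum big1// => k _.
  by have -> : (u <= k < u) = false; [lia|rewrite mul0r].
rewrite isum_last//; [|lia..].
have -> : u + m.+1%:Z - 1 = u + m%:Z by lia.
rewrite IH; last lia.
by rewrite !zsumE big_ord_recr /= addrC.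
Qed.

Lemma zsumB (R : realType) u v (f h : int -> R) :
  zsum u v (fun k => f k - h k) = zsum u v f - zsum u v h.
Proof. by rewrite /zsum sumrB. Qed.

Lemma zsumZ (R : realType) u v x (f : int -> R) :
  zsum u v (fun k => x * f k) = x * zsum u v f.
Proof. by rewrite /zsum mulr_sumr. Qed.

(* Every side of a lattice rectangle is recorded by an integer which increases
   when the side moves inward: the left and right sides of the rectangle
   [l, r[ x [b, t[ have the coordinates l - 1 and 1 - r, which are the indices
   n of the sequences a^i in the definition of the effective velocity. *)
Definition gbox (ib : side -> int) : gset :=
  grect (ib LeftSide + 1) (1 - ib RightSide) (ib LowerSide + 1) (1 - ib UpperSide).

Definition gwidth (ib : side -> int) : int := - (ib LeftSide + ib RightSide).
Definition gheight (ib : side -> int) : int := - (ib LowerSide + ib UpperSide).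

Definition glength (ib : side -> int) (s : side) : int :=
  match s with
  | LeftSide | RightSide => gheight ib
  | LowerSide | UpperSide => gwidth ib
  end.

Section OneStep.
Context {R : realType}.
Variables (gamma C : R) (c : R * R -> R) (mu lambda : int -> R).
Hypotheses (gamma_gt0 : 0 < gamma) (C_ge0 : 0 <= C) (C_lt : 4 * C < gamma^-1).
Hypothesis c_le : forall xi, dual_lattice xi -> `|c xi| <= C.

Definition line_lln : Prop := forall D eta : R, 0 < D -> 0 < eta ->
  exists2 eps0, 0 < eps0 & forall eps, 0 < eps < eps0 -> forall k u v : int, u <= v ->
    eps * `|k%:~R| <= D -> eps * `|u%:~R| <= D -> eps * `|v%:~R| <= D ->
    `|eps * zsum u v (fun j => c (vmid k j)) - eps * (v - u)%:~R * mu k| <= eta /\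
    `|eps * zsum u v (fun j => c (hmid j k)) - eps * (v - u)%:~R * lambda k| <= eta.

Hypothesis lln : line_lln.

Definition side_mean (s : side) (k : int) : R :=
  match s with
  | LeftSide => mu k
  | RightSide => mu (- k)
  | LowerSide => lambda k
  | UpperSide => lambda (- k)
  end.

Definition minimizes (eps : R) (E F : set (R * R)) : Prop :=
  lattice_set eps E /\
  forall A, lattice_set eps A -> (energy gamma eps c E F <= energy gamma eps c A F)%E.

(** The new window [n'] is needed because nothing bounds [E] beforehand; it has to contain both the
    minimizer and [G]. *)
Lemma minimizer_gset eps n G E : 0 < eps -> eps * C <= 1 ->
  inside n G -> (exists k j, G k j) -> minimizes eps E (gcells eps G) ->
  exists n' A, [/\ inside n' A, inside n' G, E = gcells eps A, (n <= n')%N &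
    forall B, inside n' B ->
      genergy n' (wvert eps c) (whoriz eps c) (eps / gamma) (gdist eps G) G A <=
      genergy n' (wvert eps c) (whoriz eps c) (eps / gamma) (gdist eps G) G B].
Proof.
move=> eps0 epsC Gin G0 [El Emin].
have t0 xi : dual_lattice xi -> 0 <= 1 + eps * c xi.
  move/c_le; rewrite ler_norml => /andP[h _].
  have := ler_wpM2l (ltW eps0) h; rewrite mulrN; lra.
have := Emin _ (lattice_set_gcells eps0 G).
rewrite (energyE gamma_gt0 eps0 t0 Gin Gin G0) => hE.
have [n1 [A [Ain EA]]] := energy_lt_inside gamma_gt0 eps0 t0 El Gin G0 hE.
have mono (X : gset) p q : (p <= q)%N -> inside p X -> inside q X.
  by move=> pq Xin k j /Xin; lia.
exists (maxn n n1), A; split=> //.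
- by apply: mono Ain; exact: leq_maxr.
- by apply: mono Gin; exact: leq_maxl.
- exact: leq_maxl.
move=> B Bin.
have Gin' : inside (maxn n n1) G by apply: mono Gin; exact: leq_maxl.
have Ain' : inside (maxn n n1) A by apply: mono Ain; exact: leq_maxr.
have := Emin _ (lattice_set_gcells eps0 B).
rewrite EA (energyE gamma_gt0 eps0 t0 Ain' Gin' G0).
by rewrite (energyE gamma_gt0 eps0 t0 Bin Gin' G0) lee_fin ler_pM2l.
Qed.

Lemma remove_of_lln (e g eta eps X Y h ma mb : R) (N : nat) :
  `|X - eps * h * ma| <= eta / 4 -> `|Y - eps * h * mb| <= eta / 4 ->
  e * 8 <= eta -> g = eps / gamma ->
  2 - 2 * e <= X - Y + g * (N.+1%:R * h) ->
  2 - eta <= eps * h * (ma - mb + N.+1%:R / gamma).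
Proof.
rewrite !ler_norml => /andP[h1 h2] /andP[h3 h4] h5 -> h6.
have -> : eps * h * (ma - mb + N.+1%:R / gamma) =
  eps * h * ma - eps * h * mb + eps / gamma * (N.+1%:R * h) by field; rewrite gt_eqF.
move: h6; lra.
Qed.

(** The error [eta] is shared equally by the two line sums, the term 2 e of the edges at the
    corners, and the loss 2 g k of the dissipation there. *)
Lemma add_of_lln (e g eta eps X Y h ma mb k : R) (N : nat) :
  `|X - eps * h * ma| <= eta / 4 -> `|Y - eps * h * mb| <= eta / 4 ->
  e * 8 <= eta -> g = eps / gamma -> 8 * (g * k) <= eta ->
  X - Y + g * (N%:R * h) <= 2 + 2 * e + 2 * (g * k) ->
  eps * h * (ma - mb + N%:R / gamma) <= 2 + eta.
Proof.
rewrite !ler_norml => /andP[h1 h2] /andP[h3 h4] h5 -> h6 h7.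
have -> : eps * h * (ma - mb + N%:R / gamma) =
  eps * h * ma - eps * h * mb + eps / gamma * (N%:R * h) by field; rewrite gt_eqF.
move: h7; lra.
Qed.

Lemma isum_vert n eps u v k1 k2 : - n%:Z <= u -> u <= v -> v <= n%:Z ->
  isum n u v (fun j => wvert eps c k1 j - wvert eps c k2 j) =
  eps * zsum u v (fun j => c (vmid k1 j)) - eps * zsum u v (fun j => c (vmid k2 j)).
Proof.
move=> h1 h2 h3; rewrite isum_zsum// -!zsumZ -zsumB; congr zsum.
by apply/funext => j; rewrite /wvert; ring.
Qed.

Lemma isum_horiz n eps u v k1 k2 : - n%:Z <= u -> u <= v -> v <= n%:Z ->
  isum n u v (fun j => whoriz eps c j k1 - whoriz eps c j k2) =
  eps * zsum u v (fun j => c (hmid j k1)) - eps * zsum u v (fun j => c (hmid j k2)).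
Proof.
move=> h1 h2 h3; rewrite isum_zsum// -!zsumZ -zsumB; congr zsum.
by apply/funext => j; rewrite /whoriz; ring.
Qed.

Lemma step_constants (delta D eta : R) : 0 < delta -> 0 < D -> 0 < eta ->
  exists (kappa0 kappa : nat) (eps1 : R),
  [/\ (0 < kappa0)%N, (kappa0 <= kappa)%N, 16 <= delta / gamma * kappa0%:R &
      16 * kappa0%:R + 2 * (16 * C * D) < delta / gamma / 4 * kappa%:R] /\
  (0 < eps1 /\ forall eps, 0 < eps < eps1 ->
    [/\ eps * C <= 1 / 2, eps * C * 8 <= eta,
        8 * (eps / gamma * kappa%:R ^+ 2) <= eta &
        eps / gamma * kappa%:R ^+ 2 < 1 / 2] /\
    (eps * (4 * kappa%:R) < delta /\ eps * (kappa%:R + 2) < 1)).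
Proof.
move=> delta0 D0 eta0; have C0 := C_ge0; have gam0 := gamma_gt0.
pose sigma := delta / gamma.
have sigma0 : 0 < sigma by rewrite divr_gt0.
pose C1 := 16 * C * D.
pose kappa0 := (Num.truncn (16 / sigma)).+1.
pose kappa := maxn kappa0 (Num.truncn ((16 * kappa0%:R + 2 * C1) * (4 / sigma))).+1.
have kR : 0 <= kappa%:R :> R by [].
have k2 : 0 <= kappa%:R ^+ 2 / gamma :> R by apply: divr_ge0; [exact: exprn_ge0|exact: ltW].
pose m2 := 8 * (C + 1) / eta; pose m3 := 4 * kappa%:R / delta.
pose m4 := 4 * (kappa%:R ^+ 2 / gamma); pose m5 := 8 * (kappa%:R ^+ 2 / gamma) / eta.
have M2 : 0 <= m2 by apply: divr_ge0; [lra|exact: ltW].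
have M3 : 0 <= m3 by apply: divr_ge0; [lra|exact: ltW].
have M4 : 0 <= m4 by rewrite /m4; lra.
have M5 : 0 <= m5 by apply: divr_ge0; [lra|exact: ltW].
(* Every smallness condition on [eps] has the form eps x < 1 with x nonnegative, and [M] is the sum
   of these x. *)
pose M := 8 * (C + 1) + m2 + m3 + m4 + m5 + (kappa%:R + 2).
have M0 : 0 < M by rewrite /M; lra.
exists kappa0, kappa, M^-1; split.
  split=> //.
  - exact: leq_maxl.
  - by rewrite mulrC -ler_pdivrMr// ltW// truncnS_gt.
  - have -> : sigma / 4 * kappa%:R = kappa%:R * (sigma / 4) by rewrite mulrC.
    rewrite -ltr_pdivrMr ?divr_gt0// invf_div.
    apply: (lt_le_trans (truncnS_gt _)); rewrite ler_nat; exact: leq_maxr.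
split; first by rewrite invr_gt0.
move=> eps /andP[eps0 epsM].
have {}epsM : eps * M < 1 by rewrite -ltr_pdivlMr// div1r.
have q x : 0 <= x -> x <= M -> eps * x < 1.
  by move=> x0 xM; apply: le_lt_trans epsM; apply: ler_wpM2l => //; exact: ltW.
have q1 : eps * (8 * (C + 1)) < 1 by apply: q => //; rewrite ?/M; lra.
have q2 : eps * m2 < 1 by apply: q => //; rewrite /M; lra.
have q3 : eps * m3 < 1 by apply: q => //; rewrite /M; lra.
have q4 : eps * m4 < 1 by apply: q => //; rewrite /M; lra.
have q5 : eps * m5 < 1 by apply: q => //; rewrite /M; lra.
have q6 : eps * (kappa%:R + 2) < 1 by apply: q => //; rewrite ?/M; lra.
have cl x y : 0 < y -> eps * (x / y) < 1 -> eps * x < y.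
  by move=> y0; rewrite mulrA ltr_pdivrMr// mul1r.
clear q epsM; split; last by split=> //; exact: cl.
have := cl _ _ eta0 q2; have := cl _ _ eta0 q5; rewrite /m4 in q4.
have -> : eps / gamma * kappa%:R ^+ 2 = eps * (kappa%:R ^+ 2 / gamma) by rewrite [RHS]mulrA mulrAC.
by move=> *; split; lra.
Qed.

(** The bound [K] on the displacements does not depend on [eps]; it later gives the Lipschitz bound
    of the limit. The length in the conclusion is that of the new rectangle, because the competitors
    move a single side of the minimizer and leave the adjacent ones where they have arrived. *)
Lemma minimizer_of_rectangle (delta D eta : R) : 0 < delta -> 0 < D -> 0 < eta ->
  exists (K : nat) (eps0 : R), 0 < eps0 /\
  forall eps ib E, 0 < eps < eps0 ->
    (forall s, eps * `|(ib s)%:~R| <= D) ->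
    (forall s, delta <= eps * (glength ib s)%:~R) ->
    minimizes eps E (gcells eps (gbox ib)) ->
    exists N : side -> nat, let ib' := fun s => ib s + (N s)%:Z in
      [/\ forall s, (N s <= K)%N, E = gcells eps (gbox ib') &
      forall s, near_minimal gamma eta (eps * (glength ib' s)%:~R) (side_mean s) (ib s) (N s)].
Proof.
move=> delta0 D0 eta0; have C0 := C_ge0; have gam0 := gamma_gt0.
pose sigma := delta / gamma.
have sigma0 : 0 < sigma by rewrite divr_gt0.
(* Width and height together are at most 4 D / eps, and 4 e = 4 C eps. *)
pose C1 := 16 * C * D.
have [kappa0 [kappa [eps1 [[kappa0_gt0 kappa0_le kappa0_ge kappa_gt] [eps10 heps1]]]]] :=
  step_constants delta0 D0 eta0.
have kappa_gt0 : (0 < kappa)%N by exact: leq_trans kappa0_le.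
(* The indices to which the law is applied differ from those of the old sides by at most [kappa + 2]
   cells, that is by less than 1 in macroscopic units. *)
have D10 : 0 < D + 1 by exact: addr_gt0.
have eta40 : 0 < eta / 4 by exact: divr_gt0.
have [e1 e10 hlln] := lln D10 eta40.
exists kappa, (Num.min e1 eps1); split; first by rewrite lt_min e10 eps10.
move=> eps ib E /andP[eps0]; rewrite lt_min => /andP[epse1 epsM] ibD ibd Emin.
have [|[e2 e8 gk8 gk] [kd q6]] := heps1 eps; first by rewrite eps0.
pose e := eps * C; pose g := eps / gamma.
have g0 : 0 < g by rewrite divr_gt0.
have e0 : 0 <= e by rewrite mulr_ge0// ltW.
have eg : 4 * e < g by rewrite /e /g mulrCA ltr_pM2l.
pose l := ib LeftSide + 1; pose r := 1 - ib RightSide.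
pose b := ib LowerSide + 1; pose t := 1 - ib UpperSide.
have wid : r - l = gwidth ib by rewrite /r /l /gwidth; clear; lia.
have hei : t - b = gheight ib by rewrite /t /b /gheight; clear; lia.
have kcol : 4 * kappa%:Z <= r - l.
  rewrite wid -(ler_int R) -(ler_pM2l eps0) rmorphM/=.
  apply: le_trans (ibd LowerSide); exact: ltW.
have krow : 4 * kappa%:Z <= t - b.
  rewrite hei -(ler_int R) -(ler_pM2l eps0) rmorphM/=.
  apply: le_trans (ibd LeftSide); exact: ltW.
have lr : l < r by move: kcol kappa_gt0; clear; lia.
have bt : b < t by move: krow kappa_gt0; clear; lia.
have GE : gbox ib = grect l r b t by [].
have [n0 Gin0] : exists n, inside n (grect l r b t).
  exists (absz l + absz r + absz b + absz t + 1)%N.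
  by move=> k j; rewrite /grect; clear; lia.
have G0 : exists k j, grect l r b t k j.
  by exists l, b; rewrite /grect; move: lr bt; clear; lia.
rewrite GE in Emin.
have epsC : eps * C <= 1 by apply: (le_trans e2); rewrite ler_pdivrMr// mul1r ler1n.
have [n [A [Ain Fin EA _ Amin]]] := minimizer_gset eps0 epsC Gin0 G0 Emin.
set d := gdist eps (grect l r b t) in Amin.
set wv := wvert eps c in Amin; set wh := whoriz eps c in Amin.
rewrite -/g in Amin.
have d1 k j : 1 <= d k j by exact: gdist_ge1 Fin G0.
have dF k j : grect l r b t k j ->
  d k j = (Num.min (Num.min (k - l + 1) (r - k)) (Num.min (j - b + 1) (t - j)))%:~R.
  by move=> h; rewrite /d (gdist_rect eps0 Fin h).
have vm k j : dual_lattice (vmid k j : R * R) by apply/dual_latticeP; left; exists k, j.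
have hm k j : dual_lattice (hmid k j : R * R) by apply/dual_latticeP; right; exists k, j.
have wv1 k j : `|wv k j - 1| <= e.
  rewrite /wv /wvert addrAC subrr add0r normrM gtr0_norm// /e.
  by apply: ler_wpM2l; [exact: ltW|exact: c_le].
have wh1 k j : `|wh k j - 1| <= e.
  rewrite /wh /whoriz addrAC subrr add0r normrM gtr0_norm// /e.
  by apply: ler_wpM2l; [exact: ltW|exact: c_le].
have sa : sigma <= g * (r - l)%:~R.
  by rewrite wid /sigma /g mulrAC ler_pM2r ?invr_gt0//; exact: (ibd LowerSide).
have sb : sigma <= g * (t - b)%:~R.
  by rewrite hei /sigma /g mulrAC ler_pM2r ?invr_gt0//; exact: (ibd LeftSide).
have absle (x : int) : eps * x%:~R <= eps * `|x%:~R|.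
  by apply: ler_wpM2l; [exact: ltW|exact: ler_norm].
have C1ge : 4 * e * ((r - l)%:~R + (t - b)%:~R) <= C1.
  have -> : 4 * e * ((r - l)%:~R + (t - b)%:~R) =
     4 * C * (eps * ((r - l)%:~R + (t - b)%:~R)) by rewrite /e; ring.
  have -> : C1 = 4 * C * (4 * D) by rewrite /C1; ring.
  apply: ler_wpM2l; first by rewrite mulr_ge0.
  have nle s : eps * - (ib s)%:~R <= D.
    by have := absle (- ib s); rewrite rmorphN normrN => /le_trans; apply; exact: ibD.
  rewrite wid hei /gwidth /gheight !rmorphN !rmorphD/=.
  by move: (nle LeftSide) (nle RightSide) (nle LowerSide) (nle UpperSide); lra.
have [N1 [N2 [N3 [N4 [k1 k2 k3 k4 AE]]]]] := min_rect e0 e2 eg wv1 wh1 lr bt Fin d1 dF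
  Ain Amin sigma0 sa sb C1ge kappa0_gt0 kappa0_le kappa0_ge kappa_gt kcol krow gk.
have {}AE : A = grect (l + N1%:Z) (r - N2%:Z) (b + N3%:Z) (t - N4%:Z).
  by apply/funext => k; apply/funext => j; exact: AE.
pose N s := match s with LeftSide => N1 | RightSide => N2 | LowerSide => N3 | UpperSide => N4 end.
exists N => /=; pose ib' s := ib s + (N s)%:Z; rewrite -/ib'.
pose l' := l + N1%:Z; pose r' := r - N2%:Z; pose b' := b + N3%:Z; pose t' := t - N4%:Z.
have l'E : l' = ib LeftSide + N1%:Z + 1 by rewrite /l' /l; clear; lia.
have r'E : r' = 1 - (ib RightSide + N2%:Z) by rewrite /r' /r; clear; lia.
have b'E : b' = ib LowerSide + N3%:Z + 1 by rewrite /b' /b; clear; lia.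
have t'E : t' = 1 - (ib UpperSide + N4%:Z) by rewrite /t' /t; clear; lia.
split; first by case.
  rewrite EA AE; congr gcells.
  by rewrite -/l' -/r' -/b' -/t' l'E r'E b'E t'E.
have rect_opt u v x y : inside n (grect u v x y) ->
    rectJ n wv wh g d (grect l r b t) l' r' b' t' <=
    rectJ n wv wh g d (grect l r b t) u v x y.
  by move=> uin; rewrite /rectJ /l' /r' /b' /t' -AE; apply: Amin.
(* The lower and upper sides are the left and right sides of the transposed problem, in which the
   roles of [wv] and [wh] are exchanged. *)
have tE : (fun k j => grect l r b t j k) = grect b t l r.
  by apply/funext => k; apply/funext => j; rewrite /grect andbC.
have rect_opt' u v x y : inside n (grect u v x y) ->
    rectJ n (fun k j => wh j k) (fun k j => wv j k) g (fun k j => d j k)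
      (grect b t l r) b' t' l' r' <=
    rectJ n (fun k j => wh j k) (fun k j => wv j k) g (fun k j => d j k)
      (grect b t l r) u v x y.
  move=> uin; have T := rectJ_transpose n wv wh g d (grect l r b t).
  rewrite -tE -(T l' r' b' t') -(T x y u v); apply: rect_opt.
  by move=> k j h; have [] := uin j k; [move: h; rewrite /grect andbC|].
have Fin' : inside n (grect b t l r).
  by move=> k j h; have [] := Fin j k; [move: h; rewrite /grect andbC|].
have dF' k j : grect b t l r k j ->
  d j k = (Num.min (Num.min (k - b + 1) (t - k)) (Num.min (j - l + 1) (r - j)))%:~R.
  by move=> h; rewrite dF; [rewrite minC|move: h; rewrite /grect andbC].
have wv1' k j : `|(fun k j => wv j k) k j - 1| <= e by exact: wv1.
have corners : [/\ - n%:Z < l, r <= n%:Z, - n%:Z < b & t <= n%:Z].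
  have [] := Fin l b; first by rewrite /grect; move: lr bt; clear; lia.
  have [] := Fin (r - 1) (t - 1); first by rewrite /grect; move: lr bt; clear; lia.
  by clear; move=> *; split; lia.
have [c1 c2 c3 c4] := corners.
have hb : [/\ - n%:Z <= b', b' <= t' & t' <= n%:Z].
  by rewrite /b' /t'; move: k3 k4 krow c3 c4; clear; move=> *; split; lia.
have hl : [/\ - n%:Z <= l', l' <= r' & r' <= n%:Z].
  by rewrite /l' /r'; move: k1 k2 kcol c1 c2; clear; move=> *; split; lia.
have [hb1 hb2 hb3] := hb; have [hl1 hl2 hl3] := hl.
have rng s (k : int) : - (kappa%:Z + 2) <= k - ib s <= kappa%:Z + 2 \/
    - (kappa%:Z + 2) <= k + ib s <= kappa%:Z + 2 -> eps * `|k%:~R| <= D + 1.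
  move=> h; have : `|k| <= `|ib s| + (kappa%:Z + 2) by move: h; clear; lia.
  rewrite -(ler_int R) rmorphD/= !intr_norm rmorphD/= -(ler_pM2l eps0) => h'.
  apply: (le_trans h'); rewrite mulrDr; apply: lerD; [exact: ibD|exact: ltW].
have eps01 : 0 < eps < e1 by rewrite eps0.
have rb' : eps * `|b'%:~R| <= D + 1.
  by apply: (rng LowerSide); left; rewrite b'E; move: k3; clear; lia.
have rt' : eps * `|t'%:~R| <= D + 1.
  by apply: (rng UpperSide); right; rewrite t'E; move: k4; clear; lia.
have rl' : eps * `|l'%:~R| <= D + 1.
  by apply: (rng LeftSide); left; rewrite l'E; move: k1; clear; lia.
have rr' : eps * `|r'%:~R| <= D + 1.
  by apply: (rng RightSide); right; rewrite r'E; move: k2; clear; lia.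
have lv k hk := (hlln _ eps01 k _ _ hb2 hk rb' rt').1.
have lh k hk := (hlln _ eps01 k _ _ hl2 hk rl' rr').2.
have hei' : gheight ib' = t' - b'.
  by rewrite /gheight /ib' /N b'E t'E; clear; lia.
have wid' : gwidth ib' = r' - l'.
  by rewrite /gwidth /ib' /N l'E r'E; clear; lia.
case; rewrite /near_minimal /glength ?hei' ?wid'; split.
- have -> : side_mean LeftSide (ib LeftSide + (N LeftSide)%:Z + 1) = mu (l').
    by rewrite /side_mean; congr mu; rewrite l'E /N; clear; lia.
  have -> : side_mean LeftSide (ib LeftSide + (N LeftSide)%:Z) = mu (l' - 1).
    by rewrite /side_mean; congr mu; rewrite l'E /N; clear; lia.
  have h := left_remove g0 wh1 Fin dF kcol krow kappa_gt0 k1 k2 k3 k4 rect_opt.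
  rewrite -/l' -/r' -/b' -/t' isum_vert// in h.
  apply: (remove_of_lln _ _ e8 (erefl g) h); apply: lv;
    apply: (rng LeftSide); left; rewrite l'E; move: k1; clear; lia.
- move=> N0; have -> : side_mean LeftSide (ib LeftSide + (N LeftSide)%:Z) = mu (l' - 1).
    by rewrite /side_mean; congr mu; rewrite l'E /N; clear; lia.
  have -> : side_mean LeftSide (ib LeftSide + (N LeftSide)%:Z - 1) = mu (l' - 2).
    by rewrite /side_mean; congr mu; rewrite l'E /N; clear; lia.
  have h := left_add g0 wh1 Fin dF kcol krow kappa_gt0 k1 k2 k3 k4 rect_opt N0.
  rewrite -/l' -/r' -/b' -/t' isum_vert// in h.
  apply: (add_of_lln _ _ e8 (erefl g) gk8 h); apply: lv;
    apply: (rng LeftSide); left; rewrite l'E; move: k1; clear; lia.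
- have -> : side_mean RightSide (ib RightSide + (N RightSide)%:Z + 1) = mu (r' - 2).
    by rewrite /side_mean; congr mu; rewrite r'E /N; clear; lia.
  have -> : side_mean RightSide (ib RightSide + (N RightSide)%:Z) = mu (r' - 1).
    by rewrite /side_mean; congr mu; rewrite r'E /N; clear; lia.
  have h := right_remove g0 wh1 Fin dF kcol krow kappa_gt0 k1 k2 k3 k4 rect_opt.
  rewrite -/l' -/r' -/b' -/t' isum_vert// in h.
  apply: (remove_of_lln _ _ e8 (erefl g) h); apply: lv;
    apply: (rng RightSide); right; rewrite r'E; move: k2; clear; lia.
- move=> N0; have -> : side_mean RightSide (ib RightSide + (N RightSide)%:Z) = mu (r' - 1).
    by rewrite /side_mean; congr mu; rewrite r'E /N; clear; lia.
  have -> : side_mean RightSide (ib RightSide + (N RightSide)%:Z - 1) = mu (r').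
    by rewrite /side_mean; congr mu; rewrite r'E /N; clear; lia.
  have h := right_add g0 wh1 Fin dF kcol krow kappa_gt0 k1 k2 k3 k4 rect_opt N0.
  rewrite -/l' -/r' -/b' -/t' isum_vert// in h.
  apply: (add_of_lln _ _ e8 (erefl g) gk8 h); apply: lv;
    apply: (rng RightSide); right; rewrite r'E; move: k2; clear; lia.
- have -> : side_mean LowerSide (ib LowerSide + (N LowerSide)%:Z + 1) = lambda (b').
    by rewrite /side_mean; congr lambda; rewrite b'E /N; clear; lia.
  have -> : side_mean LowerSide (ib LowerSide + (N LowerSide)%:Z) = lambda (b' - 1).
    by rewrite /side_mean; congr lambda; rewrite b'E /N; clear; lia.
  have h := left_remove g0 wv1' Fin' dF' krow kcol kappa_gt0 k3 k4 k1 k2 rect_opt'.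
  rewrite -/l' -/r' -/b' -/t' isum_horiz// in h.
  apply: (remove_of_lln _ _ e8 (erefl g) h); apply: lh;
    apply: (rng LowerSide); left; rewrite b'E; move: k3; clear; lia.
- move=> N0; have -> : side_mean LowerSide (ib LowerSide + (N LowerSide)%:Z) = lambda (b' - 1).
    by rewrite /side_mean; congr lambda; rewrite b'E /N; clear; lia.
  have -> : side_mean LowerSide (ib LowerSide + (N LowerSide)%:Z - 1) = lambda (b' - 2).
    by rewrite /side_mean; congr lambda; rewrite b'E /N; clear; lia.
  have h := left_add g0 wv1' Fin' dF' krow kcol kappa_gt0 k3 k4 k1 k2 rect_opt' N0.
  rewrite -/l' -/r' -/b' -/t' isum_horiz// in h.
  apply: (add_of_lln _ _ e8 (erefl g) gk8 h); apply: lh;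
    apply: (rng LowerSide); left; rewrite b'E; move: k3; clear; lia.
- have -> : side_mean UpperSide (ib UpperSide + (N UpperSide)%:Z + 1) = lambda (t' - 2).
    by rewrite /side_mean; congr lambda; rewrite t'E /N; clear; lia.
  have -> : side_mean UpperSide (ib UpperSide + (N UpperSide)%:Z) = lambda (t' - 1).
    by rewrite /side_mean; congr lambda; rewrite t'E /N; clear; lia.
  have h := right_remove g0 wv1' Fin' dF' krow kcol kappa_gt0 k3 k4 k1 k2 rect_opt'.
  rewrite -/l' -/r' -/b' -/t' isum_horiz// in h.
  apply: (remove_of_lln _ _ e8 (erefl g) h); apply: lh;
    apply: (rng UpperSide); right; rewrite t'E; move: k4; clear; lia.
- move=> N0; have -> : side_mean UpperSide (ib UpperSide + (N UpperSide)%:Z) = lambda (t' - 1).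
    by rewrite /side_mean; congr lambda; rewrite t'E /N; clear; lia.
  have -> : side_mean UpperSide (ib UpperSide + (N UpperSide)%:Z - 1) = lambda (t').
    by rewrite /side_mean; congr lambda; rewrite t'E /N; clear; lia.
  have h := right_add g0 wv1' Fin' dF' krow kcol kappa_gt0 k3 k4 k1 k2 rect_opt' N0.
  rewrite -/l' -/r' -/b' -/t' isum_horiz// in h.
  apply: (add_of_lln _ _ e8 (erefl g) gk8 h); apply: lh;
    apply: (rng UpperSide); right; rewrite t'E; move: k4; clear; lia.
Qed.

End OneStep.

(** * A law of large numbers for mixing fields *)

Section Bounded.
Context {R : realType} {d : measure_display} {T : measurableType d}.
Variable P : probability T R.
Implicit Types (A B : set T) (f g : T -> R).

Definition pr A : R := fine (P A).

Lemma prE A : measurable A -> P A = (pr A)%:E.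
Proof. by move=> mA; rewrite /pr fineK// fin_num_measure. Qed.

Lemma pr_ge0 A : 0 <= pr A.
Proof. by rewrite /pr fine_ge0. Qed.

Lemma pr_le1 A : measurable A -> pr A <= 1.
Proof. by move=> mA; rewrite -lee_fin -prE// probability_le1. Qed.

Lemma pr_bigsetU (I : Type) (s : seq I) (F : I -> set T) : (forall i, measurable (F i)) ->
  pr (\big[setU/set0]_(i <- s) F i) <= \sum_(i <- s) pr (F i).
Proof.
move=> mF; elim: s => [|i s IH]; first by rewrite !big_nil /pr measure0.
rewrite !big_cons; have mU : measurable (\big[setU/set0]_(i <- s) F i).
  by apply: bigsetU_measurable.
apply: (@le_trans _ _ (pr (F i) + pr (\big[setU/set0]_(i <- s) F i))).
  rewrite -lee_fin EFinD -!prE//; last exact: measurableU.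
  exact: measureU2.
by rewrite lerD2l.
Qed.

Definition bmeas f := measurable_fun setT f /\ exists M, forall w, `|f w| <= M.

Lemma bmeas_integrable f : bmeas f -> P.-integrable setT (EFin \o f).
Proof.
move=> [mf [M hM]]; apply: measurable_bounded_integrable => //.
  by apply: le_lt_trans (ltry 1); exact: probability_le1.
exists M; split; first exact: num_real.
by move=> x Mx w _; apply: le_trans (hM w) (ltW Mx).
Qed.

Lemma bmeas_cst x : bmeas (fun=> x).
Proof. by split; [exact: measurable_cst|exists `|x|]. Qed.

Lemma bmeas_indic A : measurable A -> bmeas \1_A.
Proof.
move=> mA; split; first exact: measurable_indic.
by exists 1 => w; rewrite indicE; case: (_ \in _); rewrite ?normr0 ?normr1.
Qed.

Lemma bmeasD f g : bmeas f -> bmeas g -> bmeas (fun w => f w + g w).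
Proof.
move=> [mf [M hM]] [mg [N hN]]; split; first exact: measurable_funD.
by exists (M + N) => w; apply: (le_trans (ler_normD _ _)); apply: lerD.
Qed.

Lemma bmeasM f g : bmeas f -> bmeas g -> bmeas (fun w => f w * g w).
Proof.
move=> [mf [M hM]] [mg [N hN]]; split; first exact: measurable_funM.
by exists (M * N) => w; rewrite normrM; apply: ler_pM.
Qed.

Lemma bmeasZ x f : bmeas f -> bmeas (fun w => x * f w).
Proof. by move=> hf; apply: bmeasM hf; exact: bmeas_cst. Qed.

Lemma bmeas_sum (I : Type) (s : seq I) (F : I -> T -> R) :
  (forall i, bmeas (F i)) -> bmeas (fun w => \sum_(i <- s) F i w).
Proof.
move=> hF; elim: s => [|i s IH].
  by rewrite [X in bmeas X](_ : _ = fun=> 0); [exact: bmeas_cst|apply/funext => w; rewrite big_nil].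
rewrite [X in bmeas X](_ : _ = fun w => F i w + \sum_(i <- s) F i w).
  exact: bmeasD.
by apply/funext => w; rewrite big_cons.
Qed.

Definition expect f : R := \int[P]_w f w.

Lemma expectD f g : bmeas f -> bmeas g ->
  expect (fun w => f w + g w) = expect f + expect g.
Proof. by move=> hf hg; rewrite /expect RintegralD//; exact: bmeas_integrable. Qed.

Lemma expectZ x f : bmeas f -> expect (fun w => x * f w) = x * expect f.
Proof. by move=> hf; rewrite /expect RintegralZl//; exact: bmeas_integrable. Qed.

Lemma expect_cst x : expect (fun=> x) = x.
Proof. by rewrite /expect Rintegral_cst// [X in fine X](@probability_setT _ _ _ P) mulr1. Qed.

Lemma expect_indic A : measurable A -> expect \1_A = pr A.
Proof. by move=> mA; rewrite /expect /Rintegral integral_indic// setIT. Qed.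

Lemma expect_sum (I : Type) (s : seq I) (F : I -> T -> R) : (forall i, bmeas (F i)) ->
  expect (fun w => \sum_(i <- s) F i w) = \sum_(i <- s) expect (F i).
Proof.
move=> hF; elim: s => [|i s IH].
  rewrite big_nil -[RHS]expect_cst; congr expect.
  by apply/funext => w; rewrite big_nil.
rewrite big_cons -IH -expectD//; last exact: bmeas_sum.
by congr expect; apply/funext => w; rewrite big_cons.
Qed.

Lemma le_expect f g : bmeas f -> bmeas g -> (forall w, f w <= g w) ->
  expect f <= expect g.
Proof.
by move=> hf hg fg; apply: le_Rintegral => //; exact: bmeas_integrable.
Qed.

Lemma ae_eq_expect f g : measurable_fun setT f -> measurable_fun setT g ->
  {ae P, forall w, f w = g w} -> expect f = expect g.
Proof.
move=> mf mg fg; rewrite /expect /Rintegral; congr fine.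
apply: ae_eq_integral => //; [exact/measurable_EFinP|exact/measurable_EFinP|].
by apply: filterS fg => w h _; rewrite /= h.
Qed.

(** The variance of the sum is the sum of all covariances. A diagonal term is at most 1, and the
    other terms of a line add up to at most 2 V. *)
Lemma chebyshev_sum (l : nat) (A : nat -> set T) (al : nat -> R) (V x : R) :
  (forall i, measurable (A i)) ->
  (forall n, (0 < n)%N -> 0 <= al n) ->
  (forall N, \sum_(1 <= n < N) al n <= V) ->
  (forall i j, i != j ->
    `|pr (A i `&` A j) - pr (A i) * pr (A j)| <= al (maxn i j - minn i j)%N) ->
  0 < x ->
  pr [set w | x < `|\sum_(i < l) (\1_(A i) w - pr (A i))|] <= l%:R * (1 + 2 * V) / x ^+ 2.
Proof.
move=> mA al0 alV cov x0; set B := [set w | _].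
pose S w : R := \sum_(i < l) (\1_(A i) w - pr (A i)).
have bI i : bmeas (fun w => \1_(A i) w - pr (A i)).
  by apply: bmeasD; [exact: bmeas_indic|exact: bmeas_cst].
have bS : bmeas S by apply: bmeas_sum.
have mB : measurable B.
  rewrite (_ : B = (fun w => `|S w|) @^-1` `]x, +oo[%classic).
    rewrite -[X in measurable X]setTI; apply: measurableT_comp => //; exact: bS.1.
  by apply/seteqP; split=> w; rewrite /B/= in_itv/= andbT.
have bSS : bmeas (fun w => S w * S w) by exact: bmeasM.
rewrite ler_pdivlMr ?exprn_gt0// mulrC -expect_indic// -expectZ; last exact: bmeas_indic.
apply: (@le_trans _ _ (expect (fun w => S w * S w))).
  apply: le_expect => //; first by apply: bmeasZ; exact: bmeas_indic.
  move=> w; rewrite indicE; case: (boolP (w \in B)) => [|_].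
    rewrite inE /B/= mulr1 -/(S w) => xS.
    rewrite -expr2 -[S w ^+ 2]ger0_norm ?sqr_ge0// normrX.
    by rewrite ler_sqr ?nnegrE// ltW.
  by rewrite mulr0 -expr2 sqr_ge0.
have -> : expect (fun w => S w * S w) =
    \sum_(i < l) \sum_(j < l) (pr (A i `&` A j) - pr (A i) * pr (A j)).
  transitivity (expect (fun w => \sum_(i < l) \sum_(j < l)
      ((\1_(A i) w - pr (A i)) * (\1_(A j) w - pr (A j))))).
    congr expect; apply/funext => w; rewrite /S mulr_suml.
    by apply: eq_bigr => i _; rewrite mulr_sumr.
  rewrite expect_sum; last by move=> i; apply: bmeas_sum => j; exact: bmeasM.
  apply: eq_bigr => i _; rewrite expect_sum; last by move=> j; exact: bmeasM.
  apply: eq_bigr => j _.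
  have mAA : measurable (A i `&` A j) by exact: measurableI.
  transitivity (expect (fun w => \1_(A i `&` A j) w + ((- pr (A j)) * \1_(A i) w +
      ((- pr (A i)) * \1_(A j) w + pr (A i) * pr (A j))))).
    congr expect; apply/funext => w; rewrite indicI /=; ring.
  rewrite expectD ?expectD ?expectZ ?expect_indic ?expect_cst//; first by ring.
  all: do ?[exact: bmeas_indic|exact: bmeas_cst|apply: bmeasZ|apply: bmeasD].
rewrite mulrC mulr_natr -[X in _ *+ X](card_ord l) -sumr_const.
apply: ler_sum => i _.
rewrite (bigD1 i)//= addrC [leRHS]addrC; apply: lerD; last first.
  rewrite setIid; have := pr_le1 (mA i); have := pr_ge0 (A i).
  have := sqr_ge0 (pr (A i)); rewrite expr2; lra.
apply: (@le_trans _ _ (\sum_(j < l | j != i) al (maxn i j - minn i j)%N)).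
  apply: ler_sum => j ji; apply: le_trans (ler_norm _) _.
  by apply: cov; rewrite eq_sym.
(* The distance to [i] is injective on the indices below [i] and on those above [i] separately, so
   each half is bounded by a partial sum of [al]. *)
rewrite (bigID (fun j : 'I_l => (j < i)%N))/= mulrDl mul1r.
have tail (N : nat) (p : pred 'I_l) (h : 'I_l -> nat) : 
    {in p &, injective h} -> (forall j, p j -> (0 < h j < N)%N) ->
    \sum_(j < l | p j) al (h j) <= V.
  move=> hinj hN; apply: le_trans (alV N).
  pose s := [seq h j | j <- enum p].
  have -> : \sum_(j < l | p j) al (h j) = \sum_(n <- s) al n.
    by rewrite big_map big_enum.
  have su : uniq s.
    rewrite map_inj_in_uniq ?enum_uniq// => a b.
    by rewrite !mem_enum; exact: hinj.
  have sub : {subset s <= iota 1 (N - 1)}.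
    move=> n /mapP[j]; rewrite mem_enum => pj ->.
    by rewrite mem_iota; have := hN j pj; lia.
  rewrite -(perm_big _ (permEl (perm_filterC (mem s) (index_iota 1 N)))) /index_iota/=.
  rewrite big_cat/= -[leLHS]addr0; apply: lerD.
    rewrite le_eqVlt; apply/orP; left; apply/eqP; apply: perm_big.
    apply: uniq_perm => //; first by rewrite filter_uniq// iota_uniq.
    move=> n; rewrite mem_filter; apply/idP/andP => [ns|[]//]; split => //; exact: sub.
  rewrite big_seq_cond; apply: sumr_ge0 => n; rewrite andbT mem_filter mem_iota => /andP[_ h2].
  by apply: al0; lia.
apply: lerD.
  apply: (tail (i : nat).+1) => [j j'|j /andP[ji jlt]].
    rewrite !unfold_in => /andP[_ h1] /andP[_ h2] h; apply: val_inj => /=; lia.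
  lia.
apply: (tail l) => [j j'|j /andP[ji jlt]].
  rewrite !unfold_in => /andP[_ h1] /andP[_ h2] h; apply: val_inj => /=; lia.
have := ltn_ord j; move: ji jlt; rewrite -val_eqE/=; lia.
Qed.

End Bounded.

(** * Sums of a bounded sequence all of whose bad blocks are neighbours *)

Section Atoms.
Context {R : realType}.
Variables (l Q : nat) (X : nat -> R) (eta : R).
Hypothesis X1 : forall i, `|X i| <= 1.
Hypothesis eta0 : 0 <= eta.

Let atom q := \sum_(i < l) X (q * l + i)%N.
Hypothesis few_bad : forall q q', (q + 2 <= q')%N -> (q' < Q)%N ->
  `|atom q| <= eta * l%:R \/ `|atom q'| <= eta * l%:R.

Let atom_le q : `|atom q| <= l%:R.
Proof.
rewrite -[l in leRHS]card_ord -sum1_card natr_sum.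
by apply: (le_trans (ler_norm_sum _ _ _)); apply: ler_sum.
Qed.

Let sum_atoms : \sum_(q < Q) `|atom q| <= (Q%:R * eta + 2) * l%:R.
Proof.
pose bad q := ~~ (`|atom q| <= eta * l%:R).
have h : \sum_(q < Q) `|atom q| <= \sum_(q < Q) (eta * l%:R + (bad q)%:R * l%:R).
  apply: ler_sum => q _; rewrite /bad; case: (leP `|atom q| (eta * l%:R)) => h /=.
    by rewrite mul0r addr0.
  by rewrite mul1r; apply: ler_wpDl; rewrite ?mulr_ge0.
apply: (le_trans h); rewrite big_split/= sumr_const card_ord -mulr_suml.
rewrite mulrDl -[(eta * _) *+ _]mulr_natl mulrA lerD2l ler_wpM2r//.
have [q0|none] := pselect (exists q, (q < Q)%N && bad q); last first.
  by rewrite big1// => q _; case: (boolP (bad q)) => // bq; case: none; exists q; rewrite ltn_ord.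
pose q1 := ex_minn q0.
have [q1Q q1min] : (q1 < Q)%N /\ forall q, (q < Q)%N -> bad q -> (q1 <= q)%N.
  rewrite /q1; case: ex_minnP => q /andP[qQ bq] hq; split=> // q' q'Q bq'.
  by apply: hq; rewrite q'Q.
have b1 : bad q1 by rewrite /q1; case: ex_minnP => q /andP[].
(* A block at distance at least 2 behind the first bad block [q1] is good, so only [q1] and its
   successor can be bad. *)
apply: (@le_trans _ _ (\sum_(q < Q) ((q == q1 :> nat)%:R + (q == q1.+1 :> nat)%:R))).
  apply: ler_sum => q _; rewrite -natrD ler_nat.
  case: (boolP (bad q)) => // bq.
  have := q1min q (ltn_ord q) bq.
  have : ~ (q1 + 2 <= q)%N.
    move=> qq; case: (few_bad qq (ltn_ord q)) => [h1|h1].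
      by move: b1; rewrite /bad h1.
    by move: bq; rewrite /bad h1.
  by move=> /negP; rewrite -ltnNge => *; case: eqP; case: eqP => //=; lia.
have one (c : nat) : \sum_(q < Q) (q == c :> nat)%:R <= 1 :> R.
  have [cQ|cQ] := ltnP c Q.
    rewrite (bigD1 (Ordinal cQ))//= eqxx big1 ?addr0// => q qc.
    by rewrite -val_eqE/= in qc; rewrite (negPf qc).
  rewrite big1 ?ler01// => q _; case: eqP => // qc.
  by move: (ltn_ord q); rewrite qc ltnNge cQ.
rewrite big_split/= [2]/(1 + 1); exact: lerD.
Qed.

(** The 4 counts two bad blocks and two incomplete blocks at the ends of the segment, each bounded
    trivially by [l]. *)
Lemma atoms_bound u v : (u <= v)%N -> (v <= Q * l)%N ->
  `|\sum_(u <= i < v) X i| <= (Q%:R * eta + 4) * l%:R.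
Proof.
move=> uv vQ.
have [l0|l0] := posnP l.
  have -> : u = v by move: vQ; rewrite l0 muln0; lia.
  by rewrite big_geq// normr0 l0 mulr0.
have block q : \sum_(0 <= i < q * l) X i = \sum_(s < q) atom s.
  elim: q => [|q IH]; first by rewrite mul0n big_geq// big_ord0.
  rewrite big_ord_recr /= -IH (@big_cat_nat _ _ _ (q * l))//=; last by rewrite mulSn leq_addl.
  congr (_ + _); rewrite -{1}[(q * l)%N]add0n big_addn.
  have -> : (q.+1 * l - q * l = l)%N by rewrite mulSn addnK.
  rewrite big_mkord.
  by apply: eq_bigr => i _; rewrite addnC.
pose rest w := \sum_((w %/ l) * l <= i < w) X i.
have restle w : `|rest w| <= l%:R.
  apply: (le_trans (ler_norm_sum _ _ _)).
  apply: (@le_trans _ _ (\sum_((w %/ l) * l <= i < w) 1)); first exact: ler_sum.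
  rewrite big_const_nat iter_addr addr0 -[1 *+ _]/(_%:R) ler_nat.
  by have := ltn_pmod w l0; rewrite {2}(divn_eq w l); lia.
have pre w : \sum_(0 <= i < w) X i = \sum_(s < w %/ l) atom s + rest w.
  by rewrite -block /rest -big_cat_nat//= leq_trunc_div.
have -> : \sum_(u <= i < v) X i =
    (\sum_(s < v %/ l) atom s - \sum_(s < u %/ l) atom s) + (rest v - rest u).
  rewrite addrACA -opprD -!pre (@big_cat_nat _ _ _ u 0 v)//=.
  by rewrite addrAC subrr add0r.
have duv : (u %/ l <= v %/ l)%N by exact: leq_div2r.
have dvQ : (v %/ l <= Q)%N by rewrite -(mulnK Q l0); exact: leq_div2r.
have -> : \sum_(s < v %/ l) atom s - \sum_(s < u %/ l) atom s =
    \sum_(u %/ l <= s < v %/ l) atom s.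
  rewrite -!(big_mkord xpredT atom) (@big_cat_nat _ _ _ (u %/ l) 0 (v %/ l))//=.
  by rewrite addrAC subrr add0r.
apply: (le_trans (ler_normD _ _)).
have -> : (Q%:R * eta + 4) * l%:R = (Q%:R * eta + 2) * l%:R + (l%:R + l%:R) by ring.
apply: lerD; last first.
  by apply: (le_trans (ler_normB _ _)); exact: lerD.
apply: (le_trans (ler_norm_sum _ _ _)); apply: le_trans sum_atoms.
rewrite -(big_mkord xpredT (fun q => `|atom q|)).
rewrite (@big_cat_nat _ _ _ (u %/ l) 0 Q)//=; last exact: leq_trans dvQ.
rewrite (@big_cat_nat _ _ _ (v %/ l) (u %/ l) Q)//=.
have s0 (a b : nat) : 0 <= \sum_(a <= q < b) `|atom q| by exact: sumr_ge0.
have := s0 0%N (u %/ l)%N; have := s0 (v %/ l)%N Q; lra.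
Qed.

End Atoms.

(** * Probability of bad scales and Borel-Cantelli along dyadic block lengths *)

Section BadScales.
Context {R : realType} {d : measure_display} {T : measurableType d}.
Variables (P : probability T R) (A : int -> int -> set T) (al : nat -> R) (V : R).
Hypothesis mA : forall k j, measurable (A k j).
Hypothesis al0 : forall n, (0 < n)%N -> 0 <= al n.
Hypothesis alV : forall N, \sum_(1 <= n < N) al n <= V.
Hypothesis mixA : forall k (n : nat) (I1 I2 : set int), (0 < n)%N ->
  (forall i j, I1 i -> I2 j -> n%:Z <= `|i - j|) ->
  forall E1 E2, <<s [set A k i | i in I1] >> E1 -> <<s [set A k i | i in I2] >> E2 ->
    `|pr P (E1 `&` E2) - pr P E1 * pr P E2| <= al n.

Definition centered k (j : int) (w : T) : R := \1_(A k j) w - pr P (A k j).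

Definition bad_atom (l : nat) (eta : R) (k s : int) : set T :=
  [set w | eta * l%:R < `|\sum_(i < l) centered k (s * l%:Z + i%:Z) w|].

(** A bad block is an event of the sigma-algebra of its own points, so that mixing applies to pairs
    of blocks and not only to pairs of points. *)
Lemma bad_atom_sigma l eta k s :
  <<s [set A k i | i in [set i | s * l%:Z <= i < s * l%:Z + l%:Z]] >> (bad_atom l eta k s).
Proof.
set G := [set _ | _ in _].
pose S (w : g_sigma_algebraType G) : R := \sum_(i < l) centered k (s * l%:Z + i%:Z) w.
have mS : measurable_fun setT S.
  have mi (i : 'I_l) : measurable_fun setT
      ((fun w => centered k (s * l%:Z + i%:Z) w) : g_sigma_algebraType G -> R).
    apply: measurable_funB; last exact: measurable_cst.
    apply: measurable_indic; apply: sub_gen_smallest; exists (s * l%:Z + i%:Z) => //=.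
    by have := ltn_ord i; lia.
  exact: (measurable_sum _ mi).
have mNS : measurable_fun setT (fun w => `|S w|) by exact: measurableT_comp.
have := mNS measurableT `]eta * l%:R, +oo[%classic (measurable_itv _).
rewrite setTI; congr (<<s _ >> _); apply/seteqP; split=> w;
  by rewrite /bad_atom/= in_itv/= andbT.
Qed.

Arguments bad_atom_sigma : clear implicits.

Lemma sigma_measurable k I1 E : <<s [set A k i | i in I1] >> E -> measurable E.
Proof.
apply: smallest_sub; first exact: sigma_algebra_measurable.
by move=> _ [i _ <-].
Qed.

Lemma measurable_bad_atom l eta k s : measurable (bad_atom l eta k s).
Proof. by have /sigma_measurable := bad_atom_sigma l eta k s. Qed.

Lemma pr_bad_atom l eta k s : (0 < l)%N -> 0 < eta ->
  pr P (bad_atom l eta k s) <= (1 + 2 * V) / eta ^+ 2 / l%:R.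
Proof.
move=> l0 eta0.
have l0R : 0 < l%:R :> R by rewrite ltr0n.
have := @chebyshev_sum R d T P l (fun i => A k (s * l%:Z + i%:Z)) al V (eta * l%:R)
  (fun i => mA _ _) al0 alV.
have -> : l%:R * (1 + 2 * V) / (eta * l%:R) ^+ 2 = (1 + 2 * V) / eta ^+ 2 / l%:R :> R.
  by field; rewrite !gt_eqF.
apply; last by rewrite mulr_gt0.
move=> i j ij.
apply: (@mixA k _ [set s * l%:Z + i%:Z] [set s * l%:Z + j%:Z]).
- by move: ij; lia.
- by move=> _ _ -> ->; lia.
- by apply: sub_gen_smallest; exists (s * l%:Z + i%:Z).
- by apply: sub_gen_smallest; exists (s * l%:Z + j%:Z).
Qed.

(** A whole block lies between the two, so mixing applies with every [n] up to [l]; leaving [n] free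
    prepares the averaging in [pr_bad_dyadic]. *)
Lemma pr_bad_pair l eta k s s' n : (0 < l)%N -> 0 < eta -> s + 2 <= s' ->
  (0 < n <= l)%N ->
  pr P (bad_atom l eta k s `&` bad_atom l eta k s') <=
  ((1 + 2 * V) / eta ^+ 2 / l%:R) ^+ 2 + al n.
Proof.
move=> l0 eta0 ss /andP[n0 nl].
have := mixA n0 _ (bad_atom_sigma l eta k s) (bad_atom_sigma l eta k s').
have hd i j : s * l%:Z <= i < s * l%:Z + l%:Z -> s' * l%:Z <= j < s' * l%:Z + l%:Z ->
    n%:Z <= `|i - j|.
  move=> hi hj; have : (s + 2) * l%:Z <= s' * l%:Z by rewrite ler_wpM2r.
  rewrite mulrDl; lia.
move=> /(_ hd); rewrite ler_norml => /andP[_ h].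
have := pr_bad_atom k s l0 eta0; have := pr_bad_atom k s' l0 eta0.
set q := _ / l%:R => h1 h2.
have : pr P (bad_atom l eta k s) * pr P (bad_atom l eta k s') <= q ^+ 2.
  by rewrite expr2; apply: ler_pM => //; exact: pr_ge0.
lra.
Qed.

(* Some line meeting the square of side 2 M l has two non-adjacent bad blocks of
   length l. *)
Definition bad_scale (M l : nat) (eta : R) : set T :=
  \big[setU/set0]_(k <- window (M * l).+1)
    \big[setU/set0]_(s <- window M) \big[setU/set0]_(s' <- window M)
      (if s + 2 <= s' then bad_atom l eta k s `&` bad_atom l eta k s' else set0).

Let m_pair l eta k s s' :
  measurable (if s + 2 <= s' then bad_atom l eta k s `&` bad_atom l eta k s' else set0).
Proof. by case: ifP => // _; apply: measurableI; exact: measurable_bad_atom. Qed.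

Lemma measurable_bad_scale M l eta : measurable (bad_scale M l eta).
Proof. by do 3 (apply: bigsetU_measurable => ? _). Qed.

Lemma size_window n : size (window n) = n.*2.
Proof. by rewrite size_map size_iota. Qed.

Lemma pr_bad_scale M l eta n : (0 < l)%N -> (0 < M)%N -> 0 < eta -> (0 < n <= l)%N ->
  pr P (bad_scale M l eta) <=
  16 * M%:R ^+ 3 * l%:R * (((1 + 2 * V) / eta ^+ 2 / l%:R) ^+ 2 + al n).
Proof.
move=> l0 M0 eta0 nl; set q := _ + al n.
have q0 : 0 <= q by rewrite addr_ge0 ?sqr_ge0// al0; case/andP: nl.
have sumc (s : seq int) (y : R) : \sum_(i <- s) y = (size s)%:R * y.
  by rewrite big_const_seq count_predT iter_addr addr0 mulr_natl.
apply: (@le_trans _ _ ((size (window (M * l).+1))%:R * ((size (window M))%:R *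
    ((size (window M))%:R * q)))); last first.
  rewrite !size_window -!muln2 !natrM -(addn1 (M * l)) natrD natrM.
  have Ml : 1 <= M%:R * l%:R :> R by rewrite -natrM ler1n muln_gt0 M0.
  have : 0 <= M%:R ^+ 2 * q by rewrite mulr_ge0// sqr_ge0.
  have -> : (M%:R * l%:R + 1) * 2 * (M%:R * 2 * (M%:R * 2 * q)) =
    8 * (M%:R ^+ 2 * q) * (M%:R * l%:R + 1) by ring.
  have -> : 16 * M%:R ^+ 3 * l%:R * q = 8 * (M%:R ^+ 2 * q) * (M%:R * l%:R * 2) by ring.
  move=> h; apply: ler_wpM2l; [by rewrite mulr_ge0|lra].
apply: le_trans (pr_bigsetU _ _ _) _.
  by move=> k; do 2 (apply: bigsetU_measurable => ? _).
rewrite -[leRHS]sumc; apply: ler_sum => k _; apply: le_trans (pr_bigsetU _ _ _) _.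
  by move=> s; apply: bigsetU_measurable => ? _.
rewrite -[leRHS]sumc; apply: ler_sum => s _; apply: le_trans (pr_bigsetU _ _ _) _.
  by move=> s'; exact: m_pair.
rewrite -[leRHS]sumc; apply: ler_sum => s' _; case: ifP => ss; first exact: pr_bad_pair.
by rewrite /pr measure0.
Qed.

(** The rate is not assumed monotone, so [al (2 ^ p.+1)] alone is not controlled by its neighbours.
    Instead the bounds for all [n] from 2^p + 1 to 2^(p+1) are averaged; the average of [al] carries
    a factor 2^-p, which compensates the number of lines. *)
Lemma pr_bad_dyadic M eta p : (0 < M)%N -> 0 < eta ->
  pr P (bad_scale M (2 ^ p.+1) eta) <=
  16 * M%:R ^+ 3 * ((1 + 2 * V) / eta ^+ 2) ^+ 2 * (2^-1) ^+ p.+1 +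
  32 * M%:R ^+ 3 * \sum_((2 ^ p).+1 <= n < (2 ^ p.+1).+1) al n.
Proof.
move=> M0 eta0; set K := (_ / eta ^+ 2) ^+ 2.
have l0 : (0 < 2 ^ p.+1)%N by rewrite expn_gt0.
pose c1 := 16 * M%:R ^+ 3 * (K * (2^-1) ^+ p.+1).
pose c2 : R := 16 * M%:R ^+ 3 * 2 ^+ p.+1.
have h n : ((2 ^ p).+1 <= n < (2 ^ p.+1).+1)%N ->
    pr P (bad_scale M (2 ^ p.+1) eta) <=
    c1 + c2 * al n.
  move=> /andP[n1 n2]; apply: le_trans (pr_bad_scale (n := n) l0 M0 eta0 _) _.
    by apply/andP; split; [exact: leq_ltn_trans n1|exact: n2].
  rewrite le_eqVlt; apply/orP; left; apply/eqP.
  rewrite /c1 /c2 natrX /K exprVn; field.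
  by rewrite !gt_eqF ?exprn_gt0.
set b := pr _ _ in h *.
have : \sum_((2 ^ p).+1 <= n < (2 ^ p.+1).+1) b <=
   \sum_((2 ^ p).+1 <= n < (2 ^ p.+1).+1)
     (c1 + c2 * al n).
  by rewrite big_nat [leRHS]big_nat; apply: ler_sum.
set sn := \sum_(_ <= n < _) al n.
have -> : \sum_((2 ^ p).+1 <= n < (2 ^ p.+1).+1) (c1 + c2 * al n) =
    \sum_((2 ^ p).+1 <= n < (2 ^ p.+1).+1) c1 + c2 * sn.
  by rewrite /sn mulr_sumr big_split.
rewrite !big_const_nat !iter_addr !addr0.
have -> : ((2 ^ p.+1).+1 - (2 ^ p).+1 = 2 ^ p)%N by rewrite expnS; lia.
rewrite -(mulr_natr b) -(mulr_natr c1) natrX => h2.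
have p0 : 0 < 2 ^+ p :> R by rewrite exprn_gt0.
rewrite -(ler_pM2r p0); apply: (le_trans h2).
rewrite /c1 /c2 [2 ^+ p.+1]exprS le_eqVlt; apply/orP; left; apply/eqP; ring.
Qed.

Lemma ae_good_scales M eta : (0 < M)%N -> 0 < eta ->
  {ae P, forall w, exists p0, forall p, (p0 <= p)%N -> ~ bad_scale M (2 ^ p) eta w}.
Proof.
move=> M0 eta0.
pose F p := bad_scale M (2 ^ p.+1) eta.
have mF p : measurable (F p) by exact: measurable_bad_scale.
have sumF : (\sum_(0 <= p <oo) P (F p) < +oo)%E.
  pose K1 := 16 * M%:R ^+ 3 * ((1 + 2 * V) / eta ^+ 2) ^+ 2.
  have K10 : 0 <= K1.
    by apply: mulr_ge0; [apply: mulr_ge0 => //; exact: exprn_ge0|exact: sqr_ge0].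
  pose K2 : R := 32 * M%:R ^+ 3.
  have K20 : 0 <= K2 by apply: mulr_ge0 => //; exact: exprn_ge0.
  apply: (@le_lt_trans _ _ (K1 + K2 * V)%:E); last by rewrite ltry.
  apply: lime_le; first by apply: is_cvg_ereal_nneg_natsum => n _; exact: measure_ge0.
  near=> N; rewrite big_mkord.
  apply: (@le_trans _ _ (\sum_(p < N) (K1 * (2^-1) ^+ p.+1 +
     K2 * \sum_((2 ^ p).+1 <= n < (2 ^ p.+1).+1) al n)%:E)).
    by apply: lee_sum => p _; rewrite (prE P (mF p)) lee_fin; exact: pr_bad_dyadic.
  rewrite sumEFin lee_fin big_split/= -!mulr_sumr; apply: lerD.
    rewrite -[leRHS]mulr1 ler_wpM2l//.
    have -> : \sum_(i < N) 2^-1 ^+ i.+1 = 1 - 2^-1 ^+ N :> R.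
      elim: (N) => [|N' IH]; first by rewrite big_ord0 expr0 subrr.
      by rewrite big_ord_recr/= IH exprS; field.
    by rewrite gerBl exprn_ge0.
  apply: ler_wpM2l => //.
  (* The dyadic ranges are consecutive, so their sums combine into one partial sum of [al]. *)
  have -> : \sum_(i < N) \sum_((2 ^ i).+1 <= n < (2 ^ i.+1).+1) al n =
      \sum_(2 <= n < (2 ^ N).+1) al n.
    elim: (N) => [|N' IH]; first by rewrite big_ord0 big_geq.
    rewrite big_ord_recr/= IH -big_cat_nat//=; first by rewrite !ltnS expn_gt0.
    by rewrite ltnS leq_exp2l.
  apply: le_trans (alV (2 ^ N).+1).
  by rewrite [leRHS]big_ltn ?ltnS ?expn_gt0// lerDr al0.
have L0 := lim_sup_set_cvg0 mF sumF.
exists (lim_sup_set F); split=> //.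
  by apply: bigcapT_measurable => n; apply: bigcup_measurable => k _.
move=> w /= h n _; apply: contrapT => h2; apply: h; exists n.+1 => p np hb.
apply: h2; exists p.-1 => /=; first by case: p np hb.
by rewrite /F prednK//; exact: leq_ltn_trans np.
Unshelve. all: by end_near. Qed.

Lemma good_scale_bound M l eta w k u v : 0 <= eta -> ~ bad_scale M l eta w ->
  `|k| <= (M * l)%N%:Z -> - (M * l)%N%:Z <= u -> u <= v -> v <= (M * l)%N%:Z ->
  `|\sum_(i < absz (v - u)%R) centered k (u + i%:Z) w| <= (2 * M%:R * eta + 4) * l%:R.
Proof.
move=> eta0 good kM uM uv vM.
(* Shifting by [M * l] numbers the blocks from 0 to 2 M - 1 instead of from -M to M - 1. *)
pose X i := centered k (- (M * l)%N%:Z + i%:Z) w.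
have X1 i : `|X i| <= 1.
  rewrite /X /centered indicE; have := pr_ge0 P (A k (- (M * l)%N%:Z + i%:Z)).
  have := pr_le1 P (mA k (- (M * l)%N%:Z + i%:Z)).
  by case: (_ \in _) => *; rewrite ler_norml; apply/andP; split => /=; lra.
have fb q q' : (q + 2 <= q')%N -> (q' < M.*2)%N ->
    `|\sum_(i < l) X (q * l + i)%N| <= eta * l%:R \/
    `|\sum_(i < l) X (q' * l + i)%N| <= eta * l%:R.
  move=> qq q'M; apply: contrapT => /not_orP[/negP + /negP]; rewrite -!ltNge => b1 b2.
  apply: good; rewrite /bad_scale.
  have e (q1 : nat) : \sum_(i < l) X (q1 * l + i)%N =
      \sum_(i < l) centered k ((- M%:Z + q1%:Z) * l%:Z + i%:Z) w.
    by apply: eq_bigr => i _; rewrite /X; congr (centered k _ w); rewrite PoszD !PoszM; ring.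
  rewrite -bigcup_seq; exists k; first by rewrite /= mem_window; lia.
  rewrite -bigcup_seq; exists (- M%:Z + q%:Z); first by rewrite /= mem_window; lia.
  rewrite -bigcup_seq; exists (- M%:Z + q'%:Z); first by rewrite /= mem_window; lia.
  by rewrite ifT; [split; rewrite /bad_atom/= -e|lia].
have := @atoms_bound R l M.*2 X eta X1 eta0 fb (absz (u + (M * l)%N%:Z)%R) (absz (v + (M * l)%N%:Z)%R).
rewrite -muln2 natrM mulrAC [M%:R * _ * _]mulrC mulrA.
have -> : \sum_(absz (u + (M * l)%N%:Z)%R <= i < absz (v + (M * l)%N%:Z)%R) X i =
    \sum_(i < absz (v - u)%R) centered k (u + i%:Z) w.
  rewrite -{1}[absz (u + _)%R]add0n big_addn big_mkord.
  have -> : (absz (v + (M * l)%N%:Z)%R - absz (u + (M * l)%N%:Z)%R)%N = absz (v - u)%R by lia.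
  by apply: eq_bigr => i _; rewrite /X; congr (centered k _ w); lia.
by apply; lia.
Qed.

End BadScales.

(** Any [m] consecutive terms add up to [m * mu]; the fewer than [m] terms left over give the
    error. *)
Lemma period_sum (R : realType) (m : nat) (f : int -> R) (C : R) (mu : R) : (0 < m)%N ->
  (forall k, f (k + m%:Z) = f k) -> (forall k, `|f k| <= C) ->
  mu = m%:R^-1 * \sum_(j < m) f j%:Z ->
  forall (n : nat) (u : int), `|\sum_(i < n) f (u + i%:Z) - n%:R * mu| <= 2 * m%:R * C.
Proof.
move=> m0 fper fC muE; have C0 : 0 <= C by apply: le_trans (fC 0).
have mR : 0 < m%:R :> R by rewrite ltr0n.
have mmu : m%:R * mu = \sum_(j < m) f j%:Z by rewrite muE mulVKf// gt_eqF.
have muC : `|mu| <= C.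
  rewrite -(ler_pM2l mR) -{1}[m%:R]gtr0_norm// -normrM mmu.
  apply: (le_trans (ler_norm_sum _ _ _)); rewrite mulr_natl -[in leRHS](card_ord m) -sumr_const.
  exact: ler_sum.
have shift (u : int) : \sum_(i < m) f (u + 1 + i%:Z) = \sum_(i < m) f (u + i%:Z).
  case: m m0 fper {muE mR mmu} => // m _ fper.
  rewrite big_ord_recr [RHS]big_ord_recl /= addr0 addrC; congr (_ + _).
    by rewrite -(fper u); congr f; lia.
  by apply: eq_bigr => i _; congr f; rewrite /= /bump /=; lia.
have per (u : int) : \sum_(i < m) f (u + i%:Z) = m%:R * mu.
  rewrite mmu; have pos (q : nat) v : \sum_(i < m) f (v + q%:Z + i%:Z) = \sum_(i < m) f (v + i%:Z).
    elim: q v => [|q IH] v; first by rewrite addr0.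
    have -> : v + q.+1%:Z = v + q%:Z + 1 by lia.
    by rewrite shift IH.
  case: u => q.
    by rewrite -[Posz q]add0r pos; apply: eq_bigr => i _; rewrite add0r.
  rewrite -(pos q.+1); apply: eq_bigr => i _; congr f; lia.
elim/ltn_ind => n IH u; have [nm|mn] := ltnP n m.
  rewrite [n%:R * mu]mulr_natl -[in _ *+ n](card_ord n) -sumr_const -sumrB.
  apply: (le_trans (ler_norm_sum _ _ _)).
  apply: (@le_trans _ _ (\sum_(i < n) (2 * C))).
    apply: ler_sum => i _; apply: (le_trans (ler_normB _ _)).
    by rewrite mulrDl mul1r lerD.
  rewrite sumr_const card_ord -[(2 * C) *+ n]mulr_natl; have -> : 2 * m%:R * C = m%:R * (2 * C) by ring.
  by apply: ler_wpM2r; [rewrite mulr_ge0|rewrite ler_nat ltnW].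
have -> : n = (m + (n - m))%N by rewrite subnKC.
rewrite big_split_ord /= per natrD mulrDl opprD addrACA subrr add0r.
have -> : \sum_(i < n - m) f (u + (m + i)%N%:Z) = \sum_(i < n - m) f (u + m%:Z + i%:Z).
  by apply: eq_bigr => i _; congr f; rewrite PoszD addrA.
by apply: IH; lia.
Qed.

(** Mixing controls events only, so the field is replaced by a step function of its level sets.
    Writing x = -C + h y with h = 2 C / Q, the sum counts the integers from 1 to y and equals the
    integer part of y. *)
Lemma layer_cake (R : realType) (C x : R) (Q : nat) : 0 < C -> (0 < Q)%N -> - C <= x <= C ->
  `|x - (- C + 2 * C / Q%:R * \sum_(q < Q) ((- C + 2 * C / Q%:R * q.+1%:R <= x)%R)%:R)|
    <= 2 * C / Q%:R.
Proof.
move=> C0 Q0 /andP[x1 x2]; have QR : 0 < Q%:R :> R by rewrite ltr0n.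
set h := 2 * C / Q%:R; have h0 : 0 < h by rewrite divr_gt0// mulr_gt0.
pose y := (x + C) / h; have xE : x = - C + h * y by rewrite /y mulrC divfK ?gt_eqF// addrC addrK.
have y0 : 0 <= y by rewrite divr_ge0 ?(ltW h0)//; lra.
have yQ : y <= Q%:R.
  by rewrite ler_pdivrMr// /h mulrC divfK ?gt_eqF//; lra.
have -> : \sum_(q < Q) ((- C + h * q.+1%:R <= x)%R)%:R = (Num.truncn y)%:R :> R.
  have tQ : (Num.truncn y <= Q)%N by rewrite -(ler_nat R) (le_trans _ yQ)// truncn_le.
  transitivity (\sum_(q < Q) ((q < Num.truncn y)%N)%:R : R).
    apply: eq_bigr => q _; congr (_%:R); congr nat_of_bool.
    by rewrite xE lerD2l ler_pM2l// -truncn_ge_nat.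
  rewrite -natr_sum; congr (_%:R).
  rewrite -(big_mkord xpredT (fun q => nat_of_bool (q < Num.truncn y)%N)).
  rewrite (@big_cat_nat _ _ _ (Num.truncn y))//= [X in (_ + X)%N]big1_seq ?addn0.
    rewrite big_nat (eq_bigr (fun=> 1%N)); last by move=> i /andP[_ ->].
    by rewrite -big_nat sum_nat_const_nat subn0 muln1.
  by move=> i; rewrite mem_index_iota => /andP[_ /andP[h1 _]]; rewrite ltnNge h1.
rewrite {1}xE opprD opprK addrACA addNr add0r -mulrBr normrM gtr0_norm//.
rewrite -[leRHS]mulr1 ler_pM2l// ger0_norm; last by rewrite subr_ge0 truncn_le.
by have := truncnS_gt y; rewrite -(addn1 (Num.truncn y)) natrD; lra.
Qed.

(** * The law of large numbers along all segments of parallel lines *)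

Section LineLln.
Context {R : realType} {d : measure_display} {T : measurableType d}.
Variables (P : probability T R) (C : R) (m : nat).
Variables (c : R * R -> {RV P >-> R}) (alpha : nat -> R).
Hypotheses (C_gt0 : 0 < C) (m_gt0 : (0 < m)%N).
Hypothesis c_bounded : {ae P, forall w, forall xi, dual_lattice xi -> `|c xi w| <= C}.
Hypothesis c_stationary : stationary_field m c.
Hypothesis c_mixing : alpha_mixing c alpha.
Hypothesis alpha_summable : (\sum_(1 <= n <oo) (alpha n)%:E < +oo)%E.

Variable xi : int -> int -> R * R.
Hypothesis xi_dual : forall k j, dual_lattice (xi k j).
Hypothesis xi_dist : forall k i j, enorm (xi k i - xi k j) = `|(i - j)%:~R|.
Hypothesis xi_shift : forall k j a b, exists z : int * int,
  xi (k + a * m%:Z) (j + b * m%:Z) = xi k j + zpoint (z *+ m).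

Let level (t : R) k j : set T := [set w | t <= c (xi k j) w].

Let m_level t k j : measurable (level t k j).
Proof.
rewrite (_ : level t k j = c (xi k j) @^-1` `[t, +oo[%classic).
  by rewrite -[X in measurable X]setTI; exact: measurable_funPT.
by apply/seteqP; split=> w; rewrite /level/= in_itv/= andbT.
Qed.

(** Empty index sets are infinitely far apart, so the mixing condition applies to them, with the
    empty set as both events. *)
Lemma alpha_ge0 n : (0 < n)%N -> 0 <= alpha n.
Proof.
move=> n0; have [_ h] := c_mixing.
have := h n set0 set0 n0 (@sub0set _ _) (@sub0set _ _).
have -> : set_dist set0 set0 = +oo%E :> \bar R.
  by rewrite /set_dist image_set0 ereal_inf0.
rewrite leey => /(_ isT) h'; rewrite -lee_fin; apply: le_trans h'.
have s0 : field_sigma_algebra c set0 set0.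
  by rewrite /field_sigma_algebra; set G := \bigcup_(_ in _) _; have [] := smallest_sigma_algebra [set: T] G.
apply: ereal_sup_ubound; exists set0 => //; exists set0 => //.
by rewrite setI0 measure0 mul0e sube0 abse0.
Qed.

Lemma alpha_sum_bounded : exists V, forall N, \sum_(1 <= n < N) alpha n <= V.
Proof.
have a0 n : (0 <= n)%N -> (1 <= n)%N -> (0 <= (alpha n)%:E)%E.
  by move=> _ n1; rewrite lee_fin alpha_ge0.
exists (fine (\sum_(1 <= n <oo) (alpha n)%:E)%E) => N.
rewrite -lee_fin fineK; last first.
  rewrite ge0_fin_numE//; apply: nneseries_ge0 => n n1 _; rewrite lee_fin alpha_ge0//.
rewrite -sumEFin; apply: nneseries_lim_ge => n n1 _; by rewrite lee_fin alpha_ge0.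
Qed.

Let mix_level t k (n : nat) (I1 I2 : set int) : (0 < n)%N ->
  (forall i j, I1 i -> I2 j -> n%:Z <= `|i - j|) ->
  forall E1 E2, <<s [set level t k i | i in I1] >> E1 ->
    <<s [set level t k i | i in I2] >> E2 ->
    `|pr P (E1 `&` E2) - pr P E1 * pr P E2| <= alpha n.
Proof.
move=> n0 hd E1 E2 s1 s2.
have [_ /(_ n [set xi k i | i in I1] [set xi k i | i in I2] n0)] := c_mixing.
have sub (I : set int) : [set xi k i | i in I] `<=` dual_lattice.
  by move=> _ [i _ <-].
move=> /(_ (sub _) (sub _)) h.
have dist : ((n%:R)%:E <= set_dist [set xi k i | i in I1] [set xi k i | i in I2])%E.
  apply/ereal_infP => _ [_ [i Ii <-] <-]; apply/ereal_infP => _ [_ [j Ij <-] <-].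
  rewrite xi_dist -intr_norm lee_fin -[n%:R]/(n%:Z%:~R) ler_int; exact: hd.
have lift (I : set int) E : <<s [set level t k i | i in I] >> E ->
    field_sigma_algebra c [set xi k i | i in I] E.
  apply: sub_sigma_algebra2.
  move=> _ [i Ii <-]; exists (xi k i); first by exists i.
  exists `[t, +oo[%classic; first exact: measurable_itv.
  by rewrite setTI; apply/seteqP; split=> w; rewrite /level/= in_itv/= andbT.
have m1 : measurable E1.
  by apply: sigma_measurable s1 => k' j; exact: m_level.
have m2 : measurable E2.
  by apply: sigma_measurable s2 => k' j; exact: m_level.
have := h dist => h'; rewrite -lee_fin; apply: le_trans h'.
apply: ereal_sup_ubound; exists E1; first exact: lift.
exists E2; first exact: lift.
by rewrite !prE//; exact: measurableI.
Qed.

(** Invariance is stated for images of events; since [tau] is an action, the image under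
    [tau (- zm)] is the preimage under [tau zm]. *)
Let pr_level_shift t k j a b :
  pr P (level t (k + a * m%:Z) (j + b * m%:Z)) = pr P (level t k j).
Proof.
have [tau [mtau tau0 tauD tauP] tauc] := c_stationary.
have [z xiz] := xi_shift k j a b; set zm := z *+ m in xiz.
rewrite -[RHS]/(fine _) -(tauP (- zm)); last exact: m_level.
rewrite /pr; congr (fine (P _)); apply/seteqP; split=> [w|_ [w lw <-]].
  rewrite /level/= xiz -tauc// => tw; exists (tau zm w) => //.
  by have := tauD zm (- zm); rewrite subrr tau0 => /(congr1 (@^~ w))/= <-.
rewrite /level/= xiz -tauc//.
by have := tauD (- zm) zm; rewrite addNr tau0 => /(congr1 (@^~ w))/= <-.
Qed.

(** The field is bounded almost surely only, while [bmeas] asks for a bound everywhere; clamping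
    changes it on a null set. *)
Definition clamp (x : R) : R := Num.max (- C) (Num.min C x).

Let clamp_bound x : - C <= clamp x <= C.
Proof. by rewrite /clamp le_max ge_max ge_min !lexx /=; apply/andP; split => //; move: C_gt0; lra. Qed.

Let clamp_id x : `|x| <= C -> clamp x = x.
Proof.
rewrite ler_norml => /andP[h1 h2]; rewrite /clamp (min_idPr h2); exact/max_idPr.
Qed.

Let clamp_level t x : - C < t <= C -> (t <= clamp x) = (t <= x).
Proof.
move=> /andP[t1 t2]; rewrite /clamp le_max le_min t2 /=.
by rewrite leNgt t1.
Qed.

Definition line_mean k j : R := expect P (c (xi k j)).

Let bmeas_clamp k j : bmeas (fun w => clamp (c (xi k j) w)).
Proof.
split; last by exists C => w; rewrite ler_norml clamp_bound.
apply: measurable_maxr; first exact: measurable_cst.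
by apply: measurable_minr; [exact: measurable_cst|].
Qed.

Let line_meanE k j : line_mean k j = expect P (fun w => clamp (c (xi k j) w)).
Proof.
apply: ae_eq_expect => //; first exact: (bmeas_clamp k j).1.
by apply: filterS c_bounded => w h; rewrite clamp_id//; exact: h.
Qed.

Let line_mean_le k j : `|line_mean k j| <= C.
Proof.
rewrite line_meanE ler_norml; apply/andP; split.
  rewrite -[leLHS](expect_cst P); apply: le_expect => //; first exact: bmeas_cst.
  by move=> w; have /andP[] := clamp_bound (c (xi k j) w).
rewrite -[leRHS](expect_cst P); apply: le_expect => //; first exact: bmeas_cst.
by move=> w; have /andP[] := clamp_bound (c (xi k j) w).
Qed.

Let lev (Q q : nat) : R := - C + 2 * C / Q%:R * q.+1%:R.

Let lev_bound (Q : nat) (q : 'I_Q) : - C < lev Q q <= C.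
Proof.
have QR : 0 < Q%:R :> R by rewrite ltr0n (leq_ltn_trans _ (ltn_ord q)).
have h : 0 < 2 * C / Q%:R by rewrite divr_gt0// mulr_gt0.
have h1 : 0 < 2 * C / Q%:R * q.+1%:R by rewrite mulr_gt0// ltr0n.
have h2 : 2 * C / Q%:R * q.+1%:R <= 2 * C.
  by rewrite mulrAC ler_pdivrMr// ler_wpM2l ?ler_nat// mulr_ge0// ltW.
by rewrite /lev; apply/andP; split; lra.
Qed.

Let layer k j Q w : (0 < Q)%N ->
  `|clamp (c (xi k j) w) -
    (- C + 2 * C / Q%:R * \sum_(q < Q) \1_(level (lev Q q) k j) w)| <= 2 * C / Q%:R.
Proof.
move=> Q0; have := layer_cake C_gt0 Q0 (clamp_bound (c (xi k j) w)).
congr (`|_ - (_ + _ * _)| <= _); apply: eq_bigr => q _.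
rewrite clamp_level; last exact: lev_bound.
rewrite indicE; congr (nat_of_bool _)%:R.
by apply/idP/idP; rewrite inE.
Qed.

Let bmeas_layer k j Q :
  bmeas (fun w => - C + 2 * C / Q%:R * \sum_(q < Q) \1_(level (lev Q q) k j) w).
Proof.
apply: bmeasD; first exact: bmeas_cst.
by apply: bmeasZ; apply: bmeas_sum => q; exact: bmeas_indic.
Qed.

Let layer_mean k j Q : (0 < Q)%N ->
  `|line_mean k j - (- C + 2 * C / Q%:R * \sum_(q < Q) pr P (level (lev Q q) k j))|
    <= 2 * C / Q%:R.
Proof.
move=> Q0; set h := 2 * C / Q%:R.
have -> : - C + h * \sum_(q < Q) pr P (level (lev Q q) k j) =
    expect P (fun w => - C + h * \sum_(q < Q) \1_(level (lev Q q) k j) w).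
  rewrite expectD ?expect_cst//; [|exact: bmeas_cst|]; last first.
    by apply: bmeasZ; apply: bmeas_sum => q; exact: bmeas_indic.
  rewrite expectZ; last by apply: bmeas_sum => q; exact: bmeas_indic.
  rewrite expect_sum; last by move=> q; exact: bmeas_indic.
  by congr (_ + _ * _); apply: eq_bigr => q _; rewrite expect_indic.
have bl := bmeas_layer k j Q.
have e1 : expect P (fun w => clamp (c (xi k j) w)) <=
    expect P (fun w => (- C + h * \sum_(q < Q) \1_(level (lev Q q) k j) w) + h).
  apply: le_expect => //; first by apply: bmeasD => //; exact: bmeas_cst.
  by move=> w; have := layer k j w Q0; rewrite ler_norml -/h => /andP[? ?]; lra.
have e2 : expect P (fun w => - C + h * \sum_(q < Q) \1_(level (lev Q q) k j) w) <=
    expect P (fun w => clamp (c (xi k j) w) + h).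
  apply: le_expect => //; first by apply: bmeasD => //; exact: bmeas_cst.
  by move=> w; have := layer k j w Q0; rewrite ler_norml -/h => /andP[? ?]; lra.
rewrite expectD// ?expect_cst in e1; last exact: bmeas_cst.
rewrite expectD// ?expect_cst in e2; last exact: bmeas_cst.
rewrite line_meanE ler_norml; apply/andP; split; move: e1 e2;
  set x := expect _ _; set y := expect _ _; lra.
Qed.

(** Shifted level sets have equal probabilities, and both means are within 2 C / Q of the same
    combination of these, for every [Q]. *)
Lemma line_mean_per k j a b : line_mean (k + a * m%:Z) (j + b * m%:Z) = line_mean k j.
Proof.
set x' := line_mean (_ + _) _; set x := line_mean k j.
apply/eqP; rewrite -subr_eq0; apply/negPn/negP => ne.
have n0 : 0 < `|x' - x| by rewrite normr_gt0.
pose Q := (Num.truncn (4 * C / `|x' - x|)).+1.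
have Q0 : (0 < Q)%N by [].
have h2 := layer_mean (k + a * m%:Z) (j + b * m%:Z) Q0; have h1 := layer_mean k j Q0.
have e : \sum_(q < Q) pr P (level (lev Q q) (k + a * m%:Z) (j + b * m%:Z)) =
    \sum_(q < Q) pr P (level (lev Q q) k j).
  by apply: eq_bigr => q _; rewrite pr_level_shift.
rewrite e in h2; move: h1 h2; rewrite -/x' -/x; set y := - C + _ => h1 h2.
have h3 : `|x' - x| <= 4 * C / Q%:R.
  have -> : x' - x = (x' - y) - (x - y) by ring.
  apply: (le_trans (ler_normB _ _)); have -> : 4 * C / Q%:R = 2 * C / Q%:R + 2 * C / Q%:R by ring.
  exact: lerD.
move: h3; rewrite ler_pdivlMr ?ltr0n// leNgt => /negP; apply.
by rewrite [_ * Q%:R]mulrC -ltr_pdivrMr//; exact: truncnS_gt.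
Qed.

Let scales w := forall (Q : nat) (q : 'I_Q) (M N : nat), (0 < M)%N -> exists p0, forall p, (p0 <= p)%N ->
  ~ bad_scale P (level (lev Q q)) M (2 ^ p) N.+1%:R^-1 w.

(** All parameters range over countable sets, the accuracy being of the form 1 / (N + 1), so one
    null set serves for all lengths and errors. *)
Lemma ae_scales : {ae P, forall w, scales w}.
Proof.
have [V hV] := alpha_sum_bounded.
have h (Q q M N : nat) : {ae P, forall w, (0 < M)%N -> exists p0, forall p, (p0 <= p)%N ->
    ~ bad_scale P (level (lev Q q)) M (2 ^ p) N.+1%:R^-1 w}.
  have [M0|M0] := posnP M; first by rewrite M0; apply: filterE.
  have := @ae_good_scales R d T P (level (lev Q q)) alpha V (m_level _) alpha_ge0 hV
    (@mix_level (lev Q q)) M N.+1%:R^-1 M0 (ltac:(by rewrite invr_gt0 ltr0n)).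
  by apply: filterS => w.
have h1 (Q q M : nat) := ae_foralln (h Q q M).
have h2 (Q q : nat) := ae_foralln (h1 Q q).
have h3 (Q : nat) := ae_foralln (h2 Q).
have h4 := ae_foralln h3.
by apply: filterS h4 => w hw Q q M N; exact: hw.
Qed.

Let dyadic_scale (x : R) (p0 : nat) : 2 ^+ p0 < x -> exists p, [/\ (p0 <= p)%N, x <= 2 ^+ p & 2 ^+ p < 2 * x].
Proof.
move=> px; have ex : exists p, x <= 2 ^+ p.
  exists (Num.truncn x).+1; apply: ltW; apply: (lt_le_trans (truncnS_gt x)).
  by rewrite -natrX ler_nat ltnW// ltn_expl.
exists (ex_minn ex); case: ex_minnP => p h1 h2.
have p0p : (p0 < p)%N.
  rewrite ltnNge; apply/negP => pp0.
  have : 2 ^+ p <= 2 ^+ p0 :> R by rewrite ler_eXn2l// ltr1n.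
  by move=> h; have := le_lt_trans (le_trans h1 h) px; rewrite ltxx.
split=> //; first exact: ltnW.
case: p h1 h2 p0p => // p h1 h2 _; rewrite exprS ltr_pM2l// ltNge; apply/negP => /h2.
by rewrite ltnn.
Qed.

(** The block length 2^p is chosen between D / (M eps) and 2 D / (M eps), so that 2 M blocks cover
    the window. The error is then at most 2 D (2 / (N + 1) + 4 / M), and [M] and [N] make each of
    the two parts at most eta / 2. *)
Let level_lln w (Q : nat) (q : 'I_Q) : scales w -> forall D eta : R, 0 < D -> 0 < eta ->
  exists2 eps0, 0 < eps0 & forall eps, 0 < eps < eps0 -> forall k u v : int, u <= v ->
    eps * `|k%:~R| <= D -> eps * `|u%:~R| <= D -> eps * `|v%:~R| <= D ->
    `|eps * \sum_(i < absz (v - u)%R) centered P (level (lev Q q)) k (u + i%:Z) w| <= eta.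
Proof.
move=> sw D eta D0 eta0.
pose M := (Num.truncn (16 * D / eta)).+1.
pose N := Num.truncn (8 * D / eta).
have M0 : (0 < M)%N by [].
have MR : 0 < M%:R :> R by rewrite ltr0n.
have [p0 hp0] := sw Q q M N M0.
exists (D / (M%:R * 2 ^+ p0)); first by rewrite divr_gt0// mulr_gt0// exprn_gt0.
move=> eps /andP[eps0 epslt] k u v uv kD uD vD.
have px : 2 ^+ p0 < D / (M%:R * eps).
  rewrite ltr_pdivlMr ?mulr_gt0//; move: epslt; rewrite ltr_pdivlMr ?mulr_gt0 ?exprn_gt0//.
  by have -> : 2 ^+ p0 * (M%:R * eps) = eps * (M%:R * 2 ^+ p0) by ring.
have [p [pp0 xp p2x]] := dyadic_scale px.
have MD : D <= eps * (M * 2 ^ p)%N%:R.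
  by move: xp; rewrite ler_pdivrMr ?mulr_gt0// natrM natrX; lra.
have rng (x : int) : eps * `|x%:~R| <= D -> `|x| <= (M * 2 ^ p)%N%:Z.
  move=> /le_trans/(_ MD); rewrite ler_pM2l// -intr_norm.
  by rewrite -[_%:R]/((M * 2 ^ p)%N%:Z%:~R) ler_int.
have ru := rng _ uD; have rv := rng _ vD.
have := @good_scale_bound R d T P (level (lev Q q)) (m_level _) M (2 ^ p) N.+1%:R^-1 w k u v
   (ltac:(by rewrite invr_ge0)) (hp0 p pp0) (rng _ kD) ltac:(move: ru; clear; lia) uv
   ltac:(move: rv; clear; lia).
move=> h; rewrite normrM gtr0_norm//.
apply: (le_trans (ler_wpM2l (ltW eps0) h)); rewrite natrX.
have e2 : eps * 2 ^+ p * M%:R <= 2 * D.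
  have := p2x; rewrite mulrA ltr_pdivlMr ?mulr_gt0//; lra.
have NR : 0 < N.+1%:R :> R by rewrite ltr0n.
have hN : 8 * D <= N.+1%:R * eta by rewrite -ler_pdivrMr// ltW//; exact: truncnS_gt.
have hM : 16 * D <= M%:R * eta by rewrite -ler_pdivrMr// ltW//; exact: truncnS_gt.
have -> : eps * ((2 * M%:R * N.+1%:R^-1 + 4) * 2 ^+ p) =
  (eps * 2 ^+ p * M%:R) * (2 / N.+1%:R + 4 / M%:R) by field; rewrite !gt_eqF.
apply: (@le_trans _ _ (2 * D * (2 / N.+1%:R + 4 / M%:R))).
  apply: ler_wpM2r => //; apply: addr_ge0; apply: divr_ge0 => //.
have a1 : 4 * D / N.+1%:R <= eta / 2 by rewrite ler_pdivrMr//; lra.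
have a2 : 8 * D / M%:R <= eta / 2 by rewrite ler_pdivrMr//; lra.
have -> : 2 * D * (2 / N.+1%:R + 4 / M%:R) = 4 * D / N.+1%:R + 8 * D / M%:R.
  by field; rewrite !gt_eqF.
by rewrite [leRHS]splitr; exact: lerD.
Qed.

Definition periodic_mean (k : int) : R := m%:R^-1 * \sum_(j < m) line_mean k j%:Z.

Lemma ae_line_lln : {ae P, forall w, forall D eta : R, 0 < D -> 0 < eta ->
  exists2 eps0, 0 < eps0 & forall eps, 0 < eps < eps0 -> forall k u v : int, u <= v ->
    eps * `|k%:~R| <= D -> eps * `|u%:~R| <= D -> eps * `|v%:~R| <= D ->
    `|eps * zsum u v (fun j => c (xi k j) w) - eps * (v - u)%:~R * periodic_mean k| <= eta}.
Proof.
apply: filterS2 ae_scales c_bounded => w sw cw D eta D0 eta0.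
(* The error has three parts of eta / 3. Discretizing the levels costs 2 h at each of at most 2 D /
   eps points, with h = 2 C / Q, which determines [Q]; the [Q] level laws with error eta / (6 C)
   give the second part; the rounding to full periods, at most 2 m C eps, gives the third through
   [e3]. *)
pose Q := (Num.truncn (24 * (D * C) / eta)).+1.
have Q0 : (0 < Q)%N by []. have QR : 0 < Q%:R :> R by rewrite ltr0n.
have hQ : 24 * (D * C) <= Q%:R * eta by rewrite -ler_pdivrMr// ltW//; exact: truncnS_gt.
have eta1 : 0 < eta / (6 * C) by rewrite divr_gt0// mulr_gt0.
have hq (q : 'I_Q) : exists e : R, 0 < e /\ forall eps, 0 < eps < e -> forall k u v : int, u <= v ->
    eps * `|k%:~R| <= D -> eps * `|u%:~R| <= D -> eps * `|v%:~R| <= D ->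
    `|eps * \sum_(i < absz (v - u)%R) centered P (level (lev Q q)) k (u + i%:Z) w| <= eta / (6 * C).
  by have [e e0 he] := level_lln q sw D0 eta1; exists e.
have [E hE] := choice hq.
have mR : 0 < m%:R :> R by rewrite ltr0n.
pose e3 := eta / (6 * m%:R * C).
have e30 : 0 < e3 by rewrite divr_gt0 ?mulr_gt0.
exists (\big[Num.min/e3]_(q < Q) E q).
  by apply: (big_ind (fun x => 0 < x)) => // [x y x0 y0|q _]; [rewrite lt_min x0|have [] := hE q].
move=> eps /andP[eps0 epsE] k u v uv kD uD vD.
have epsq q : 0 < eps < E q.
  rewrite eps0 (lt_le_trans epsE)//; exact: bigmin_le_cond.
have epse3 : eps < e3 by apply: (lt_le_trans epsE); exact: bigmin_le_id.
pose n := absz (v - u).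
have nE : (v - u)%:~R = n%:R :> R.
  by rewrite -[n%:R]/(n%:Z%:~R); congr (_%:~R); rewrite /n; move: uv; clear; lia.
have nD : eps * n%:R <= 2 * D.
  rewrite -nE rmorphB/=; have := ler_norm (v%:~R : R); have := lerNnormlW (lexx `|u%:~R : R|).
  move=> h1 h2; have := ler_wpM2l (ltW eps0) h1; have := ler_wpM2l (ltW eps0) h2; lra.
pose h := 2 * C / Q%:R.
have h0 : 0 < h by rewrite divr_gt0// mulr_gt0.
have term (i : nat) : `|c (xi k (u + i%:Z)) w - line_mean k (u + i%:Z) -
    h * \sum_(q < Q) centered P (level (lev Q q)) k (u + i%:Z) w| <= h + h.
  have := layer k (u + i%:Z) w Q0; have := layer_mean k (u + i%:Z) Q0.
  rewrite clamp_id; last exact: cw.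
  rewrite -/h /centered sumrB mulrBr; set S1 := \sum_(q < Q) pr _ _; set S2 := \sum_(q < Q) _.
  rewrite !ler_norml => /andP[? ?] /andP[? ?]; apply/andP; split; lra.
have p1 : `|\sum_(i < n) line_mean k (u + i%:Z) - n%:R * periodic_mean k| <= 2 * m%:R * C.
  apply: (@period_sum R m (line_mean k) C) => // j.
  by have := line_mean_per k j 0 1; rewrite mul0r addr0 mul1r.
have p2 : `|\sum_(i < n) (c (xi k (u + i%:Z)) w - line_mean k (u + i%:Z) -
    h * \sum_(q < Q) centered P (level (lev Q q)) k (u + i%:Z) w)| <= n%:R * (h + h).
  apply: (le_trans (ler_norm_sum _ _ _)); rewrite mulr_natl -[in leRHS](card_ord n) -sumr_const.
  by apply: ler_sum => i _; exact: term.
have p3 : `|eps * \sum_(i < n) (h * \sum_(q < Q) centered P (level (lev Q q)) k (u + i%:Z) w)| <=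
    eta / 3.
  rewrite -mulr_sumr exchange_big mulrCA /= mulr_sumr normrM gtr0_norm//.
  apply: (@le_trans _ _ (h * \sum_(q < Q) (eta / (6 * C)))).
    apply: ler_wpM2l; first exact: ltW.
    apply: (le_trans (ler_norm_sum _ _ _)); apply: ler_sum => q _.
    by have [_] := hE q; move/(_ eps (epsq q) k u v uv kD uD vD).
  rewrite sumr_const card_ord -mulr_natl /h le_eqVlt; apply/orP; left; apply/eqP.
  by field; rewrite !gt_eqF.
rewrite nE /zsum -/n !sumrB in p2 *.
set Sc := \sum_(i < n) c _ _ in p2 *; set Sl := \sum_(i < n) line_mean _ _ in p1 p2.
set Sq := \sum_(i < n) (h * _) in p2 p3.
have -> : eps * Sc - eps * n%:R * periodic_mean k =
  eps * (Sc - Sl - Sq) + eps * (Sl - n%:R * periodic_mean k) + eps * Sq by ring.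
have b1 : `|eps * (Sc - Sl - Sq)| <= eta / 3.
  rewrite normrM gtr0_norm//; apply: (le_trans (ler_wpM2l (ltW eps0) p2)).
  apply: (@le_trans _ _ (2 * D * (h + h))).
    by rewrite mulrA ler_wpM2r// addr_ge0// ltW.
  have -> : 2 * D * (h + h) = 8 * (D * C) / Q%:R by rewrite /h; field; rewrite gt_eqF.
  by rewrite ler_pdivrMr//; lra.
have b2 : `|eps * (Sl - n%:R * periodic_mean k)| <= eta / 3.
  rewrite normrM gtr0_norm//; apply: (le_trans (ler_wpM2l (ltW eps0) p1)).
  have mC : 0 < 6 * m%:R * C by rewrite !mulr_gt0.
  move: epse3; rewrite /e3 ltr_pdivlMr//; lra.
apply: (le_trans (ler_normD _ _)).
have := ler_normD (eps * (Sc - Sl - Sq)) (eps * (Sl - n%:R * periodic_mean k)); lra.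
Qed.

Lemma periodic_meanE k : periodic_mean k =
  fine ('E_P[(fun w => m%:R^-1 * \sum_(j < m) c (xi k j%:Z) w)%R]).
Proof.
rewrite /periodic_mean expectation.unlock -[RHS]/(expect P _).
transitivity (expect P (fun w => m%:R^-1 * \sum_(j < m) clamp (c (xi k j%:Z) w))).
  rewrite expectZ; last by apply: bmeas_sum => j.
  rewrite expect_sum//; congr (_ * _); apply: eq_bigr => j _; exact: line_meanE.
apply: ae_eq_expect.
- by apply: (bmeasZ _ (bmeas_sum _ _)).1.
- by apply: measurable_funM; [exact: measurable_cst|exact: measurable_sum].
apply: filterS c_bounded => w h; congr (_ * _); apply: eq_bigr => j _.
by rewrite clamp_id//; exact: h.
Qed.

Lemma periodic_mean_le k : `|periodic_mean k| <= C.
Proof.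
have mR : 0 < m%:R :> R by rewrite ltr0n.
rewrite /periodic_mean normrM gtr0_norm ?invr_gt0// ler_pdivrMl//.
apply: (le_trans (ler_norm_sum _ _ _)); rewrite mulr_natl -[in leRHS](card_ord m) -sumr_const.
by apply: ler_sum.
Qed.

Lemma periodic_mean_per k a : periodic_mean (k + a * m%:Z) = periodic_mean k.
Proof.
rewrite /periodic_mean; congr (_ * _); apply: eq_bigr => j _.
by have := line_mean_per k j%:Z a 0; rewrite mul0r addr0.
Qed.

End LineLln.

(** * Differentiability of Lipschitz monotone functions *)

Section MonotoneLipschitz.
Context {R : realType}.
Variables (f : R -> R) (K : R).
Hypothesis K_gt0 : 0 < K.
Hypothesis f_nd : forall x y, x <= y -> f x <= f y.
Hypothesis f_lip : forall x y, x <= y -> f y - f x <= K * (y - x).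

Let lip_cont (g : R -> R) (M : R) : 0 < M -> (forall x y, x <= y -> `|g y - g x| <= M * (y - x)) ->
  right_continuous g.
Proof.
move=> M0 h; apply: right_continuousW => x; apply/cvgrPdist_lt => e e0.
have : 0 < e / M by rewrite divr_gt0.
move=> eM; near=> y.
have : `|x - y| < e / M by near: y; apply/nbhs_ballP; exists (e / M).
rewrite ltr_pdivlMr// mulrC => xy; apply: le_lt_trans xy.
have [le|/ltW le] := leP x y.
  by rewrite distrC (le_trans (h _ _ le))// distrC ger0_norm ?subr_ge0.
by rewrite (le_trans (h _ _ le))// ger0_norm ?subr_ge0.
Unshelve. all: by end_near. Qed.

(* K x = f x + h x with f and h nondecreasing, so the Stieltjes measure of f is
   dominated by K times the Lebesgue measure. *)
Let h x := K * x - f x.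
Let s x := K * x.

Let h_nd : {homo h : x y / x <= y}.
Proof. by move=> x y xy; have := f_lip xy; rewrite /h; lra. Qed.

Let s_nd : {homo s : x y / x <= y}.
Proof. by move=> x y xy; rewrite /s ler_pM2l. Qed.

Let f_rc : right_continuous f.
Proof.
apply: (lip_cont K_gt0) => x y xy.
by rewrite ger0_norm ?subr_ge0 ?f_nd//; exact: f_lip.
Qed.

Let h_rc : right_continuous h.
Proof.
apply: (lip_cont K_gt0) => x y xy.
rewrite ger0_norm ?subr_ge0 ?h_nd//; have := f_nd xy; rewrite /h; lra.
Qed.

Let s_rc : right_continuous s.
Proof.
apply: (lip_cont K_gt0) => x y xy.
by rewrite ger0_norm ?subr_ge0 ?s_nd// /s mulrBr.
Qed.

HB.instance Definition _ := @isCumulative.Build R _ R f f_nd f_rc.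
HB.instance Definition _ := @isCumulative.Build R _ R h h_nd h_rc.
HB.instance Definition _ := @isCumulative.Build R _ R s s_nd s_rc.

Let lam := @lebesgue_measure R.
Let mf := lebesgue_stieltjes_measure (f : cumulative R R).
Let mh := lebesgue_stieltjes_measure (h : cumulative R R).
Let ms := lebesgue_stieltjes_measure (s : cumulative R R).

Let LS_oc (g : cumulative R R) (a b : R) : a <= b ->
  lebesgue_stieltjes_measure g `]a, b]%classic = (g b - g a)%:E.
Proof.
move=> ab; rewrite /lebesgue_stieltjes_measure /measure_extension measurable_mu_extE/=; last exact: is_ocitv.
by rewrite wlength_itv_bnd.
Qed.

Let null_mf B : measurable B -> lam B = 0%E -> mf B = 0%E.
Proof.
move=> mB B0.
have ocE X : ocitv X -> X = set0 \/ exists a b : R, a < b /\ X = `]a, b]%classic.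
  by move/ocitvP => [->|[[a b] /= ab ->]]; [left|right; exists a, b].
have e1 : ms B = measure_add mf mh B.
  apply: lebesgue_stieltjes_measure_unique => // X /ocE[->|[a [b [ab ->]]]].
    by rewrite !measure0.
  apply: (eq_trans (LS_oc (s : cumulative R R) (ltW ab))); apply: esym.
  apply: (eq_trans (measure_addE mf mh _)).
  apply: (eq_trans (congr2 adde (LS_oc (f : cumulative R R) (ltW ab))
    (LS_oc (h : cumulative R R) (ltW ab)))).
  apply: (@eq_trans _ _ ((f b - f a) + (h b - h a))%:E); first by [].
  by congr EFin; rewrite /= /s /h; ring.
have e2 : ms B = mscale (NngNum (ltW K_gt0)) lam B.
  apply: lebesgue_stieltjes_measure_unique => // X /ocE[->|[a [b [ab ->]]]].
    by rewrite !measure0.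
  apply: (eq_trans (LS_oc (s : cumulative R R) (ltW ab))).
  apply: (@eq_trans _ _ (K%:E * (b - a)%:E)%E); first by rewrite -EFinM; congr EFin; rewrite /= /s mulrBr.
  congr (_ * _)%E; apply: esym.
  by apply: (eq_trans (lebesgue_measure_itv `]a, b])); rewrite /= lte_fin ab.
have e3 : mscale (NngNum (ltW K_gt0)) lam B = 0%E.
  by apply: (@eq_trans _ _ (K%:E * lam B)%E) => //; rewrite B0 mule0.
have /eqP : (mf B + mh B = 0)%E by rewrite -[RHS]e3 -e2 e1 measure_addE.
by rewrite padde_eq0 ?measure_ge0// => /andP[/eqP].
Qed.

(** By [null_mf] the Stieltjes measure of [f] on the interval is absolutely continuous. So [f] is
    the integral of its Radon-Nikodym density up to a constant, and Lebesgue differentiation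
    applies. *)
Lemma ae_derivable_on (a b : R) : a < b ->
  {ae (@lebesgue_measure R), forall x, a < x < b -> derivable f x 1}.
Proof.
move=> ab; pose D : set (measurableTypeR R) := `]a, b]%classic.
have mD : measurable D by exact: measurable_itv.
have mfD_fin : (mf D < +oo)%E.
  by apply: (eq_ind_r (fun z => (z < +oo)%E) _ (LS_oc (f : cumulative R R) (ltW ab))); rewrite ltry.
pose nu := mfrestr mD mfD_fin.
have nul : nu `<< lam.
  move=> N N0 B mB BN; rewrite /nu /mfrestr /mrestr.
  apply: null_mf; first exact: measurableI.
  by apply: N0; [exact: measurableI|exact: subset_trans BN].
have [g [g0 gfin intg gE]] := radon_nikodym_sigma_finite nul.
pose G : R -> R := fine \o g.
have gG : EFin \o G = g by apply/funext => x /=; rewrite fineK.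
have ig : (@lebesgue_measure R).-integrable setT (EFin \o G) by rewrite gG; exact: intg.
have ig2 y : (@lebesgue_measure R).-integrable [set` Interval (BRight a) (BRight y)] (EFin \o G).
  by apply: (integrableS _ _ _ ig).
have il : locally_integrable setT G by apply: open_integrable_locally ig; exact: openT.
have Fae : Filter (nbhs (almost_everywhere (@lebesgue_measure R))).
  by apply: ae_filter_ringOfSetsType.
have := FTC1 ig2 il.
apply: filterS.
move=> x hx /andP[ax xb].
have [dF _] := hx ax.
have FE y : a < y < b -> f y = f a + (\int[lam]_(t in `]a, y]) G t).
  move=> /andP[ay yb].
  have : nu `]a, y]%classic = (f y - f a)%:E.
    rewrite /nu /mfrestr /mrestr (_ : `]a, y] `&` D = `]a, y]%classic).
      exact: (LS_oc (f : cumulative R R) (ltW ay)).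
    by rewrite /D setIidl//; apply: subset_itvl; rewrite bnd_simp ltW.
  move=> nuE; have e := eq_trans (esym nuE) (gE _ (measurable_itv `]a, y])).
  have -> : (\int[lam]_(t in `]a, y]) G t) = fine (f y - f a)%:E by rewrite e /Rintegral -gG.
  by rewrite /= addrC subrK.
apply: (@near_eq_derivable _ _ _ (fun y => f a + (\int[lam]_(t in `]a, y]) G t))).
  near=> y; apply/esym/FE; apply/andP; split; near: y.
    exact: lt_nbhsr.
  exact: lt_nbhsl.
by apply: derivableD => //; exact: derivable_cst.
Unshelve. all: by end_near. Qed.

End MonotoneLipschitz.

(** * Rectangles *)

Section Norm.
Context {R : realType}.
Implicit Types x y : R * R.

Lemma fst_le_enorm x : `|x.1| <= enorm x.
Proof. by rewrite -sqrtr_sqr ler_wsqrtr// lerDl sqr_ge0. Qed.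

Lemma snd_le_enorm x : `|x.2| <= enorm x.
Proof. by rewrite -sqrtr_sqr ler_wsqrtr// lerDr sqr_ge0. Qed.

Lemma enorm_le x (e : R) : `|x.1| <= e -> `|x.2| <= e -> enorm x <= 2 * e.
Proof.
move=> h1 h2; have e0 : 0 <= e := le_trans (normr_ge0 _) h1.
rewrite -[leRHS]ger0_norm ?mulr_ge0// -sqrtr_sqr ler_wsqrtr//.
have q (u : R) : `|u| <= e -> u ^+ 2 <= e ^+ 2.
  by move=> ue; rewrite -real_normK ?num_real// ler_sqr ?nnegrE.
by have := q _ h1; have := q _ h2; have := sqr_ge0 e; nra.
Qed.

Lemma diam_ge0 (A : set (R * R)) : (0 <= diam A)%E.
Proof. by rewrite /diam le_max lexx. Qed.

Lemma diam_le (A : set (R * R)) (e : R) : 0 <= e ->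
  (forall x y, A x -> A y -> enorm (x - y) <= e) -> (diam A <= e%:E)%E.
Proof.
move=> e0 h; rewrite /diam ge_max lee_fin e0/=.
by apply: ge_ereal_sup => _ [x Ax [y Ay <-]]; rewrite lee_fin h.
Qed.

Lemma enorm_le_diam (A : set (R * R)) x y : A x -> A y -> ((enorm (x - y))%:E <= diam A)%E.
Proof.
move=> Ax Ay; rewrite /diam le_max; apply/orP; right.
by apply: ereal_sup_ubound; exists x => //; exists y.
Qed.

End Norm.

(** * The Hausdorff measure of isometric images of intervals *)

Section Segment.
Context {R : realType}.
Variables (e : R -> R * R) (pr : R * R -> R).
Hypothesis e_isom : forall s t, enorm (e s - e t) = `|s - t|.
Hypothesis pr_e : forall t, pr (e t) = t.
Hypothesis pr_contr : forall x y, `|pr x - pr y| <= enorm (x - y).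

Let seg (a b : R) : set (R * R) := e @` `[a, b]%classic.

Let premeasure_le (a b delta : R) : a <= b -> 0 < delta ->
  (hausdorff_premeasure1 delta (seg a b) <= (b - a)%:E)%E.
Proof.
move=> ab d0; pose N := (Num.truncn ((b - a) / delta)).+1.
pose h := (b - a) / N%:R.
have N0 : 0 < N%:R :> R by rewrite ltr0n.
have h0 : 0 <= h by rewrite divr_ge0 ?subr_ge0// ltW.
have hN : h * N%:R = b - a by rewrite /h mulfVK ?gt_eqF.
have hd : h <= delta.
  rewrite /h ler_pdivrMr// mulrC -ler_pdivrMr//.
  by rewrite ltW// truncnS_gt.
pose U n : set (R * R) := if (n < N)%N then seg (a + n%:R * h) (a + n.+1%:R * h) else set0.
have dU n : (diam (U n) <= (if (n < N)%N then h else 0)%:E)%E.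
  rewrite /U; case: ifP => nN; last by apply: diam_le => // x y [].
  apply: diam_le => // x y; move=> [s /= + <-] [t /= + <-]; rewrite !in_itv/= e_isom -natr1 mulrDl mul1r.
  by move=> /andP[s1 s2] /andP[t1 t2]; rewrite ler_norml; apply/andP; split; lra.
apply: (@le_trans _ _ (\sum_(0 <= n <oo) diam (U n))%E).
  apply: ereal_inf_lbound; exists U => //; split; last first.
    move=> n; apply: le_trans (dU n) _; rewrite lee_fin; case: ifP => // _.
    exact: ltW.
  move=> x [t /=]; rewrite in_itv/= => /andP[at1 tb] <-.
  have ex : exists n, t <= a + n.+1%:R * h by exists N.-1; rewrite /= mulrC hN addrC subrK.
  have n_N : (ex_minn ex < N)%N.
    by case: ex_minnP => n _ /(_ N.-1); apply; rewrite /= mulrC hN addrC subrK.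
  exists (ex_minn ex) => //; rewrite /U n_N; case: ex_minnP => n tn nmin.
  exists t => //=; rewrite in_itv/= tn andbT.
  case: n nmin {tn} => [|n] nmin; first by rewrite mul0r addr0.
  by rewrite leNgt; apply/negP => /ltW /nmin; rewrite ltnn.
apply: lime_le; first by apply: is_cvg_nneseries => n _ _; exact: diam_ge0.
apply: nearW => M; apply: (@le_trans _ _ (\sum_(0 <= n < M) (if (n < N)%N then h else 0)%:E)%E).
  by apply: lee_sum => n _; exact: dU.
rewrite sumEFin lee_fin -hN.
elim: M => [|M IH]; first by rewrite big_nil mulr_ge0// ltW.
have eM M' : (M' <= N)%N -> \sum_(0 <= n < M') (if (n < N)%N then h else 0) = h * M'%:R.
  move=> MN; rewrite (eq_big_nat _ _ (F2 := fun=> h)); last first.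
    by move=> n /= nM; rewrite (leq_trans nM MN).
  by rewrite big_const_nat subn0 iter_addr addr0 mulr_natr.
have [MN|NM] := ltnP M N; last by rewrite big_nat_recr//= [(M < N)%N]ltnNge NM addr0.
by rewrite eM// ler_wpM2l// ler_nat.
Qed.

(** The projection [pr] does not increase distances, so it maps each covering set into an interval
    no longer than its diameter. These intervals cover [[a, b]], and Lebesgue measure is
    subadditive. *)
Let premeasure_ge (a b delta : R) : a <= b ->
  ((b - a)%:E <= hausdorff_premeasure1 delta (seg a b))%E.
Proof.
move=> ab; apply: le_ereal_inf_tmp => _ [U [cov dU] <-].
pose F n := `[inf (pr @` U n), sup (pr @` U n)]%classic.
have bnd n x y : U n x -> U n y -> pr x - pr y <= fine (diam (U n)).
  move=> Ux Uy; have fin : diam (U n) \is a fin_num.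
    by rewrite ge0_fin_numE ?diam_ge0// (le_lt_trans (dU n))// ltry.
  rewrite (le_trans (ler_norm _))// (le_trans (pr_contr _ _))//.
  by rewrite -lee_fin fineK//; exact: enorm_le_diam.
have hs n x : U n x -> has_sup (pr @` U n).
  move=> Ux; split; first by exists (pr x), x.
  exists (pr x + fine (diam (U n))) => _ [y Uy <-].
  by rewrite -lerBlDl; exact: bnd.
have hi n x : U n x -> has_inf (pr @` U n).
  move=> Ux; split; first by exists (pr x), x.
  exists (pr x - fine (diam (U n))) => _ [y Uy <-].
  by have := bnd n x y Ux Uy; lra.
have FU n : U n !=set0 -> (lebesgue_measure (F n) <= diam (U n))%E.
  move=> [x Ux]; rewrite /F lebesgue_measure_itv/=; case: ifP => _; last exact: diam_ge0.
  have fin : diam (U n) \is a fin_num.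
    by rewrite ge0_fin_numE ?diam_ge0// (le_lt_trans (dU n))// ltry.
  rewrite -EFinB -(fineK fin) lee_fin lerBlDr.
  apply: ge_sup; first by exists (pr x), x.
  move=> _ [y Uy <-]; rewrite -lerBlDl; apply: lb_le_inf; first by exists (pr x), x.
  by move=> _ [z Uz <-]; have := bnd n y z Uy Uz; lra.
pose G n := if `[< U n !=set0 >] then F n else set0.
have mG n : measurable (G n) by rewrite /G; case: ifP => _; [exact: measurable_itv|exact: measurable0].
have covG : `[a, b] `<=` \bigcup_n G n.
  move=> t tab; have [n _ Un] := cov (e t) ltac:(by exists t).
  exists n => //; rewrite /G; case: asboolP => [_|[]]; last by exists (e t).
  rewrite /F/= in_itv/=; apply/andP; split.
    by apply: inf_lbound; [exact: (hi _ _ Un).2|exists (e t)].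
  by apply: ub_le_sup; [exact: (hs _ _ Un).2|exists (e t)].
have : (lebesgue_measure `[a, b]%classic <= \sum_(0 <= n <oo) lebesgue_measure (G n))%E.
  by apply: measure_sigma_subadditive => //; exact: measurable_itv.
rewrite lebesgue_measure_itv/= lte_fin => h.
apply: (@le_trans _ _ (\sum_(0 <= n <oo) lebesgue_measure (G n))%E).
  apply: le_trans h; case: ltP => // ba.
  by rewrite lee_fin subr_le0.
apply: lee_nneseries => [n _ _|n _]; first exact: measure_ge0.
by rewrite /G; case: asboolP => [/FU //|_]; rewrite measure0 diam_ge0.
Qed.

Lemma hausdorff_measure1_segment (a b : R) : a <= b ->
  hausdorff_measure1 (e @` `[a, b]%classic) = (b - a)%:E.
Proof.
move=> ab; apply/eqP; rewrite eq_le; apply/andP; split.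
  by apply: ge_ereal_sup => _ [delta d0 <-]; exact: premeasure_le.
apply: ereal_sup_ge; exists (hausdorff_premeasure1 1 (seg a b)); last exact: premeasure_ge.
by exists 1 => //=.
Qed.

End Segment.

Section Boxes.
Context {R : realType}.
Implicit Types (q : box R) (s : side).

Lemma side_lengthE q s : xmin q <= xmax q -> ymin q <= ymax q ->
  side_length q s = match s with
    | LeftSide | RightSide => ymax q - ymin q
    | LowerSide | UpperSide => xmax q - xmin q
    end.
Proof.
move=> hx hy; rewrite /side_length.
have vE (u : R) : [set x : R * R | x.1 = u /\ ymin q <= x.2 <= ymax q] =
    (fun t => (u, t)) @` `[ymin q, ymax q]%classic.
  apply/seteqP; split=> [[x1 x2] /= [-> h]|_ [t + <-]]; last by rewrite /= in_itv.
  by exists x2; rewrite //= in_itv.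
have hE (u : R) : [set x : R * R | x.2 = u /\ xmin q <= x.1 <= xmax q] =
    (fun t => (t, u)) @` `[xmin q, xmax q]%classic.
  apply/seteqP; split=> [[x1 x2] /= [-> h]|_ [t + <-]]; last by rewrite /= in_itv.
  by exists x1; rewrite //= in_itv.
have lv (u : R) : hausdorff_measure1 ((fun t => (u, t)) @` `[ymin q, ymax q]%classic) =
    (ymax q - ymin q)%:E.
  apply: (@hausdorff_measure1_segment _ _ snd) => // [s' t|x y]; last exact: (snd_le_enorm (x - y)).
  by rewrite /enorm/= subrr expr0n add0r sqrtr_sqr.
have lh (u : R) : hausdorff_measure1 ((fun t => (t, u)) @` `[xmin q, xmax q]%classic) =
    (xmax q - xmin q)%:E.
  apply: (@hausdorff_measure1_segment _ _ fst) => // [s' t|x y]; last exact: (fst_le_enorm (x - y)).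
  by rewrite /enorm/= subrr expr0n addr0 sqrtr_sqr.
by case: s => /=; rewrite ?vE ?hE ?lv ?lh.
Qed.

Definition box_of (p : side -> R) : box R :=
  Box (p LeftSide) (- p RightSide) (p LowerSide) (- p UpperSide).

Lemma inward_position_box_of p s : inward_position (box_of p) s = p s.
Proof. by case: s => /=; rewrite ?opprK. Qed.

Definition opposite s := match s with
  | LeftSide => RightSide | RightSide => LeftSide
  | LowerSide => UpperSide | UpperSide => LowerSide end.

Definition adjacent s := match s with
  | LeftSide => LowerSide | RightSide => UpperSide
  | LowerSide => LeftSide | UpperSide => RightSide end.

Definition box_length (p : side -> R) s : R :=
  - (p (adjacent s) + p (opposite (adjacent s))).

Lemma side_length_box_of p s : (forall s, 0 <= box_length p s) ->
  side_length (box_of p) s = box_length p s.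
Proof.
move=> h; rewrite side_lengthE; first by case: s; rewrite /box_length/=; ring.
  by have := h LowerSide; rewrite /box_length/=; lra.
by have := h LeftSide; rewrite /box_length/=; lra.
Qed.

Lemma box_of_inward_position q : box_of (inward_position q) = q.
Proof. by case: q => a b u v; rewrite /box_of /= !opprK. Qed.

Definition box_interior q : set (R * R) :=
  [set x | xmin q < x.1 < xmax q /\ ymin q < x.2 < ymax q].
Definition box_closure q : set (R * R) :=
  [set x | xmin q <= x.1 <= xmax q /\ ymin q <= x.2 <= ymax q].

(** A rectangle is only known to contain its open box, so the nearby point has to lie strictly
    inside; this costs the factor 2. Passing from the coordinates to the Euclidean norm costs
    another, whence the 4 in [hausdorff_dist_le]. *)
Let near_itv (a b a' b' e x : R) : 0 < e -> a <= x <= b -> a' < b' ->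
  `|a - a'| <= e -> `|b - b'| <= e -> exists2 y, a' < y < b' & `|x - y| <= 2 * e.
Proof.
move=> e0 /andP[ax xb] ab'; rewrite !ler_norml => /andP[h1 h2] /andP[h3 h4].
pose u := Num.min e ((b' - a') / 2).
have u0 : 0 < u by rewrite /u lt_min e0/= divr_gt0// subr_gt0.
have [u1 u2] : u <= e /\ u <= (b' - a') / 2 by rewrite /u !ge_min !lexx orbT.
have [xa|xa] := leP x a'.
  by exists (a' + u); [apply/andP; split; lra|rewrite ler_norml; apply/andP; split; lra].
have [xb'|xb'] := leP b' x.
  by exists (b' - u); [apply/andP; split; lra|rewrite ler_norml; apply/andP; split; lra].
by exists x; [rewrite xa xb'|rewrite subrr normr0; lra].
Qed.

Let sup_dist_le q q' A A' e : 0 < e -> rectangle_with_box q A -> rectangle_with_box q' A' ->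
  (forall s, `|inward_position q s - inward_position q' s| <= e) ->
  (ereal_sup [set point_dist x A' | x in A] <= (4 * e)%:E)%E.
Proof.
move=> e0 [hx hy _ Aq] [hx' hy' qA' _] h; apply: ge_ereal_sup => _ [x Ax <-].
have [x1 x2] := Aq _ Ax.
have hR : `|xmax q - xmax q'| <= e by have := h RightSide; rewrite /= -opprD normrN.
have hU : `|ymax q - ymax q'| <= e by have := h UpperSide; rewrite /= -opprD normrN.
have [y1 y1q y1x] := near_itv e0 x1 hx' (h LeftSide) hR.
have [y2 y2q y2x] := near_itv e0 x2 hy' (h LowerSide) hU.
apply: (@le_trans _ _ (enorm (x - (y1, y2)))%:E).
  by apply: ereal_inf_lbound; exists (y1, y2) => //; apply: qA'.
by rewrite lee_fin (_ : 4 * e = 2 * (2 * e)); [exact: enorm_le|ring].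
Qed.

Lemma hausdorff_dist_le q q' A A' e : 0 < e -> rectangle_with_box q A -> rectangle_with_box q' A' ->
  (forall s, `|inward_position q s - inward_position q' s| <= e) ->
  (hausdorff_dist A A' <= (4 * e)%:E)%E.
Proof.
move=> e0 qA qA' h; rewrite /hausdorff_dist !ge_max lee_fin mulr_ge0 ?(ltW e0)//=.
rewrite (sup_dist_le e0 qA qA' h)/=; apply: (sup_dist_le e0 qA' qA) => s.
by rewrite distrC.
Qed.

Let close_itv q q' A A' e : rectangle_with_box q A -> rectangle_with_box q' A' ->
  (hausdorff_dist A A' < e%:E)%E ->
  forall x, box_interior q x -> exists2 y, box_closure q' y & enorm (x - y) < e.
Proof.
move=> [_ _ qA _] [_ _ _ A'q]; rewrite /hausdorff_dist !gt_max => /andP[_ /andP[+ _]] x xq.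
move=> /(le_lt_trans (ereal_sup_ubound (ex_intro2 _ _ _ (qA _ xq) erefl))).
by move=> /ereal_inf_lt[_ [y A'y <-]]; rewrite lte_fin => xy; exists y => //; exact: A'q.
Qed.

Let itv_close (a b a' b' e : R) : a < b -> (forall x, a < x < b -> a' - e <= x <= b' + e) ->
  a' - e <= a /\ b <= b' + e.
Proof.
move=> ab h; split; rewrite leNgt; apply/negP => lt.
  pose x := Num.min ((a + b) / 2) ((a + (a' - e)) / 2).
  have [x1 x2] : x <= (a + b) / 2 /\ x <= (a + (a' - e)) / 2 by rewrite /x !ge_min !lexx orbT.
  have x0 : a < x by rewrite /x lt_min; apply/andP; split; lra.
  by have /andP[] := h x ltac:(by apply/andP; split; lra); lra.
pose x := Num.max ((a + b) / 2) ((b + (b' + e)) / 2).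
have [x1 x2] : (a + b) / 2 <= x /\ (b + (b' + e)) / 2 <= x by rewrite /x !le_max !lexx orbT.
have x0 : x < b by rewrite /x gt_max; apply/andP; split; lra.
by have /andP[] := h x ltac:(by apply/andP; split; lra); lra.
Qed.

Let coords_close q q' A A' e : rectangle_with_box q A -> rectangle_with_box q' A' ->
  (hausdorff_dist A A' < e%:E)%E ->
  forall s, inward_position q' s - inward_position q s <= e.
Proof.
move=> qA qA' h; have cl := close_itv qA qA' h; have [hx hy _ _] := qA.
have [X1 X2] : xmin q' - e <= xmin q /\ xmax q <= xmax q' + e.
  apply: itv_close => // x xq.
  have [y [/andP[y1 y2] _] xy] := cl (x, (ymin q + ymax q) / 2)
     ltac:(by split=> //=; apply/andP; split; lra).
  have := le_lt_trans (fst_le_enorm _) xy; rewrite /= ltr_norml => /andP[? ?].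
  by apply/andP; split; lra.
have [Y1 Y2] : ymin q' - e <= ymin q /\ ymax q <= ymax q' + e.
  apply: itv_close => // x xq.
  have [y [_ /andP[y1 y2]] xy] := cl ((xmin q + xmax q) / 2, x)
     ltac:(by split=> //=; apply/andP; split; lra).
  have := le_lt_trans (snd_le_enorm _) xy; rewrite /= ltr_norml => /andP[? ?].
  by apply/andP; split; lra.
by case=> /=; lra.
Qed.

Lemma hausdorff_distC A A' : @hausdorff_dist R A A' = hausdorff_dist A' A.
Proof. by rewrite /hausdorff_dist [X in maxe _ X]maxC. Qed.

Lemma inward_position_close q q' A A' e : rectangle_with_box q A -> rectangle_with_box q' A' ->
  (hausdorff_dist A A' < e%:E)%E ->
  forall s, `|inward_position q s - inward_position q' s| <= e.
Proof.
move=> qA qA' h s; rewrite ler_norml; have := coords_close qA qA' h s.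
rewrite hausdorff_distC in h; have := coords_close qA' qA h s.
by move=> ? ?; apply/andP; split; lra.
Qed.

Variable eps : R.
Hypothesis eps_gt0 : 0 < eps.

(** Cells are centred at lattice points, so sides lie half a cell off the lattice. The shifts of
    opposite sides cancel in [box_length]. *)
Definition half_shift s : R := match s with
  | LeftSide | LowerSide => eps / 2 | RightSide | UpperSide => - (eps / 2) end.

Definition grid_position (ib : side -> int) s : R := eps * (ib s)%:~R + half_shift s.

Lemma box_length_grid ib s : box_length (grid_position ib) s = eps * (glength ib s)%:~R.
Proof.
by case: s; rewrite /box_length /grid_position /glength /gwidth /gheight/=
  !(rmorphN, rmorphD)/=; ring.
Qed.

Lemma rectangle_gbox ib : (forall s, 0 < glength ib s) ->
  rectangle_with_box (box_of (grid_position ib)) (gcells eps (gbox ib)).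
Proof.
move=> ib0.
have pos s : 0 < box_length (grid_position ib) s by rewrite box_length_grid mulr_gt0// ltr0z.
have aux (u : R) k (z : int) : idx eps u = k ->
  [/\ eps * z%:~R + eps / 2 < u -> (z + 1 <= k)%R, (z + 1 <= k)%R -> eps * z%:~R + eps / 2 <= u,
    u < eps * z%:~R + eps / 2 -> (k <= z)%R & (k <= z)%R -> u <= eps * z%:~R + eps / 2].
  move=> /(idxP eps_gt0 _ _)/andP[h1 h2]; split.
  - move=> h; have : z%:~R < k%:~R :> R by rewrite -(ltr_pM2l eps_gt0); lra.
    by rewrite ltr_int; lia.
  - by rewrite -(ler_int R) rmorphD/= -(ler_pM2l eps_gt0) => h; lra.
  - move=> h; have : k%:~R < (z + 1)%:~R :> R by rewrite rmorphD/= -(ltr_pM2l eps_gt0); lra.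
    by rewrite ltr_int; lia.
  - by rewrite -(ler_int R) -(ler_pM2l eps_gt0) => h; lra.
split; rewrite /=.
- by have := pos LowerSide; rewrite /box_length/=; lra.
- by have := pos LeftSide; rewrite /box_length/=; lra.
- move=> x /= [/andP[h1 h2] /andP[h3 h4]]; rewrite /gcells/= /gbox /grect.
  have [a1 _ _ _] := aux x.1 _ (ib LeftSide) erefl.
  have [_ _ a2 _] := aux x.1 _ (- ib RightSide) erefl.
  have [a3 _ _ _] := aux x.2 _ (ib LowerSide) erefl.
  have [_ _ a4 _] := aux x.2 _ (- ib UpperSide) erefl.
  move: h1 h2 h3 h4; rewrite /grid_position/= !opprD !opprK -!mulrN -!rmorphN.
  by move=> /a1 + /a2 + /a3 + /a4; clear; lia.
- move=> x; rewrite /gcells/= /gbox /grect.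
  have [_ a1 _ _] := aux x.1 _ (ib LeftSide) erefl.
  have [_ _ _ a2] := aux x.1 _ (- ib RightSide) erefl.
  have [_ a3 _ _] := aux x.2 _ (ib LowerSide) erefl.
  have [_ _ _ a4] := aux x.2 _ (- ib UpperSide) erefl.
  move=> /andP[/andP[h1 h2] /andP[h3 h4]].
  rewrite /grid_position/= !opprD !opprK -!mulrN -!rmorphN a1// a2 ?a3// ?a4//; lia.
Qed.

(** A cell of [A] lies in the closed box; conversely a cell in the closed box has its centre in the
    open box and so belongs to [A]. The integers of [ib] describe exactly the cells contained in the
    closed box. *)
Lemma lattice_rectangleP q A : lattice_set eps A -> rectangle_with_box q A ->
  exists2 ib, A = gcells eps (gbox ib) & forall s, 0 < glength ib s.
Proof.
move=> /(lattice_setP eps_gt0) AE [hx hy qA Aq].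
have latA k j x : A (lat eps k j) -> idx eps x.1 = k -> idx eps x.2 = j -> A x.
  by rewrite [in X in _ -> X]AE /gcells/= => Akj -> ->; apply/asboolP.
pose l := Num.ceil (xmin q / eps + 2^-1); pose r := Num.floor (xmax q / eps - 2^-1).
pose b := Num.ceil (ymin q / eps + 2^-1); pose t := Num.floor (ymax q / eps - 2^-1).
have lP (u : R) (k : int) : (Num.ceil (u / eps + 2^-1) <= k) = (u <= eps * k%:~R - eps / 2).
  rewrite ceil_le_int -lerBrDr ler_pdivrMr// mulrBl mulrC; congr (_ <= _ - _).
  by rewrite mulrC.
have rP (u : R) (k : int) : (k <= Num.floor (u / eps - 2^-1)) = (eps * k%:~R + eps / 2 <= u).
  rewrite floor_ge_int lerBrDr ler_pdivlMr// mulrDl mulrC; congr (_ + _ <= _).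
  by rewrite mulrC.
pose ib s := match s with LeftSide => l - 1 | RightSide => - r
  | LowerSide => b - 1 | UpperSide => - t end.
have gE k j : gbox ib k j = [&& xmin q <= eps * k%:~R - eps / 2, eps * k%:~R + eps / 2 <= xmax q,
    ymin q <= eps * j%:~R - eps / 2 & eps * j%:~R + eps / 2 <= ymax q].
  rewrite -!lP -!rP -/l -/r -/b -/t /gbox /grect/=; clear; lia.
have AgE : A = gcells eps (gbox ib).
  rewrite AE; congr gcells; apply/funext => k; apply/funext => j; rewrite gE.
  apply/asboolP/idP => [Akj|/and4P[h1 h2 h3 h4]]; last first.
    by apply: qA; split; apply/andP; split; rewrite /=; move: eps_gt0; lra.
  have inA (u v : R) : eps * k%:~R - eps / 2 <= u < eps * k%:~R + eps / 2 ->
      eps * j%:~R - eps / 2 <= v < eps * j%:~R + eps / 2 -> A (u, v).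
    by move=> hu hv; apply: latA Akj _ _; apply/(idxP eps_gt0).
  have hk : eps * k%:~R - eps / 2 <= eps * k%:~R < eps * k%:~R + eps / 2.
    by apply/andP; split; move: eps_gt0; lra.
  have hj : eps * j%:~R - eps / 2 <= eps * j%:~R < eps * j%:~R + eps / 2.
    by apply/andP; split; move: eps_gt0; lra.
  have lo (w : R) : w - eps / 2 <= w - eps / 2 < w + eps / 2.
    by rewrite lexx/=; move: eps_gt0; lra.
  have sup_le (f w : R) : (forall u, f - eps / 2 <= u < f + eps / 2 -> u <= w) -> f + eps / 2 <= w.
    move=> h; apply/ler_addgt0Pl => e e0; have := h (f + eps / 2 - Num.min e eps).
    have m0 : 0 < Num.min e eps by rewrite lt_min e0 eps_gt0.
    have [m1 m2] : Num.min e eps <= e /\ Num.min e eps <= eps by rewrite !ge_min !lexx orbT.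
    by move=> /(_ ltac:(by apply/andP; split; lra)); lra.
  apply/and4P; split.
  - by have [/andP[] /=] := Aq _ (inA _ _ (lo _) hj).
  - by apply: sup_le => u hu; have [/andP[] /=] := Aq _ (inA _ _ hu hj).
  - by have [_ /andP[] /=] := Aq _ (inA _ _ hk (lo _)).
  - by apply: sup_le => u hu; have [_ /andP[] /=] := Aq _ (inA _ _ hk hu).
exists ib => //.
have : A ((xmin q + xmax q) / 2, (ymin q + ymax q) / 2).
  by apply: qA; split; apply/andP; split; rewrite /=; lra.
rewrite AgE /gcells/= /gbox /grect.
move=> h s; move: h; rewrite /glength /gwidth /gheight; case: s; lia.
Qed.

End Boxes.

(** * The limit flow *)

Section UltraLimit.
Context {R : realType}.
Variable U : set_system nat.
Hypothesis FU : UltraFilter U.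

Definition is_ulim (u : nat -> R) (x : R) := forall e, 0 < e -> U [set j | `|u j - x| <= e].

Let FFU : Filter U. Proof. exact: (@filter_filter _ _ (@ultra_proper _ _ FU)). Qed.

Lemma ultra_nonempty P : U P -> exists j, P j.
Proof. exact: (@filter_ex _ _ (@ultra_proper _ _ FU)). Qed.

(** The limit is the supremum of the [y] with [y <= u j] for almost all [j]; above it the
    ultrafilter contains the complementary set. *)
Lemma is_ulim_exists (u : nat -> R) D : U [set j | `|u j| <= D] -> exists x, is_ulim u x.
Proof.
move=> hD; pose S := [set y | U [set j | y <= u j]].
have S0 : S (- D) by apply: filterS hD => j /=; rewrite ler_norml => /andP[].
have SD : ubound S D.
  move=> y Sy; have [j [/= h1 h2]] := ultra_nonempty (filterI hD Sy).
  by apply: le_trans h2 (le_trans (ler_norm _) h1).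
have hS : has_sup S by split; [exists (- D)|exists D].
exists (sup S) => e e0.
have [y Sy ye] := sup_adherent e0 hS.
have [Sx|] := in_ultra_setVsetC [set j | sup S + e <= u j] FU.
  by have := ub_le_sup hS.2 Sx; rewrite gerDl leNgt e0.
apply: filterS2 Sy => j /= h1 /negP; rewrite -ltNge => h2.
by rewrite ler_norml; apply/andP; split; lra.
Qed.

Lemma is_ulim_le (u w : nat -> R) x y : is_ulim u x -> is_ulim w y ->
  (forall e, 0 < e -> U [set j | u j <= w j + e]) -> x <= y.
Proof.
move=> hu hw h; apply/ler_addgt0Pl => e e0.
have e3 : 0 < e / 3 by rewrite divr_gt0.
have [j [[/= h1 h2] h3]] := ultra_nonempty (filterI (filterI (hu _ e3) (hw _ e3)) (h _ e3)).
by move: h1 h2; rewrite !ler_norml => /andP[a1 a2] /andP[b1 b2]; move: h3 => /=; lra.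
Qed.

Lemma is_ulim_cst x : is_ulim (fun=> x) x.
Proof. by move=> e e0; apply: filterE => j /=; rewrite subrr normr0 ltW. Qed.

Lemma is_ulimD u w x y : is_ulim u x -> is_ulim w y -> is_ulim (fun j => u j + w j) (x + y).
Proof.
move=> hu hw e e0; have e2 : 0 < e / 2 by rewrite divr_gt0.
apply: filterS2 (hu _ e2) (hw _ e2) => j /= h1 h2.
rewrite opprD addrACA [e]splitr (le_trans (ler_normD _ _))//; exact: lerD.
Qed.

Lemma is_ulimN u x : is_ulim u x -> is_ulim (fun j => - u j) (- x).
Proof. by move=> hu e e0; apply: filterS (hu _ e0) => j /=; rewrite -opprD normrN. Qed.

Lemma is_ulim_gt u x y : is_ulim u x -> y < x -> U [set j | y <= u j].
Proof.
move=> hu yx; have e0 : 0 < x - y by rewrite subr_gt0.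
by apply: filterS (hu _ e0) => j /=; rewrite ler_norml => /andP[h _]; lra.
Qed.

Lemma is_ulim_lt u x y : is_ulim u x -> x < y -> U [set j | u j <= y].
Proof.
move=> hu xy; have e0 : 0 < y - x by rewrite subr_gt0.
by apply: filterS (hu _ e0) => j /=; rewrite ler_norml => /andP[_ h]; lra.
Qed.

Lemma is_ulim_unique u x y : is_ulim u x -> is_ulim u y -> x = y.
Proof.
move=> hx hy; apply/eqP; rewrite eq_le; apply/andP; split.
  by apply: is_ulim_le hx hy _ => e e0; apply: filterE => j /=; rewrite lerDl ltW.
by apply: is_ulim_le hy hx _ => e e0; apply: filterE => j /=; rewrite lerDl ltW.
Qed.

End UltraLimit.

Lemma glengthE ib s : glength ib s = - (ib (adjacent s) + ib (opposite (adjacent s))).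
Proof. by case: s; rewrite /glength /gwidth /gheight //= addrC. Qed.

Lemma gbox_inj ib ib' : (forall s, 0 < glength ib s) -> (forall s, 0 < glength ib' s) ->
  gbox ib = gbox ib' -> ib = ib'.
Proof.
have le : forall ib ib', (forall s, 0 < glength ib s) -> gbox ib = gbox ib' ->
    forall s, ib' s <= ib s.
  move=> {}ib {}ib' h e s.
  have := h LeftSide; have := h LowerSide; rewrite /glength /gwidth /gheight => w1 w2.
  have := congr1 (fun A : gset => A (ib LeftSide + 1) (ib LowerSide + 1)) e.
  have := congr1 (fun A : gset => A (- ib RightSide) (- ib UpperSide)) e.
  by rewrite /gbox /grect; move: w1 w2; case: s; clear; lia.
by move=> h h' e; apply/funext => s; apply/eqP; rewrite eq_le !le.
Qed.

(** * Convergence of discrete flows and the properties of the limit *)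

Section DiscreteFlow.
Context {R : realType}.
Variables (gamma C : R) (m : nat) (c : R * R -> R) (a : side -> int -> R).
Hypotheses (gamma_gt0 : 0 < gamma) (m_gt0 : (0 < m)%N).
Hypothesis a_per : forall s k, a s (k + m%:Z) = a s k.
Hypotheses (a_le : forall s k, `|a s k| <= C) (C_le : 4 * C <= gamma^-1).

Hypothesis one_step : forall delta D eta : R, 0 < delta -> 0 < D -> 0 < eta ->
  exists (K : nat) (eps0 : R), 0 < eps0 /\
  forall eps ib E, 0 < eps < eps0 ->
    (forall s, eps * `|(ib s)%:~R| <= D) ->
    (forall s, delta <= eps * (glength ib s)%:~R) ->
    minimizes gamma c eps E (gcells eps (gbox ib)) ->
    exists N : side -> nat, let ib' := fun s => ib s + (N s)%:Z in
      [/\ forall s, (N s <= K)%N, E = gcells eps (gbox ib') &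
      forall s, near_minimal gamma eta (eps * (glength ib' s)%:~R) (a s) (ib s) (N s)].

Variables (eps : nat -> R) (Ak : nat -> nat -> set (R * R)) (p0 : side -> R).
Hypothesis eps_gt0 : forall j, 0 < eps j.
Hypothesis Ak_min : forall j k, minimizes gamma c (eps j) (Ak j k.+1) (Ak j k).

Variable U : set_system nat.
Hypothesis FU : UltraFilter U.
Hypothesis eps_small : forall e, 0 < e -> U [set j | eps j < e].

Let FFU : Filter U. Proof. exact: (@filter_filter _ _ (@ultra_proper _ _ FU)). Qed.

Definition is_fbox j k (ib : side -> int) : Prop :=
  Ak j k = gcells (eps j) (gbox ib) /\ forall s, 0 < glength ib s.

(** Unique by [fboxP] whenever step [k] is a rectangle; the default 0 is ruled out wherever
    [is_fbox j k (fbox j k)] is required. *)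
Definition fbox j k : side -> int := xget (fun=> 0) (is_fbox j k).

Lemma fboxP j k ib : is_fbox j k ib -> fbox j k = ib.
Proof.
move=> h; rewrite /fbox; case: xgetP => [ib' _ h'|/(_ ib)//].
apply: gbox_inj; [exact: h'.2|exact: h.2|].
apply/funext => u; apply/funext => v.
have := congr1 (fun E => E (lat (eps j) u v)) (etrans (esym h'.1) h.1).
by rewrite /= !gcells_lat// => e; apply/idP/idP; rewrite e.
Qed.

Definition flength j k s : R := eps j * (glength (fbox j k) s)%:~R.

Definition alive j delta k : Prop :=
  is_fbox j k (fbox j k) /\ forall s, delta <= flength j k s.

Definition alive_upto j delta n : Prop := forall k, (k <= n)%N -> alive j delta k.

Definition good_step j K eta k : Prop :=
  is_fbox j k.+1 (fbox j k.+1) /\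
  forall s, exists2 N, (N <= K)%N & fbox j k.+1 s = fbox j k s + N%:Z /\
    near_minimal gamma eta (flength j k.+1 s) (a s) (fbox j k s) N.

Hypothesis start : U [set j | is_fbox j 0 (fbox j 0)].
Hypothesis start_cvg : forall s, is_ulim U (fun j => eps j * (fbox j 0 s)%:~R) (p0 s).
Hypothesis p0_gt0 : forall s, 0 < box_length p0 s.

Lemma good_mono j K eta n n' : (forall k, (n <= k < n')%N -> good_step j K eta k) ->
  (n <= n')%N -> forall s, fbox j n s <= fbox j n' s <= fbox j n s + (K * (n' - n))%:Z.
Proof.
move=> h nn' s; have -> : n' = (n + (n' - n))%N by lia.
have : forall i, (i < n' - n)%N -> good_step j K eta (n + i) by move=> i lti; apply: h; lia.
rewrite addKn; elim: (n' - n)%N => [|i IH] hi; first by rewrite addn0 muln0; lia.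
have {}IH := IH ltac:(by move=> i' lt; apply: hi; lia).
have [_ /(_ s) [N NK [e _]]] := hi i (ltnSn _).
rewrite addnS e mulnS; move: IH NK; clear; lia.
Qed.

Lemma flengthE j k s : flength j k s =
  - (eps j * (fbox j k (adjacent s))%:~R + eps j * (fbox j k (opposite (adjacent s)))%:~R).
Proof. by rewrite /flength glengthE rmorphN rmorphD/= mulrN mulrDr. Qed.

Lemma flength_mono j K eta n n' s : (forall k, (n <= k < n')%N -> good_step j K eta k) ->
  (n <= n')%N ->
  flength j n s - 2 * (eps j * (K * (n' - n))%:R) <= flength j n' s <= flength j n s.
Proof.
move=> h nn'; rewrite !flengthE.
have aux s' : eps j * (fbox j n s')%:~R <= eps j * (fbox j n' s')%:~R <=
    eps j * (fbox j n s')%:~R + eps j * (K * (n' - n))%:R.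
  have /andP[h1 h2] := good_mono h nn' s'.
  rewrite -mulrDr !ler_pM2l// ler_int h1/=.
  by rewrite -[X in _ <= _ + X]/((K * (n' - n))%:Z%:~R) -rmorphD ler_int.
have /andP[b1 b2] := aux (adjacent s); have /andP[b3 b4] := aux (opposite (adjacent s)).
by apply/andP; split; lra.
Qed.

Lemma start_bound : exists2 D, 0 < D & U [set j | forall s, eps j * `|(fbox j 0 s)%:~R| <= D].
Proof.
have aux s : U [set j | eps j * `|(fbox j 0 s)%:~R| <= `|p0 s| + 1].
  apply: filterS (start_cvg s ltr01) => j /= h.
  rewrite -[X in X * _]gtr0_norm// -normrM -lerBlDl; exact: le_trans (lerB_dist _ _) h.
exists (\sum_(s <- [:: LeftSide; RightSide; LowerSide; UpperSide]) (`|p0 s| + 1)).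
  by rewrite !big_cons big_nil; have := normr_ge0 (p0 LeftSide);
   have := normr_ge0 (p0 RightSide); have := normr_ge0 (p0 LowerSide);
   have := normr_ge0 (p0 UpperSide); lra.
apply: filterS (filterI (filterI (aux LeftSide) (aux RightSide))
  (filterI (aux LowerSide) (aux UpperSide))) => j /= [[h1 h2] [h3 h4]] s; rewrite !big_cons big_nil.
have := normr_ge0 (p0 LeftSide); have := normr_ge0 (p0 RightSide).
have := normr_ge0 (p0 LowerSide); have := normr_ge0 (p0 UpperSide).
by case: s; lra.
Qed.

(** The constants of [one_step] depend on a bound for the positions, which must therefore not grow
    with the number of steps. The initial bound persists: sides move inward only, and none passes
    the initial position of the opposite side. *)
Lemma alive_good_steps (delta eta : R) : 0 < delta -> 0 < eta -> exists (K : nat) (D : R),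
  U [set j | forall n, alive_upto j delta n ->
      (forall k, (k <= n)%N -> good_step j K eta k) /\
      (forall k s, (k <= n)%N -> eps j * `|(fbox j k s)%:~R| <= D)].
Proof.
move=> delta0 eta0; have [D D0 hD] := start_bound.
have [K [eps0 [eps00 st]]] := one_step delta0 D0 eta0.
have K0 : 0 < (2 * K)%:R + 1 :> R by rewrite natr1 ltr0n.
(* A step shortens a length by at most 2 K cells, so eps (2 K + 1) < delta keeps all lengths
   positive. *)
have e1 : 0 < Num.min eps0 (delta / ((2 * K)%:R + 1)) by rewrite lt_min eps00 divr_gt0.
exists K, D; apply: filterS2 hD (eps_small e1) => j /= hj.
rewrite lt_min => /andP[je0]; rewrite ltr_pdivlMr// => jd n al.
have stepk k : (k <= n)%N -> (forall s, eps j * `|(fbox j k s)%:~R| <= D) -> good_step j K eta k.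
  move=> kn hk; have [[AkE len0] lend] := al k kn.
  have := Ak_min j k; rewrite AkE => /(st _ _ _ _ hk lend).
  move=> /(_ ltac:(by rewrite eps_gt0 je0)) [N [NK E nm]].
  have len' s : 0 < glength (fun s => fbox j k s + (N s)%:Z) s.
    have h : delta <= flength j k s := lend s.
    have : (2 * K)%:R < (glength (fbox j k) s)%:~R :> R.
      rewrite -(ltr_pM2l (eps_gt0 j)); apply: lt_le_trans h.
      by apply: lt_trans jd; rewrite ltr_pM2l// ltrDl.
    rewrite -[X in X < _]/((2 * K)%:Z%:~R) ltr_int !glengthE.
    by have := NK (adjacent s); have := NK (opposite (adjacent s)); clear; lia.
  have fE : fbox j k.+1 = (fun s => fbox j k s + (N s)%:Z) by apply: fboxP; split.
  split; first by rewrite fE; split.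
  by move=> s; exists (N s) => //; rewrite /flength fE.
suff main k : (k <= n)%N -> (forall i, (i < k)%N -> good_step j K eta i) /\
    (forall s, eps j * `|(fbox j k s)%:~R| <= D).
  by split=> k; [move=> kn; apply: stepk (main k kn).2|move=> s kn; exact: (main k kn).2].
elim: k => [|k IH] kn; first by split.
have [gk bk] := IH (ltnW kn).
have gk1 i : (i < k.+1)%N -> good_step j K eta i.
  by rewrite ltnS leq_eqVlt => /predU1P[->|/gk //]; apply: stepk bk; exact: ltnW.
split=> // s; have [[_ len0] _] := al _ kn.
have mono s' : fbox j 0 s' <= fbox j k.+1 s'.
  by have /andP[] := @good_mono j K eta 0 k.+1 (fun i h => gk1 i h) (leq0n _) s'.
have lo s' : - D <= eps j * (fbox j 0 s')%:~R.
  have := hj s'; rewrite -[X in X * _ <= _]gtr0_norm// -normrM ler_norml => /andP[] //.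
rewrite -[X in X * _]gtr0_norm// -normrM ler_norml; apply/andP; split.
  by apply: le_trans (lo s) _; rewrite ler_pM2l// ler_int.
have : fbox j k.+1 s <= - fbox j 0 (opposite s).
  have := mono (opposite s); have := len0 LeftSide; have := len0 LowerSide.
  by rewrite /glength /gwidth /gheight; case: s; rewrite /opposite; clear; lia.
rewrite -(ler_int R) -(ler_pM2l (eps_gt0 j)) rmorphN mulrN => h.
by apply: le_trans h _; have := lo (opposite s); rewrite lerNl.
Qed.

(** In [i] steps a length decreases by at most 2 K i eps, which stays below delta / 2 as long as i
    eps <= h. The step following the last alive one is still good, which drives the induction. *)
Lemma alive_extend (delta : R) : 0 < delta -> exists2 h, 0 < h &
  U [set j | forall n i, alive_upto j delta n -> i%:R * eps j <= h ->
     alive_upto j (delta / 2) (n + i)].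
Proof.
move=> delta0; have d20 : 0 < delta / 2 by rewrite divr_gt0.
have [K [D hj]] := alive_good_steps d20 ltr01.
exists (delta / (4 * (K%:R + 1))); first by rewrite divr_gt0// mulr_gt0// natr1 ltr0n.
apply: filterS hj => j /= hj n i al; elim: i => [|i IH] hi.
  by rewrite addn0 => k /al [? h]; split=> // s; apply: le_trans (h s); lra.
have e0 := eps_gt0 j.
have {}IH := IH ltac:(by apply: le_trans hi; rewrite ler_pM2r// ler_nat).
have [gs _] := hj _ IH.
move=> k; rewrite addnS leq_eqVlt => /predU1P[->|]; last by rewrite ltnS => /IH.
have [fb _] := gs _ (leqnn _); split=> // s.
have /andP[h _] := @flength_mono j K 1 n (n + i).+1 s
  (fun k h => gs k ltac:(lia)) ltac:(lia).
have := (al n (leqnn _)).2 s; move: h; rewrite -addnS addKn => h1 h2.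
move: hi; rewrite ler_pdivlMr ?mulr_gt0 ?natr1 ?ltr0n// -natr1 => hi.
have : 0 <= i.+1%:R * eps j by rewrite mulr_ge0// ltW.
by move: h1; rewrite natrM -[i.+1%:R]natr1 => h1 h3; lra.
Qed.

Definition stepno j (t : R) : nat := Num.truncn (t / (gamma * eps j)).

Lemma stepno_ge j t : 0 <= t -> (stepno j t)%:R * eps j <= t / gamma.
Proof.
move=> t0; rewrite -ler_pdivlMr// -mulrA -invfM /stepno.
by rewrite Num.Theory.truncn_le divr_ge0// mulr_ge0// ltW.
Qed.

Lemma stepno_lt j t : 0 <= t -> t / gamma < (stepno j t).+1%:R * eps j.
Proof. by move=> t0; rewrite -ltr_pdivrMr// -mulrA -invfM /stepno truncnS_gt. Qed.

Lemma stepno_mono j t t' : t <= t' -> (stepno j t <= stepno j t')%N.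
Proof.
move=> tt'; apply: Num.Theory.le_truncn.
by rewrite ler_pM2r// invr_gt0 mulr_gt0.
Qed.

Lemma stepno_sub j t t' : 0 <= t -> t <= t' ->
  `|(stepno j t' - stepno j t)%:R * eps j - (t' - t) / gamma| <= eps j.
Proof.
move=> t0 tt'; have t'0 := le_trans t0 tt'.
have := stepno_ge j t0; have := stepno_lt j t0; have := stepno_ge j t'0; have := stepno_lt j t'0.
rewrite natrB ?stepno_mono// !mulrBl -!natr1 !mulrDl !mul1r => h1 h2 h3 h4.
by rewrite ler_norml; apply/andP; split; lra.
Qed.

Definition surv (delta t : R) : Prop := U [set j | alive_upto j delta (stepno j t)].

Lemma surv_le delta t t' : t <= t' -> surv delta t' -> surv delta t.
Proof.
move=> tt'; apply: filterS => j /= h k kt; apply: h; apply: leq_trans kt _.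
exact: stepno_mono.
Qed.

(** The gain [h] depends on [delta] but not on [t]; this uniformity is what [lifespan_extinction]
    rests on. *)
Lemma surv_extend (delta : R) : 0 < delta -> exists2 h, 0 < h &
  forall t, 0 <= t -> surv delta t -> surv (delta / 2) (t + h).
Proof.
move=> /alive_extend[h h0 hU]; exists (gamma * (h / 2)); first by rewrite !mulr_gt0// divr_gt0.
move=> t t0 st; have h20 : 0 < h / 2 by rewrite divr_gt0.
have tt : t <= t + gamma * (h / 2) by rewrite lerDl mulr_ge0// ltW.
apply: filterS (filterI (filterI hU st) (eps_small h20)) => j /= [[hj al] ej].
have -> : stepno j (t + gamma * (h / 2)) =
   (stepno j t + (stepno j (t + gamma * (h / 2)) - stepno j t))%N.
  by rewrite subnKC// stepno_mono.
apply: hj => //; have := stepno_sub j t0 tt.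
rewrite addrAC subrr add0r [gamma * _]mulrC mulfK ?gt_eqF// ler_norml => /andP[_].
by move: ej; lra.
Qed.

(** The half-cell shifts between these grid positions and the true sides vanish in the limit. *)
Definition pos s t : R := xget 0 (is_ulim U (fun j => eps j * (fbox j (stepno j t) s)%:~R)).

Lemma posP delta t s : 0 < delta -> surv delta t ->
  is_ulim U (fun j => eps j * (fbox j (stepno j t) s)%:~R) (pos s t).
Proof.
move=> delta0 st; have [K [D hj]] := alive_good_steps delta0 ltr01.
have [|x hx] := @is_ulim_exists R U FU (fun j => eps j * (fbox j (stepno j t) s)%:~R) D.
  apply: filterS2 hj st => j /= hj al; have [_ /(_ (stepno j t) s (leqnn _))] := hj _ al.
  by rewrite normrM gtr0_norm.
by rewrite /pos; case: xgetP => [y _ //|/(_ x)].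
Qed.

Lemma stepno0 j : stepno j 0 = 0%N.
Proof. by rewrite /stepno mul0r Num.Theory.truncn0. Qed.

Lemma pos0 s : pos s 0 = p0 s.
Proof.
have h : is_ulim U (fun j => eps j * (fbox j (stepno j 0) s)%:~R) (p0 s).
  by move=> e /(start_cvg s); apply: filterS => j /=; rewrite stepno0.
rewrite /pos; case: xgetP => [y _ hy|/(_ _ h)//].
exact: is_ulim_unique FU _ _ _ hy h.
Qed.

Lemma length_ulim delta t s : 0 < delta -> surv delta t ->
  is_ulim U (fun j => flength j (stepno j t) s) (box_length (pos^~ t) s).
Proof.
move=> delta0 st e e0.
have := is_ulimN FU (is_ulimD FU (posP (adjacent s) delta0 st)
   (posP (opposite (adjacent s)) delta0 st)).
move=> /(_ e e0); apply: filterS => j /=.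
by rewrite -flengthE.
Qed.

Lemma surv_start : exists2 delta, 0 < delta & surv delta 0.
Proof.
pose delta := Num.min (Num.min (box_length p0 LeftSide) (box_length p0 RightSide))
  (Num.min (box_length p0 LowerSide) (box_length p0 UpperSide)) / 2.
have dle s : delta < box_length p0 s.
  rewrite /delta ltr_pdivrMr// mulr_natr; apply: (@le_lt_trans _ _ (box_length p0 s)).
    by case: s; rewrite !ge_min lexx ?orbT.
  by rewrite mulr2n ltrDl.
exists delta; first by rewrite divr_gt0// !lt_min !p0_gt0.
have ev s : U [set j | delta <= flength j 0 s].
  apply: is_ulim_gt FU _ _ _ _ (dle s) => e e0.
  have := is_ulimN FU (is_ulimD FU (start_cvg (adjacent s)) (start_cvg (opposite (adjacent s)))).
  by move=> /(_ e e0); apply: filterS => j /=; rewrite -flengthE.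
apply: filterS (filterI start (filterI (filterI (ev LeftSide) (ev RightSide))
  (filterI (ev LowerSide) (ev UpperSide)))) => j /= [h0 [[h1 h2] [h3 h4]]].
rewrite stepno0 => k; rewrite leqn0 => /eqP ->.
by split=> // -[].
Qed.

(** A side moves by at most [K] cells in each time step [gamma * eps]. *)
Lemma pos_lipschitz delta t1 : 0 < delta -> surv delta t1 -> exists2 kappa, 0 < kappa &
  forall s t t', 0 <= t -> t <= t' -> t' <= t1 -> 0 <= pos s t' - pos s t <= kappa * (t' - t).
Proof.
move=> delta0 st1; have [K [D hj]] := alive_good_steps delta0 ltr01.
exists ((K%:R + 1) / gamma); first by rewrite divr_gt0// natr1 ltr0n.
move=> s t t' t0 tt' t't1.
have st' := surv_le t't1 st1; have st := surv_le tt' st'.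
have p' := posP s delta0 st'; have p := posP s delta0 st.
have mono : U [set j | fbox j (stepno j t) s <= fbox j (stepno j t') s <=
    fbox j (stepno j t) s + (K * (stepno j t' - stepno j t))%:Z].
  apply: filterS2 hj st' => j /= hj al; have [gs _] := hj _ al.
  by apply: good_mono (stepno_mono _ tt') _ => k /andP[_ /ltnW]; exact: gs.
apply/andP; split.
  rewrite subr_ge0; apply: is_ulim_le FU _ _ _ _ p p' _ => e e0.
  apply: filterS mono => j /= /andP[h _].
  by rewrite -[leLHS]addr0 lerD ?(ltW e0)// ler_pM2l// ler_int.
rewrite lerBlDr; have c0 := is_ulim_cst FU ((K%:R + 1) / gamma * (t' - t)).
apply: is_ulim_le FU _ _ _ _ p' (is_ulimD FU c0 p) _ => e e0 /=.
have ek : 0 < e / (K%:R + 1) by rewrite divr_gt0// natr1 ltr0n.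
apply: filterS2 mono (eps_small ek) => j /= /andP[_ h].
rewrite ltr_pdivlMr ?natr1 ?ltr0n// -natr1 => ej.
move: h; rewrite -(ler_int R) rmorphD/= -(ler_pM2l (eps_gt0 j)) mulrDr => h.
apply: le_trans h _; rewrite addrC -[leRHS]addrAC lerD2r.
have := stepno_sub j t0 tt'; rewrite ler_norml => /andP[_ h].
have e1 := eps_gt0 j; have K0 : 0 <= K%:R :> R by [].
rewrite -[_%:~R]/((K * (stepno j t' - stepno j t))%:R) natrM mulrCA [eps j * _]mulrC.
have : 0 <= (t' - t) / gamma by rewrite divr_ge0 ?subr_ge0// ltW.
rewrite mulrAC -mulrA.
move: h ej K0 e1; set A := _ * eps j; set B := (t' - t) / gamma; set k := K%:R => h ej K0 e1 B0.
have := ler_wpM2l K0 (_ : A <= B + eps j); lra.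
Qed.

(** The discrete positions are monotone in time and the limit is Lipschitz, so convergence at the
    finitely many points of a time grid implies uniform convergence. *)
Lemma pos_uniform delta t1 e : 0 < delta -> surv delta t1 -> 0 < e ->
  U [set j | forall t, 0 <= t -> t <= t1 ->
     is_fbox j (stepno j t) (fbox j (stepno j t)) /\
     forall s, `|eps j * (fbox j (stepno j t) s)%:~R - pos s t| <= e].
Proof.
move=> delta0 st1 e0; have [kappa kappa0 lip] := pos_lipschitz delta0 st1.
have [K [D hj]] := alive_good_steps delta0 ltr01.
have e20 : 0 < e / 2 by rewrite divr_gt0.
pose h := e / 2 / kappa; have h0 : 0 < h by rewrite divr_gt0.
pose N := (Num.truncn (t1 / h)).+2.
pose g i := Num.min (i%:R * h) t1.
have g1 i : g i <= t1 by rewrite /g ge_min lexx orbT.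
have ev (i : 'I_N) : U [set j | forall s, `|eps j * (fbox j (stepno j (g i)) s)%:~R - pos s (g i)| <= e / 2].
  have p s := posP s delta0 (surv_le (g1 i) st1) e20.
  apply: filterS (filterI (filterI (p LeftSide) (p RightSide))
    (filterI (p LowerSide) (p UpperSide))) => j /= [[h1 h2] [h3 h4]].
  by case.
apply: filterS (filterI (filter_forall _ ev) (filterI hj st1)) => j /= [grid [{}hj al]] t t0 tt1.
have [gs _] := hj _ al.
split; first by case: (al (stepno j t) (stepno_mono _ tt1)).
move=> s; pose i := Num.truncn (t / h).
have th0 : 0 <= t / h by rewrite divr_ge0// ltW.
have /andP[i1 i2] : i%:R <= t / h < i.+1%:R by exact: Num.Theory.truncn_itv.
have iN : (i.+1 < N)%N by rewrite !ltnS; apply: Num.Theory.le_truncn; rewrite ler_pM2r// invr_gt0.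
have gt : g i <= t by rewrite /g ge_min -ler_pdivlMr// i1.
have tg : t <= g i.+1 by rewrite /g le_min tt1 andbT -ler_pdivrMr// ltW.
have gi0 k : 0 <= g k by rewrite /g le_min mulr_ge0 ?(ltW h0)//= (le_trans t0).
have := grid (Ordinal (ltnW iN)) s; have := grid (Ordinal iN) s; rewrite /= !ler_norml.
move=> /andP[_ b1] /andP[b2 _].
have gd : g i.+1 - g i <= h.
  by rewrite /g -natr1 mulrDl mul1r /Num.min; case: ifP; case: ifP; move: (ltW h0); lra.
have /andP[_ l1] := lip s _ _ (gi0 i) (le_trans gt tg) (g1 _).
have l2 : kappa * (g i.+1 - g i) <= e / 2.
  by rewrite mulrC -ler_pdivlMr.
have /andP[l3 _] := lip s _ _ (gi0 i) gt tt1.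
have /andP[l4 _] := lip s _ _ t0 tg (g1 _).
have mono u u' : u <= u' -> u' <= t1 ->
    eps j * (fbox j (stepno j u) s)%:~R <= eps j * (fbox j (stepno j u') s)%:~R.
  move=> uu' u't1; rewrite ler_pM2l// ler_int.
  have gs' k : (stepno j u <= k < stepno j u')%N -> good_step j K 1 k.
    by case/andP=> _ /ltnW h1; apply: gs; apply: leq_trans h1 _; exact: stepno_mono.
  by have /andP[] := good_mono gs' (stepno_mono j uu') s.
have m1 := mono _ _ gt tt1; have m2 := mono _ _ tg (g1 _).
by apply/andP; split; lra.
Qed.

Lemma length_ge delta t s : 0 < delta -> surv delta t -> delta <= box_length (pos^~ t) s.
Proof.
move=> delta0 st; apply: is_ulim_le FU _ _ _ _ (is_ulim_cst FU delta) (length_ulim s delta0 st) _.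
move=> e e0; apply: filterS st => j /= /(_ _ (leqnn _)) [_ /(_ s)] h.
by apply: le_trans h _; rewrite lerDl ltW.
Qed.

Lemma length_antitone delta t t' s : 0 < delta -> surv delta t' -> 0 <= t -> t <= t' ->
  box_length (pos^~ t') s <= box_length (pos^~ t) s.
Proof.
move=> delta0 st t0 tt'; have [kappa kappa0 lip] := pos_lipschitz delta0 st.
have /andP[h1 _] := lip (adjacent s) _ _ t0 tt' (lexx _).
have /andP[h2 _] := lip (opposite (adjacent s)) _ _ t0 tt' (lexx _).
by rewrite /box_length; lra.
Qed.

Let veff s := effective_velocity gamma m (a s).

(** Lengths decrease in time, so during the whole interval they exceed [L2], already at its end. The
    discrete side therefore stays behind the orbit for [L2], which advances at rate [veff s L2] up
    to a bounded number of cells. *)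
Lemma sandwich_upper delta t h s L2 : 0 < delta -> 0 <= t -> 0 < h -> surv delta (t + h) ->
  0 < L2 -> L2 < box_length (pos^~ (t + h)) s ->
  gamma * (pos s (t + h) - pos s t) <= h * veff s L2.
Proof.
move=> delta0 t0 h0 sth L20 L2l; set l := box_length _ _ in L2l.
have tth : t <= t + h by rewrite lerDl ltW.
pose l' := (L2 + l) / 2; have l'l : l' < l by rewrite /l'; lra.
have l'0 : 0 < l' by rewrite /l'; lra.
(* This [eta] makes (2 + eta) L2 = L2 + l', which is less than 2 l', as [near_minimal_le] demands
   for lengths at least [l']. *)
pose eta := (l' - L2) / L2.
have eta0 : 0 < eta by rewrite divr_gt0// /l'; lra.
have etaE : (2 + eta) * L2 = L2 + l' by rewrite mulrDl /eta mulfVK ?gt_eqF//; ring.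
have [K [D hj]] := alive_good_steps delta0 eta0.
have [B hB] := orbit_deviation gamma_gt0 m_gt0 (a_per s) (a_le s) C_le L20.
have p' := posP s delta0 sth; have p := posP s delta0 (surv_le tth sth).
rewrite -ler_pdivlMl// lerBlDr.
have c0 := is_ulim_cst FU (gamma^-1 * (h * veff s L2)).
apply: is_ulim_le FU _ _ _ _ p' (is_ulimD FU c0 p) _ => e e0 /=.
(* The first term pays for rounding the time to full steps, the second for the deviation of the
   orbit. *)
have B0 : 0 < `|veff s L2| + `|B| + 1 by rewrite ltr_wpDl// addr_ge0.
have ek : 0 < e / (`|veff s L2| + `|B| + 1) by rewrite divr_gt0.
apply: filterS (filterI (filterI hj sth) (filterI (is_ulim_gt FU (length_ulim s delta0 sth) l'l)
  (eps_small ek))) => j /= [[{}hj al] [len]].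
rewrite ltr_pdivlMr// => ej.
have [gs _] := hj _ al.
have kk := stepno_mono j tth.
set k0 := stepno j t in kk *; set k1 := stepno j (t + h) in kk al len gs *.
have cmp n : (k0 + n <= k1)%N ->
    fbox j (k0 + n) s <= step_orbit gamma (a s) L2 (fbox j k0 s) n.
  elim: n => [|n IH] nk; first by rewrite addn0.
  rewrite addnS in nk *; have {}IH := IH (ltnW nk).
  have [_ /(_ s) [N _ [-> nm]]] := gs _ (ltnW nk).
  have lj : l' <= flength j (k0 + n).+1 s.
    have gs' k : ((k0 + n).+1 <= k < k1)%N -> good_step j K eta k.
      by case/andP=> _ /ltnW; exact: gs.
    by apply: le_trans len _; have /andP[] := flength_mono s gs' nk.
  apply: (near_minimal_le gamma_gt0 m_gt0 (a_le s) C_le _ L20 _ IH nm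
    (argmin_stepP gamma_gt0 m_gt0 (a_le s) C_le _ L20)); first exact: lt_le_trans lj.
  by rewrite etaE; move: lj; rewrite /l'; lra.
have := cmp (k1 - k0)%N; rewrite subnKC// => /(_ (leqnn _)) c1.
have := hB (fbox j k0 s) (k1 - k0)%N; rewrite ler_norml rmorphB/= => /andP[_ d1].
have := stepno_sub j t0 tth; rewrite -/k0 -/k1 addrAC subrr add0r => d2.
move: c1; rewrite -(ler_int R) => c1.
have e1 := eps_gt0 j.
have : eps j * ((fbox j k1 s)%:~R - (fbox j k0 s)%:~R) <=
    eps j * ((k1 - k0)%:R * veff s L2 + B).
  by rewrite ler_pM2l//; move: d1; rewrite /veff; lra.
have d3 : (k1 - k0)%:R * eps j * veff s L2 - h / gamma * veff s L2 <= eps j * `|veff s L2|.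
  rewrite -mulrBl (le_trans (ler_norm _))// normrM; exact: ler_wpM2r.
have d4 : eps j * B <= eps j * `|B| by rewrite ler_pM2l// ler_norm.
rewrite mulrBr mulrDr => d5.
have -> : gamma^-1 * (h * veff s L2) = h / gamma * veff s L2 by ring.
by move: d3 d4 d5 ej; rewrite !mulrDr mulrCA mulrA; move: (normr_ge0 (veff s L2)); lra.
Qed.

(** Here the length is largest at the beginning of the interval, so the comparison length [L1] only
    has to exceed the initial one. *)
Lemma sandwich_lower delta t h s L1 : 0 < delta -> 0 <= t -> 0 < h -> surv delta (t + h) ->
  box_length (pos^~ t) s < L1 ->
  h * veff s L1 <= gamma * (pos s (t + h) - pos s t).
Proof.
move=> delta0 t0 h0 sth lL1; have tth : t <= t + h by rewrite lerDl ltW.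
have l0 := lt_le_trans delta0 (length_ge s delta0 (surv_le tth sth)).
set l := box_length _ _ in lL1 l0.
have L10 : 0 < L1 by exact: lt_trans lL1.
pose l' := (L1 + l) / 2; have l'l : l < l' by rewrite /l'; lra.
have l'0 : 0 < l' by rewrite /l'; lra.
pose eta := (L1 - l') / L1.
have eta0 : 0 < eta by rewrite divr_gt0// /l'; lra.
have etaE : (2 - eta) * L1 = L1 + l' by rewrite mulrBl /eta mulfVK ?gt_eqF//; ring.
have [K [D hj]] := alive_good_steps delta0 eta0.
have [B hB] := orbit_deviation gamma_gt0 m_gt0 (a_per s) (a_le s) C_le L10.
have p' := posP s delta0 sth; have p := posP s delta0 (surv_le tth sth).
rewrite -ler_pdivrMl// lerBrDr.
have c0 := is_ulim_cst FU (gamma^-1 * (h * veff s L1)).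
apply: is_ulim_le FU _ _ _ _ (is_ulimD FU c0 p) p' _ => e e0 /=.
have B0 : 0 < `|veff s L1| + `|B| + 1 by rewrite ltr_wpDl// addr_ge0.
have ek : 0 < e / (`|veff s L1| + `|B| + 1) by rewrite divr_gt0.
apply: filterS (filterI (filterI hj sth) (filterI (is_ulim_lt FU (length_ulim s delta0 (surv_le tth sth)) l'l)
  (eps_small ek))) => j /= [[{}hj al] [len]].
rewrite ltr_pdivlMr// => ej.
have [gs _] := hj _ al.
have kk := stepno_mono j tth.
set k0 := stepno j t in kk *; set k1 := stepno j (t + h) in kk al len gs *.
have cmp n : (k0 + n <= k1)%N ->
    step_orbit gamma (a s) L1 (fbox j k0 s) n <= fbox j (k0 + n) s.
  elim: n => [|n IH] nk; first by rewrite addn0.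
  rewrite addnS in nk *; have {}IH := IH (ltnW nk).
  have [_ /(_ s) [N _ [-> nm]]] := gs _ (ltnW nk).
  have lj : flength j (k0 + n).+1 s <= l'.
    have gs' k : (k0 <= k < (k0 + n).+1)%N -> good_step j K eta k.
      by case/andP=> _ h1; apply: gs; exact: leq_trans (ltnW h1) nk.
    apply: le_trans len; have /andP[_] := flength_mono s gs' ltac:(rewrite -addnS; exact: leq_addr).
    by [].
  apply: (near_minimal_ge gamma_gt0 m_gt0 (a_le s) C_le _ L10 _ IH nm
    (argmin_stepP gamma_gt0 m_gt0 (a_le s) C_le _ L10)); last by rewrite etaE; move: lj; rewrite /l'; lra.
  exact: lt_le_trans delta0 ((al _ nk).2 s).
have := cmp (k1 - k0)%N; rewrite subnKC// => /(_ (leqnn _)) c1.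
have := hB (fbox j k0 s) (k1 - k0)%N; rewrite ler_norml rmorphB/= => /andP[d1 _].
have := stepno_sub j t0 tth; rewrite -/k0 -/k1 addrAC subrr add0r => d2.
move: c1; rewrite -(ler_int R) => c1.
have e1 := eps_gt0 j.
have : eps j * ((k1 - k0)%:R * veff s L1 - B) <=
    eps j * ((fbox j k1 s)%:~R - (fbox j k0 s)%:~R).
  by rewrite ler_pM2l//; move: d1; rewrite /veff; lra.
have d3 : h / gamma * veff s L1 - (k1 - k0)%:R * eps j * veff s L1 <= eps j * `|veff s L1|.
  rewrite -mulrBl (le_trans (ler_norm _))// normrM distrC; exact: ler_wpM2r.
have d4 : eps j * B <= eps j * `|B| by rewrite ler_pM2l// ler_norm.
rewrite !mulrBr => d5.
have -> : gamma^-1 * (h * veff s L1) = h / gamma * veff s L1 by ring.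
by move: d3 d4 d5 ej; rewrite !mulrDr mulrCA mulrA; move: (normr_ge0 (veff s L1)); lra.
Qed.

(** The two sandwich estimates are divided by [h], with [h] tending to 0 from above, and passed to
    [velocity_law_sandwich]. *)
Lemma pos_velocity_law delta t t1 s : 0 < delta -> surv delta t1 -> 0 <= t -> t < t1 ->
  derivable (pos s) t 1 ->
  velocity_law gamma m (a s) (box_length (pos^~ t) s) ('D_1 (pos s) t).
Proof.
move=> delta0 st1 t0 tt1 dt; set D := 'D_1 (pos s) t.
have [kappa kappa0 lip] := pos_lipschitz delta0 st1.
have quot e r : 0 < e -> 0 < r -> exists2 h, 0 < h < r & `|D - h^-1 * (pos s (t + h) - pos s t)| <= e.
  move=> e0 r0; have /cvgrPdist_le/(_ e e0)/nbhs_ballP[r' r'0 hr'] := dt.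
  pose h := Num.min r r' / 2.
  have m0 : 0 < Num.min r r' by rewrite lt_min r0.
  have [m1 m2] : Num.min r r' <= r /\ Num.min r r' <= r' by rewrite !ge_min !lexx orbT.
  exists h; first by apply/andP; split; rewrite /h; lra.
  have := hr' h; rewrite /ball/= sub0r normrN gtr0_norm ?divr_gt0//.
  move=> /(_ ltac:(by rewrite /h; lra)); rewrite gt_eqF ?divr_gt0// => /(_ isT).
  by rewrite -[_%:A]/(h * 1) mulr1 [h + t]addrC.
have len t' : t <= t' -> t' <= t1 ->
    box_length (pos^~ t) s - 2 * (kappa * (t' - t)) <= box_length (pos^~ t') s.
  move=> h1 h2; have /andP[_ l1] := lip (adjacent s) _ _ t0 h1 h2.
  have /andP[_ l2] := lip (opposite (adjacent s)) _ _ t0 h1 h2.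
  by rewrite /box_length; lra.
apply: (velocity_law_sandwich gamma_gt0 m_gt0 (a_per s) (a_le s) C_le).
  exact: lt_le_trans delta0 (length_ge s delta0 (surv_le (ltW tt1) st1)).
move=> L1 L2 L20 L2l lL1; apply/andP; split; apply/ler_addgt0Pl => e e0.
  have r0 : 0 < t1 - t by rewrite subr_gt0.
  have eg : 0 < e / gamma by rewrite divr_gt0.
  have [h /andP[h0 hr] hD] := quot _ _ eg r0.
  have sth : surv delta (t + h) by apply: surv_le st1; lra.
  have := sandwich_lower delta0 t0 h0 sth lL1; rewrite -ler_pdivlMl// => h1.
  apply: le_trans h1 _; rewrite mulrCA -lerBlDr  -mulrBr -ler_pdivlMl// [_ * e]mulrC.
  by apply: le_trans hD; rewrite distrC; exact: ler_norm.
(* A length decreases at rate at most 2 kappa, so for h < r it is still above [L2] at time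
   [t + h]. *)
pose r := Num.min (t1 - t) ((box_length (pos^~ t) s - L2) / (2 * kappa)).
have r0 : 0 < r by rewrite lt_min subr_gt0 tt1 divr_gt0 ?mulr_gt0 ?subr_gt0.
have eg : 0 < e / gamma by rewrite divr_gt0.
have [h /andP[h0 hr] hD] := quot _ _ eg r0.
have [hr1 hr2] : h < t1 - t /\ h * (2 * kappa) < box_length (pos^~ t) s - L2.
  by move: hr; rewrite /r lt_min ltr_pdivlMr ?mulr_gt0// => /andP[].
have sth : surv delta (t + h) by apply: surv_le st1; lra.
have L2h : L2 < box_length (pos^~ (t + h)) s.
  have := len (t + h) ltac:(lra) ltac:(lra); rewrite [t + h - t]addrAC subrr add0r.
  by move: hr2; rewrite [h * _]mulrC -mulrA; lra.
have := sandwich_upper delta0 t0 h0 sth L20 L2h; rewrite -ler_pdivrMl// mulrCA => h1.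
rewrite -lerBlDr; apply: le_trans (lerB (lexx _) h1) _.
rewrite -mulrBr -ler_pdivlMl// [_ * e]mulrC.
by apply: le_trans hD; exact: ler_norm.
Qed.

Definition lifespan : \bar R :=
  ereal_sup [set t%:E | t in [set t | 0 <= t /\ exists2 delta, 0 < delta & surv delta t]].

Lemma lifetime_surv t : lifetime lifespan t ->
  exists t1 delta, [/\ t < t1, lifetime lifespan t, 0 < delta & surv delta t1].
Proof.
move=> lt; have [t0 /ereal_sup_gt[_ [t1 [t10 [delta delta0 st]] <-]]] := lt.
by rewrite lte_fin => tt1; exists t1, delta.
Qed.

Lemma surv_lifespan delta t : 0 < delta -> 0 <= t -> surv delta t -> (t%:E < lifespan)%E.
Proof.
move=> delta0 t0 st; have [h h0 /(_ t t0 st) hs] := surv_extend delta0.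
apply: (@lt_le_trans _ _ (t + h)%:E); first by rewrite lte_fin ltrDl.
apply: ereal_sup_ubound; exists (t + h) => //; split; first by rewrite addr_ge0// ltW.
by exists (delta / 2) => //; rewrite divr_gt0.
Qed.

Lemma lifespan_gt0 : (0 < lifespan)%E.
Proof. by have [delta delta0 s0] := surv_start; exact: (surv_lifespan delta0 (lexx 0) s0). Qed.

(** If no length tended to 0, all of them would stay above some [d] up to [T'], and [surv_extend],
    started shortly before [T'] with a gain depending only on [d], would carry the flow beyond
    [T']. *)
Lemma lifespan_extinction T' : lifespan = T'%:E ->
  exists s, box_length (pos^~ t) s @[t --> T'^'-] --> (0 : R).
Proof.
move=> TE; apply: contrapT => no.
have T'0 : 0 < T' by have := lifespan_gt0; rewrite TE.
have lt t : 0 <= t -> t < T' -> exists2 delta, 0 < delta & surv delta t.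
  move=> t0 tT; have [t1 [delta [tt1 _ d0 st1]]] : exists t1 delta,
      [/\ t < t1, lifetime lifespan t, 0 < delta & surv delta t1].
    by apply: lifetime_surv; rewrite /lifetime/= TE lte_fin.
  by exists delta => //; apply: surv_le (ltW tt1) st1.
(* A nonincreasing length that comes below every positive level tends to 0. *)
have lb s : exists2 d, 0 < d & forall t, 0 <= t -> t < T' -> d <= box_length (pos^~ t) s.
  apply: contrapT => h; apply: no; exists s; apply/cvgrPdist_le => e e0.
  have [t [t0 tT te]] : exists t, [/\ 0 <= t, t < T' & box_length (pos^~ t) s < e].
    apply: contrapT => h'; apply: h; exists e => // t t0 tT; rewrite leNgt; apply/negP => te.
    by apply: h'; exists t.
  near=> u; have tu : t <= u by near: u; exact: nbhs_left_ge.
  have uT : u < T' by near: u; exact: nbhs_left_lt.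
  have u0 := le_trans t0 tu; have [delta delta0 su] := lt u u0 uT.
  rewrite sub0r normrN ger0_norm; last exact: le_trans (ltW delta0) (length_ge s delta0 su).
  exact: le_trans (length_antitone s delta0 su t0 tu) (ltW te).
have [dL dL0 hL] := lb LeftSide; have [dR dR0 hR] := lb RightSide.
have [dl dl0 hl] := lb LowerSide; have [du du0 hu] := lb UpperSide.
pose d := Num.min (Num.min dL dR) (Num.min dl du).
have d0 : 0 < d by rewrite !lt_min dL0 dR0 dl0 du0.
have d20 : 0 < d / 2 by rewrite divr_gt0.
have dle s t : 0 <= t -> t < T' -> d <= box_length (pos^~ t) s.
  move=> t0 tT; case: s; [apply: le_trans (hL t t0 tT)|apply: le_trans (hR t t0 tT)
   |apply: le_trans (hl t t0 tT)|apply: le_trans (hu t t0 tT)]; by rewrite !ge_min lexx ?orbT.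
have [h h0 hs] := surv_extend d20.
pose t := Num.max 0 (T' - h / 2).
have t0 : 0 <= t by rewrite le_max lexx.
have tT : t < T' by rewrite gt_max T'0 ltrBlDr ltrDl divr_gt0.
have tT' : T' < t + h.
  have : T' - h / 2 <= t by rewrite le_max lexx orbT.
  by lra.
have [delta delta0 st] := lt t t0 tT.
have ev s : U [set j | d / 2 <= flength j (stepno j t) s].
  apply: is_ulim_gt FU _ _ _ (length_ulim s delta0 st) _.
  by apply: lt_le_trans (dle s t t0 tT); lra.
have [K [D hj]] := alive_good_steps delta0 ltr01.
(* Survival is known with an uncontrolled [delta] only. The limit lengths at time [t] are at least
   [d], so the discrete ones are eventually at least d / 2 there, and at all earlier steps as well
   by monotonicity. *)
have sd : surv (d / 2) t.
  apply: filterS (filterI (filterI hj st) (filterI (filterI (ev LeftSide) (ev RightSide))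
    (filterI (ev LowerSide) (ev UpperSide)))) => j /= [[{}hj al] [[h1 h2] [h3 h4]]] k kt.
  have [fb _] := al k kt; split=> // s; have [gs _] := hj _ al.
  have gs' i : (k <= i < stepno j t)%N -> good_step j K 1 i by case/andP=> _ /ltnW; exact: gs.
  have /andP[_ le] := flength_mono s gs' kt; apply: le_trans le.
  by case: s => //.
have := surv_lifespan (_ : 0 < d / 2 / 2) (addr_ge0 t0 (ltW h0)) (hs t t0 sd).
rewrite TE lte_fin => /(_ ltac:(by rewrite divr_gt0)).
by rewrite ltNge (ltW tT').
Unshelve. all: by end_near. Qed.

Lemma pos_locally_lipschitz s : locally_lipschitz_on (lifetime lifespan) (pos s).
Proof.
move=> t /lifetime_surv[t1 [delta [tt1 [t0 _] delta0 st1]]].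
have [kappa kappa0 lip] := pos_lipschitz delta0 st1.
exists kappa, [set u | u < t1]; split; first exact: (lt_nbhsl tt1).
move=> [x y] /= [[[x0 _] xt] [[y0 _] yt]].
wlog xy : x y x0 xt y0 yt / x <= y.
  by move=> H; have [|/ltW] := leP x y; [|rewrite distrC [X in _ * X]distrC]; apply: H.
rewrite distrC [X in _ * X]distrC; have /andP[h1 h2] := lip s _ _ x0 xy (ltW yt).
by rewrite ger0_norm// ger0_norm ?subr_ge0.
Qed.

Lemma exhausting_times : exists tau : nat -> R,
  (forall n, lifetime lifespan (tau n)) /\
  forall t, lifetime lifespan t -> exists N, forall n, (N <= n)%N -> t < tau n.
Proof.
have := lifespan_gt0; case: lifespan => [r r0| _|//]; last first.
  exists (fun n => n%:R); split=> [n|t _]; first by split; rewrite ?ltry.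
  exists (Num.truncn t).+1 => n nt; apply: lt_le_trans (truncnS_gt t) _.
  by rewrite ler_nat.
have {}r0 : 0 < r by [].
have n0 n : 0 < n.+1%:R :> R by rewrite ltr0n.
exists (fun n => r - r / n.+1%:R); split=> [n|t [t0]].
  split; last by rewrite lte_fin ltrBlDr ltrDl divr_gt0.
  by rewrite subr_ge0 ler_pdivrMr// ler_peMr ?(ltW r0)// ler1n.
rewrite lte_fin -subr_gt0 => tr; exists (Num.truncn (r / (r - t))) => n nt.
have h : r / (r - t) < n.+1%:R by apply: lt_le_trans (truncnS_gt _) _; rewrite ler_nat ltnS.
rewrite ltrBrDl -ltrBrDr ltr_pdivrMr// mulrC -ltr_pdivrMr//.
Qed.

(** [ae_derivable_on] needs monotonicity and the Lipschitz bound on the whole line, whereas [pos] is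
    controlled on the lifetime only; so the time is first clamped to the interval from 0 to [tau n].
    The time 0 is a null set. *)
Lemma pos_ae_derivable s :
  {ae (@lebesgue_measure R), forall t, lifetime lifespan t -> derivable (pos s) t 1}.
Proof.
have Fae : Filter (nbhs (almost_everywhere (@lebesgue_measure R))).
  by apply: ae_filter_ringOfSetsType.
have [tau [tauT tau_lim]] := exhausting_times.
have ae n : {ae (@lebesgue_measure R), forall t, 0 < t < tau n -> derivable (pos s) t 1}.
  have [tau0|tau0] := leP (tau n) 0.
    apply: aeW => t /andP[h1 h2].
    by have := lt_le_trans (lt_trans h1 h2) tau0; rewrite ltxx.
  have [t1 [delta [tt1 _ delta0 st1]]] := lifetime_surv (tauT n).
  have [kappa kappa0 lip] := pos_lipschitz delta0 st1.
  pose cl x := Num.max 0 (Num.min x (tau n)).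
  have cl_nd x y : x <= y -> cl x <= cl y <= cl x + (y - x).
    by move=> xy; rewrite /cl /Num.max /Num.min; do !case: ifP; move=> *; apply/andP; split; lra.
  have cl0 x : 0 <= cl x by rewrite le_max lexx.
  have cl1 x : cl x <= t1 by rewrite ge_max !ge_min !(ltW tt1) orbT andbT (le_trans (ltW tau0) (ltW tt1)).
  have h : {ae (@lebesgue_measure R), forall x, 0 < x < tau n -> derivable (pos s \o cl) x 1}.
    apply: (@ae_derivable_on R (pos s \o cl) kappa) => // x y xy; have /andP[c1 c2] := cl_nd _ _ xy;
      have /andP[l1 l2] := lip s _ _ (cl0 x) c1 (cl1 y); first by rewrite -subr_ge0.
    by apply: le_trans l2 _; rewrite ler_pM2l// lerBlDl.
  apply: filterS h => x hx x0; apply: near_eq_derivable (hx x0).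
  have /andP[x1 x2] := x0; near=> y.
  have y1 : 0 < y by near: y; exact: lt_nbhsr.
  have y2 : y < tau n by near: y; exact: lt_nbhsl.
  by rewrite /= /cl min_l ?max_r// ltW.
have ne0 : {ae (@lebesgue_measure R), forall t : R, t != 0}.
  exists [set 0]; split=> //; first exact: lebesgue_measure_set1.
  by move=> t /= /negP; rewrite negbK => /eqP.
apply: filterS2 (ae_foralln ae) ne0 => t ht t0 lt.
have [N /(_ N (leqnn _)) tN] := tau_lim t lt.
by apply: (ht N); rewrite tN andbT lt_def t0; case: lt.
Unshelve. all: by end_near. Qed.

Lemma flow_limit (A : set (R * R)) (flow : nat -> R -> set (R * R)) :
  (forall N, U [set j | (N <= j)%N]) ->
  rectangle_with_box (box_of p0) A ->
  (forall j t, 0 <= t -> flow j t = Ak j (stepno j t)) ->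
  exists phi : nat -> nat, {homo phi : i j / (i < j)%N} /\
  exists (T : \bar R) (At : R -> set (R * R)) (q : R -> box R) (v : side -> R -> R),
    [/\ extinction_time T q,
        At 0 = A,
        forall t, lifetime T t -> rectangle_with_box (q t) (At t),
        converges_locally_in_time T (fun j => flow (phi j)) At &
        forall s : side,
          locally_lipschitz_on (lifetime T) (fun t => inward_position (q t) s) /\
          {ae (@lebesgue_measure R), forall t, lifetime T t ->
             is_derive t 1 (fun u => inward_position (q u) s) (v s t) /\
             velocity_law gamma m (a s) (side_length (q t) s) (v s t)}].
Proof.
have Fae : Filter (nbhs (almost_everywhere (@lebesgue_measure R))).
  by apply: ae_filter_ringOfSetsType.
move=> Uoo rA flowE; have [tau [tauT tau_lim]] := exhausting_times.
(* Diagonal choice: [close n j] asks for accuracy 1 / (n + 1) up to the time [tau n]. The indices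
   with this property form a set of the ultrafilter, so there is one beyond any given bound. *)
pose close n j := eps j < n.+1%:R^-1 /\ forall t, 0 <= t -> t <= tau n ->
     is_fbox j (stepno j t) (fbox j (stepno j t)) /\
     forall s, `|eps j * (fbox j (stepno j t) s)%:~R - pos s t| <= n.+1%:R^-1.
have n0 n : 0 < n.+1%:R^-1 :> R by rewrite invr_gt0 ltr0n.
have ex (nk : nat * nat) : exists j, (nk.2 < j)%N /\ close nk.1 j.
  have [t1 [delta [tt1 _ delta0 st1]]] := lifetime_surv (tauT nk.1).
  exact: (ultra_nonempty FU (filterI (Uoo nk.2.+1) (filterI (eps_small (n0 nk.1))
    (pos_uniform delta0 (surv_le (ltW tt1) st1) (n0 nk.1))))).
have [f hf] := choice ex.
pose phi := fix phi n := if n is n'.+1 then f (n, phi n') else f (0%N, 0%N).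
have phi_close n : close n (phi n).
  by case: n => [|n]; [exact: (hf (0, 0)%N).2|exact: (hf (n.+1, phi n)).2].
exists phi; split.
  apply: homo_ltn; first exact: ltn_trans.
  by move=> n; have [] := hf (n.+1, phi n).
pose q t := box_of (pos^~ t).
have qs s : (fun t => inward_position (q t) s) = pos s.
  by apply/funext => t; rewrite inward_position_box_of.
have q0 : q 0 = box_of p0 by rewrite /q; congr box_of; apply/funext => s; exact: pos0.
(* The initial set must be [A] itself, which may contain any part of its boundary; at later times
   the closed box is taken. *)
pose At t := if t == 0 then A else box_closure (q t).
have len t : lifetime lifespan t -> forall s, 0 < box_length (pos^~ t) s.
  move=> /lifetime_surv[t1 [delta [tt1 _ delta0 st1]]] s.
  exact: lt_le_trans delta0 (length_ge s delta0 (surv_le (ltW tt1) st1)).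
have lenE t : lifetime lifespan t -> forall s, side_length (q t) s = box_length (pos^~ t) s.
  by move=> /len lt s; apply: side_length_box_of => s'; exact: ltW.
have rAt t : lifetime lifespan t -> rectangle_with_box (q t) (At t).
  move=> lt; rewrite /At; case: eqP => [->|_]; first by rewrite q0.
  have := len t lt LeftSide; have := len t lt LowerSide.
  rewrite /box_length/= => h1 h2; split; rewrite /q/=; [lra|lra| |by []].
  by move=> x /= [/andP[? ?] /andP[? ?]]; split; apply/andP; split; exact: ltW.
exists lifespan, At, q, (fun s t => 'D_1 (pos s) t); split => //.
- split; first exact: lifespan_gt0.
  move=> T' TE; have [s hs] := lifespan_extinction TE; exists s.
  have T'0 : 0 < T' by have := lifespan_gt0; rewrite TE.
  apply: cvg_trans hs; apply: near_eq_cvg; near=> t.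
  apply: esym; apply: lenE; split; rewrite ?TE ?lte_fin; first by near: t; apply: nbhs_left_ge.
  by near: t; exact: nbhs_left_lt.
- by rewrite /At eqxx.
- move=> K cK KT e e0.
  have e8 : 0 < e / 8 by rewrite divr_gt0.
  (* Compactness turns the pointwise bound [t < tau n] for large [n] into one that is uniform on
     [K]. *)
  have KP : \forall n \near \oo, K `<=` [set t | t <= tau n].
    move/compact_near_coveringP: cK; apply => t /KT lt.
    have [t1 [delta [tt1 [t0 _] delta0 st1]]] := lifetime_surv lt.
    have [N hN] := tau_lim t1 (conj (le_trans t0 (ltW tt1))
      (surv_lifespan delta0 (le_trans t0 (ltW tt1)) st1)).
    exists ([set u | u < t1], [set n | (N <= n)%N]); first by split; [exact: lt_nbhsl|exists N].
    by move=> [u n] /= [ut /hN h]; apply: ltW; exact: lt_trans h.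
  have nP : \forall n \near \oo, n.+1%:R^-1 <= e / 8.
    exists (Num.truncn (e / 8)^-1) => // n /= nN.
    rewrite -[leRHS]invrK lef_pV2 ?posrE ?ltr0n ?invr_gt0//.
    by apply: le_trans (ltW (truncnS_gt _)) _; rewrite ler_nat ltnS.
  apply: filterS2 KP nP => n KP nP t Kt; have lt := KT _ Kt; have [t0 _] := lt.
  have [en /(_ t t0 (KP t Kt)) [[AE lp] cl]] := phi_close n.
  rewrite flowE// AE (_ : e = 4 * (e / 4)); last by field.
  apply: (hausdorff_dist_le _ (rectangle_gbox (eps_gt0 _) lp) (rAt t lt)); first by rewrite divr_gt0.
  move=> s; rewrite !inward_position_box_of /grid_position addrAC (le_trans (ler_normD _ _))//.
  have := cl s; have : `|half_shift (eps (phi n)) s| <= eps (phi n).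
    by have := eps_gt0 (phi n); case: s; rewrite /half_shift ?normrN gtr0_norm ?divr_gt0//; lra.
  move=> h1 h2; rewrite (_ : e / 4 = e / 8 + e / 8); last by field.
  by apply: lerD; [exact: le_trans h2 nP|exact: le_trans h1 (le_trans (ltW en) nP)].
- move=> s; rewrite qs; split; first exact: pos_locally_lipschitz.
  apply: filterS (pos_ae_derivable s) => t dt lt; have {}dt := dt lt.
  have [t1 [delta [tt1 [t0 _] delta0 st1]]] := lifetime_surv lt.
  split; first exact: derivableP.
  by rewrite lenE//; exact: pos_velocity_law delta0 st1 t0 tt1 dt.
Unshelve. all: by end_near. Qed.

End DiscreteFlow.

Lemma enorm_vert {R : realType} (x y z : R) : enorm ((x, y) - (x, z)) = `|y - z|.
Proof. by rewrite /enorm/= subrr expr0n add0r sqrtr_sqr. Qed.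

Lemma enorm_horiz {R : realType} (x y z : R) : enorm ((y, x) - (z, x)) = `|y - z|.
Proof. by rewrite /enorm/= subrr expr0n addr0 sqrtr_sqr. Qed.

Lemma zpointMn {R : realType} (a b : int) (m : nat) :
  zpoint ((a, b) *+ m) = ((a * m%:Z)%:~R, (b * m%:Z)%:~R) :> R * R.
Proof. by rewrite /zpoint pairMnE /= -[a *+ m]mulr_natr -[b *+ m]mulr_natr natz. Qed.

(** * The two families of lines and the means of the field along them *)

Section Means.
Context {R : realType} {d : measure_display} {T : measurableType d}.
Variables (P : probability T R) (C : R) (m : nat) (c : R * R -> {RV P >-> R}) (alpha : nat -> R).
Hypotheses (C_gt0 : 0 < C) (m_gt0 : (0 < m)%N).
Hypothesis c_bounded : {ae P, forall w, forall xi, dual_lattice xi -> `|c xi w| <= C}.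
Hypothesis c_stationary : stationary_field m c.
Hypothesis c_mixing : alpha_mixing c alpha.
Hypothesis alpha_summable : (\sum_(1 <= n <oo) (alpha n)%:E < +oo)%E.

(** The index of the line comes first, as [LineLln] expects, so horizontal edges are indexed by
    their row. *)
Let tmid (k j : int) : R * R := hmid j k.

Let v_dual k j : dual_lattice (@vmid R k j).
Proof. by apply/dual_latticeP; left; exists k, j. Qed.
Let h_dual k j : dual_lattice (tmid k j).
Proof. by apply/dual_latticeP; right; exists j, k. Qed.

Let v_dist k i j : enorm (@vmid R k i - vmid k j) = `|(i - j)%:~R|.
Proof. by rewrite enorm_vert rmorphB. Qed.
Let h_dist k i j : enorm (tmid k i - tmid k j) = `|(i - j)%:~R|.
Proof. by rewrite enorm_horiz rmorphB. Qed.

Let v_shift k j a b : exists z,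
  @vmid R (k + a * m%:Z) (j + b * m%:Z) = vmid k j + zpoint (z *+ m).
Proof.
exists (a, b); rewrite zpointMn /vmid.
by rewrite [(k + _)%:~R]rmorphD [(j + _)%:~R]rmorphD addrAC.
Qed.
Let h_shift k j a b : exists z,
  tmid (k + a * m%:Z) (j + b * m%:Z) = tmid k j + zpoint (z *+ m).
Proof.
exists (b, a); rewrite zpointMn /tmid /hmid.
by rewrite [(k + _)%:~R]rmorphD [(j + _)%:~R]rmorphD addrAC.
Qed.

Lemma mean_verticalE k : mean_vertical m c k = periodic_mean m c (@vmid R) k.
Proof.
rewrite /mean_vertical [in RHS](divz_eq k m%:Z) [in RHS]addrC.
rewrite (periodic_mean_per C_gt0 c_bounded c_stationary v_dual v_shift).
by rewrite (periodic_meanE _ C_gt0 c_bounded v_dual).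
Qed.

Lemma mean_horizontalE k : mean_horizontal m c k = periodic_mean m c tmid k.
Proof.
rewrite /mean_horizontal [in RHS](divz_eq k m%:Z) [in RHS]addrC.
rewrite (periodic_mean_per C_gt0 c_bounded c_stationary h_dual h_shift).
by rewrite (periodic_meanE _ C_gt0 c_bounded h_dual).
Qed.

Lemma side_sequence_le s k : `|side_sequence m c s k| <= C.
Proof.
by case: s; rewrite /side_sequence ?mean_verticalE ?mean_horizontalE;
  apply: (periodic_mean_le C_gt0 m_gt0 c_bounded).
Qed.

Lemma side_sequence_per s k : side_sequence m c s (k + m%:Z) = side_sequence m c s k.
Proof.
have pv k' a := periodic_mean_per C_gt0 c_bounded c_stationary v_dual v_shift k' a.
have ph k' a := periodic_mean_per C_gt0 c_bounded c_stationary h_dual h_shift k' a.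
have e (x : int) : - (x + m%:Z) = - x + (-1) * m%:Z by rewrite opprD mulN1r.
by case: s; rewrite /side_sequence ?mean_verticalE ?mean_horizontalE ?e ?pv ?ph//
  -[X in _ + X]mul1r ?pv ?ph.
Qed.

Lemma ae_lln : {ae P, forall w,
  line_lln (fun xi => c xi w) (mean_vertical m c) (mean_horizontal m c)}.
Proof.
have hv := ae_line_lln C_gt0 m_gt0 c_bounded c_stationary c_mixing alpha_summable
  v_dual v_dist v_shift.
have hh := ae_line_lln C_gt0 m_gt0 c_bounded c_stationary c_mixing alpha_summable
  h_dual h_dist h_shift.
apply: filterS2 hv hh => w hv hh D eta D0 eta0.
have [e1 e10 h1] := hv D eta D0 eta0; have [e2 e20 h2] := hh D eta D0 eta0.
exists (Num.min e1 e2); first by rewrite lt_min e10.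
move=> eps /andP[eps0]; rewrite lt_min => /andP[ee1 ee2] k u v uv kD uD vD.
rewrite mean_verticalE mean_horizontalE; split.
  by apply: h1 => //; rewrite eps0.
by apply: h2 => //; rewrite eps0.
Qed.

End Means.

Theorem theorem3p8 (R : realType) (d : measure_display) (Omega : measurableType d)
    (P : probability Omega R) (gamma : R) (m : nat)
    (c : R * R -> {RV P >-> R}) (alpha : nat -> R)
    (P_complete : measure_is_complete P)
    (gamma_gt0 : 0 < gamma) (m_gt0 : (0 < m)%N)
    (c_bounded : {ae P, forall w,
       (ereal_sup [set `|c xi w|%:E | xi in dual_lattice]
          < ((4 * gamma)^-1)%:E)%E})
    (c_stationary : stationary_field m c)
    (c_mixing : alpha_mixing c alpha)
    (alpha_summable : (\sum_(1 <= n <oo) (alpha n)%:E < +oo)%E) :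
  {ae P, forall w,
    forall (eps : nat -> R) (A0 : nat -> set (R * R)) (A : set (R * R))
           (flow : nat -> R -> set (R * R)),
      (forall j, 0 < eps j) -> nonincreasing_seq eps ->
      eps @ \oo --> (0 : R) ->
      (forall j, lattice_set (eps j) (A0 j)) ->
      (forall j, coordinate_rectangle (A0 j)) ->
      coordinate_rectangle A ->
      hausdorff_dist (A0 j) A @[j --> \oo] --> 0%E ->
      (forall j, discrete_flat_flow gamma (eps j) (fun xi => c xi w)
                   (A0 j) (flow j)) ->
    exists phi : nat -> nat, {homo phi : i j / (i < j)%N} /\
    exists (T : \bar R) (At : R -> set (R * R)) (q : R -> box R)
           (v : side -> R -> R),
      [/\ extinction_time T q,
          At 0 = A,
          forall t, lifetime T t -> rectangle_with_box (q t) (At t),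
          converges_locally_in_time T (fun j => flow (phi j)) At &
          forall s : side,
            locally_lipschitz_on (lifetime T)
              (fun t => inward_position (q t) s) /\
            {ae (@lebesgue_measure R), forall t, lifetime T t ->
               is_derive t 1 (fun u => inward_position (q u) s) (v s t) /\
               velocity_law gamma m (side_sequence m c s)
                 (side_length (q t) s) (v s t)}]}.
Proof.
pose C := (4 * gamma)^-1.
have C0 : 0 < C by rewrite invr_gt0 mulr_gt0.
have C4 : 4 * C = gamma^-1 by rewrite /C; field; rewrite gt_eqF.
have cC : {ae P, forall w, forall xi, dual_lattice xi -> `|c xi w| <= C}.
  apply: filterS c_bounded => w cw xi xi_dual; rewrite -lee_fin; apply: le_trans (ltW cw).
  by apply: ereal_sup_ubound; exists xi.
have lln := ae_lln C0 m_gt0 cC c_stationary c_mixing alpha_summable.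
apply: filterS2 c_bounded lln => w cw lln.
(* The constant [C] bounds the means and does not depend on [w], but gives only 4 C = 1/gamma. The
   one-step analysis needs a strict inequality, supplied by the supremum of the field at this
   [w]. *)
have [C' [C'0 C'4 c_le]] : exists C', [/\ 0 <= C', 4 * C' < gamma^-1 &
    forall xi, dual_lattice xi -> `|c xi w| <= C'].
  have ub xi : dual_lattice xi ->
      (`|c xi w|%:E <= ereal_sup [set `|c xi w|%:E | xi in dual_lattice])%E.
    by move=> xi_dual; apply: ereal_sup_ubound; exists xi.
  have x0 : dual_lattice (@vmid R 0 0) by apply/dual_latticeP; left; exists 0, 0.
  move: cw ub; case: (ereal_sup _) => [r| |] // rC ub.
    exists r; split; first by have := ub _ x0; rewrite lee_fin; exact: le_trans.
      by rewrite -C4 ltr_pM2l// -lte_fin.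
    by move=> xi /ub; rewrite lee_fin.
  by have := ub _ x0; rewrite leNgt ltNyr.
move=> eps A0 A flow eps0 _ eps_cvg A0l A0r [qA qAA] A0A flowP.
have [Ak AkP] := choice flowP.
(* An ultrafilter finer than the filter at infinity contains everything that holds for all large
   [j]. *)
have [U [FU Uoo]] := @ultraFilterLemma _ \oo _.
have eps_small e : 0 < e -> \forall j \near \oo, eps j < e.
  move=> e0; move/cvgrPdist_lt/(_ e e0): eps_cvg; apply: filterS => j.
  by rewrite sub0r normrN gtr0_norm.
have fb j : is_fbox eps Ak j 0 (fbox eps Ak j 0).
  have [q qA0] := A0r j; have [ib A0E ib0] := lattice_rectangleP (eps0 j) (A0l j) qA0.
  have h : is_fbox eps Ak j 0 ib by split => //; have [-> _ _ _] := AkP j.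
  by rewrite (fboxP eps0 h).
have [hx hy _ _] := qAA.
apply: (flow_limit gamma_gt0 m_gt0 (side_sequence_per C0 cC c_stationary)
  (side_sequence_le C0 m_gt0 cC c_stationary) _ _ eps0 (Ak := Ak) (p0 := inward_position qA)
  (c := fun xi => c xi w) (C := C) _ FU).
- by rewrite C4.
- move=> delta D eta delta0 D0 eta0.
  have [K [e1 [e10 h]]] := minimizer_of_rectangle gamma_gt0 C'0 C'4 c_le lln delta0 D0 eta0.
  by exists K, e1; split=> // e ib E e0 hD hd hm; have [N hN] := h e ib E e0 hD hd hm; exists N.
- move=> j k; have [_ l mn _] := AkP j; split; [exact: l|exact: mn].
- by move=> e e0; apply: Uoo; exact: eps_small.
- by apply: Uoo; exists 0%N => // j _; exact: fb.
- move=> s e e0; have e2 : 0 < e / 2 by rewrite divr_gt0.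
  apply: Uoo.
  have near_dist : \forall j \near \oo, (hausdorff_dist (A0 j) A < (e / 2)%:E)%E.
    have nb : nbhs (0%E : \bar R) [set y | (y < (e / 2)%:E)%E].
      by apply: open_nbhs_nbhs; split; [exact: open_ereal_lt_ereal|rewrite /= lte_fin].
    exact: A0A _ nb.
  apply: filterS2 near_dist (eps_small _ e2) => j hd ej.
  have [A0E ib0] := fb j; have [Ak0 _ _ _] := AkP j.
  have rg := rectangle_gbox (eps0 j) ib0; rewrite -A0E Ak0 in rg.
  have := inward_position_close rg qAA hd s.
  rewrite inward_position_box_of /grid_position addrAC => h1.
  have h2 : `|half_shift (eps j) s| <= eps j / 2.
    by case: s {h1} => /=; rewrite ?normrN gtr0_norm// divr_gt0.
  have := ler_normB (eps j * (fbox eps Ak j 0 s)%:~R - inward_position qA s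
    + half_shift (eps j) s) (half_shift (eps j) s); rewrite addrK.
  move=> h3; apply: (le_trans h3); rewrite [leRHS]splitr; apply: (lerD h1 (le_trans h2 _)).
  by rewrite ler_pM2r ?invr_gt0// (le_trans (ltW ej))// ler_pdivrMr// ler_peMr ?(ltW e0)// ler1n.
- by case; rewrite /box_length /=; lra.
- by move=> N; apply: Uoo; exists N.
- by rewrite box_of_inward_position.
- by move=> j t t0; have [_ _ _] := AkP j; exact.
Qed.
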